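(* Let $R$ be a Henselian local ring, let $n\ge0$ be an integer, and let $\mathcal X$ be a resolving subcategory of $\operatorname{mod}R$ satisfying the following three conditions. (1) The $R$-modules of projective dimension less than $n$ are in $\mathcal X$. (2) For each $R$-sequence $\boldsymbol x=x_1,\dots,x_n$ the module $R/\boldsymbol xR$ belongs to $\mathcal X$. (3) For all $X\in\mathcal X$ the module $\Omega^{n+1}X$ is $(n+1)$-torsionfree. If $\operatorname{Ext}^{3n+1}_{\operatorname{mod}\underline{\mathcal X}}(\operatorname{mod}\underline{\mathcal X},\operatorname{proj}(\operatorname{mod}\underline{\mathcal X}))=0$ (that is, $\operatorname{Ext}^{3n+1}_{\operatorname{mod}\underline{\mathcal X}}(F,P)=0$ for all $F\in\operatorname{mod}\underline{\mathcal X}$ and all projective $P\in\operatorname{mod}\underline{\mathcal X}$), then $\operatorname{Ext}_R^{>n}(\mathcal X,R)=0$ (that is, $\operatorname{Ext}_R^i(X,R)=0$ for all $i>n$ and $X\in\mathcal X$).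
   Context: Rings are commutative noetherian; $\operatorname{mod}R$ is the category of finitely generated $R$-modules and all modules are finitely generated. Subcategories are strictly full. A subcategory $\mathcal X$ of $\operatorname{mod}R$ is resolving if it contains the projective modules and is closed under finite direct sums, direct summands, extensions, and kernels of epimorphisms. $\underline{\mathcal X}$ is the stable category: same objects as $\mathcal X$, morphisms taken modulo those factoring through projective modules. $\operatorname{mod}\underline{\mathcal X}$ is the category of finitely presented $\underline{\mathcal X}$-modules, i.e. additive contravariant functors $F$ from $\underline{\mathcal X}$ to abelian groups admitting an exact sequence $\operatorname{Hom}_{\underline{\mathcal X}}(-,X)\to\operatorname{Hom}_{\underline{\mathcal X}}(-,Y)\to F\to0$ with $X,Y\in\underline{\mathcal X}$; it is an abelian category with enough projectives, and $\operatorname{proj}(\operatorname{mod}\underline{\mathcal X})$ denotes its projective objects. $\Omega^mX$ is the $m$th syzygy of $X$ (unique up to projective summands). The transpose $\operatorname{Tr}X$ is the cokernel of $\operatorname{Hom}_R(\phi,R)$, where $F_1\xrightarrow{\phi}F_0\to X\to0$ is a presentation by finitely generated free modules (unique up to free summands). A module $M$ is $m$-torsionfree if $\operatorname{Ext}_R^i(\operatorname{Tr}M,R)=0$ for all $1\le i\le m$. *)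

(* Defs.v *)
From HB Require Import structures.
From mathcomp Require Import all_boot all_algebra.
From mathcomp Require Import mathcomp_extra boolp.

Set Implicit Arguments.
Unset Strict Implicit.
Unset Printing Implicit Defensive.
#[local] Obligation Tactic := idtac.
Import GRing.Theory.
Local Open Scope ring_scope.
Local Open Scope quotient_scope.

Section Modules.
Variable R : comNzRingType.

Definition span (M : lmodType R) (s : seq M) (x : M) : Prop :=
  exists c : nat -> R, x = \sum_(i < size s) c i *: s`_i.

Definition fin_gen (M : lmodType R) : Prop := exists s : seq M, forall x, span s x.

Definition surj (A B : Type) (f : A -> B) : Prop := forall y, exists x, f x = y.

Definition exact (A B C : lmodType R) (f : A -> B) (g : B -> C) : Prop :=
  forall y, g y = 0 <-> exists x, f x = y.

Definition short_exact (A B C : lmodType R) (f : A -> B) (g : B -> C) : Prop :=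
  [/\ injective f, exact f g & surj g].

Definition isomorphic (M N : lmodType R) : Prop :=
  exists f : {linear M -> N}, bijective f.

Definition projective_module (P : lmodType R) : Prop :=
  forall (A B : lmodType R) (p : {linear A -> B}) (g : {linear P -> B}),
    surj p -> exists h : {linear P -> A}, p \o h =1 g.

Definition fg_projective (P : lmodType R) : Prop :=
  fin_gen P /\ projective_module P.

Definition lhom (M N : lmodType R) : Type := {linear M -> N}.

Section LHom.
Variables M N : lmodType R.
Implicit Types f g h : lhom M N.

HB.instance Definition _ := gen_eqMixin (lhom M N).
HB.instance Definition _ := gen_choiceMixin (lhom M N).

Lemma lhomP f g : (f : M -> N) =1 g -> f = g.
Proof.
case: f g => [f [[f1] [f2]]] [g [[g1] [g2]]] /= /funext E; case: _ / E in g1 g2 *.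
by rewrite (Prop_irrelevance f1 g1) (Prop_irrelevance f2 g2).
Qed.

Definition lhom0 : lhom M N := \0 : {linear M -> N}.
Definition lhom_opp f : lhom M N := \- f : {linear M -> N}.
Definition lhom_add f g : lhom M N := f \+ g : {linear M -> N}.
Definition lhom_scale a f : lhom M N := a \*: f : {linear M -> N}.

Lemma lhom_addA : associative lhom_add.
Proof. by move=> f g h; apply: lhomP => x /=; rewrite addrA. Qed.
Lemma lhom_addC : commutative lhom_add.
Proof. by move=> f g; apply: lhomP => x /=; rewrite addrC. Qed.
Lemma lhom_add0 : left_id lhom0 lhom_add.
Proof. by move=> f; apply: lhomP => x /=; rewrite add0r. Qed.
Lemma lhom_addN : left_inverse lhom0 lhom_opp lhom_add.
Proof. by move=> f; apply: lhomP => x /=; rewrite addNr. Qed.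

HB.instance Definition _ :=
  GRing.isZmodule.Build (lhom M N) lhom_addA lhom_addC lhom_add0 lhom_addN.

Lemma lhom_scaleA a b f : lhom_scale a (lhom_scale b f) = lhom_scale (a * b) f.
Proof. by apply: lhomP => x /=; rewrite scalerA. Qed.
Lemma lhom_scale1 : left_id 1 lhom_scale.
Proof. by move=> f; apply: lhomP => x /=; rewrite scale1r. Qed.
Lemma lhom_scaleDr : right_distributive lhom_scale +%R.
Proof. by move=> a f g; apply: lhomP => x /=; rewrite scalerDr. Qed.
Lemma lhom_scaleDl f : {morph lhom_scale^~ f : a b / a + b}.
Proof. by move=> a b; apply: lhomP => x /=; rewrite scalerDl. Qed.

HB.instance Definition _ := GRing.Zmodule_isLmodule.Build R (lhom M N)
  lhom_scaleA lhom_scale1 lhom_scaleDr lhom_scaleDl.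

End LHom.

Definition lid (M : lmodType R) : lhom M M := idfun : {linear M -> M}.
Definition lcomp (M N L : lmodType R) (g : lhom N L) (f : lhom M N) : lhom M L :=
  g \o f : {linear M -> L}.

Record fg_resolution (M : lmodType R) := FgResolution {
  fres_mod :> nat -> lmodType R;
  fres_d : forall i, {linear fres_mod i.+1 -> fres_mod i};
  fres_aug : {linear fres_mod 0%N -> M};
  fres_proj : forall i, fg_projective (fres_mod i);
  fres_surj : surj fres_aug;
  fres_exact0 : exact (fres_d 0) fres_aug;
  fres_exact : forall i, exact (fres_d i.+1) (fres_d i) }.

(* The complex Hom(P, N) has zero cohomology in degree i. *)
Definition fres_acyclic (M : lmodType R) (P : fg_resolution M) (i : nat)
    (N : lmodType R) : Prop :=
  forall g : {linear P i -> N}, (forall x, g (fres_d P i x) = 0) ->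
    match i return {linear P i -> N} -> Prop with
    | 0 => fun g => forall x, g x = 0
    | j.+1 => fun g => exists h : {linear P j -> N}, h \o fres_d P j =1 g
    end g.

(* Ext_R^i(M, N) = 0, to be used for M finitely generated over R noetherian, so
   that M has such resolutions; the cohomology does not depend on the choice. *)
Definition Ext_module_zero (i : nat) (M N : lmodType R) : Prop :=
  forall P : fg_resolution M, fres_acyclic P i N.

(* For n = 0 this says that M = 0. *)
Definition pd_lt (n : nat) (M : lmodType R) : Prop :=
  exists P : fg_resolution M, forall i, (n <= i)%N -> forall x : P i, x = 0.

Fixpoint is_syzygy (m : nat) (M N : lmodType R) : Prop :=
  if m is m'.+1 then
    exists (K P : lmodType R) (f : {linear K -> P}) (p : {linear P -> M}),
      [/\ fg_projective P, short_exact f p & is_syzygy m' K N]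
  else isomorphic M N.

(* T is the cokernel of Hom(phi, R) for some presentation
   F_1 -phi-> F_0 -> M -> 0 by finitely generated free modules. *)
Definition is_transpose (M T : lmodType R) : Prop :=
  exists (p q : nat) (phi : {linear 'rV[R]_p -> 'rV[R]_q})
         (pi : {linear 'rV[R]_q -> M})
         (t : {linear lhom 'rV[R]_p R^o -> T}),
    [/\ exact phi pi, surj pi,
        exact (fun g : lhom 'rV[R]_q R^o => lcomp g phi) t & surj t].

Definition torsionfree (m : nat) (M : lmodType R) : Prop :=
  forall T, is_transpose M T ->
  forall i, (1 <= i <= m)%N -> Ext_module_zero i T R^o.

(* A strictly full subcategory of mod R is given by a class of finitely
   generated modules that is closed under isomorphism. *)
Record resolving (X : lmodType R -> Prop) : Prop := Resolving {
  resolving_fg : forall M, X M -> fin_gen M;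
  resolving_iso : forall M N, isomorphic M N -> X M -> X N;
  resolving_proj : forall P, fg_projective P -> X P;
  resolving_sum : forall M N, X M -> X N -> X (M * N)%type;
  resolving_summand : forall M N : lmodType R, X (M * N)%type -> X M;
  resolving_ext : forall (A B C : lmodType R)
    (f : {linear A -> B}) (g : {linear B -> C}),
    short_exact f g -> X A -> X C -> X B;
  resolving_ker : forall (A B C : lmodType R)
    (f : {linear A -> B}) (g : {linear B -> C}),
    short_exact f g -> X B -> X C -> X A }.

Definition gen_ideal (s : seq R) : R -> Prop := @span R^o s.

Definition regular_seq (s : seq R) : Prop :=
  (forall i, (i < size s)%N -> forall a,
     gen_ideal (take i s) (s`_i * a) -> gen_ideal (take i s) a) /\
  ~ gen_ideal s 1.

(* M is isomorphic to R / sR. *)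
Definition is_quotient_ring_module (s : seq R) (M : lmodType R) : Prop :=
  exists p : {linear R^o -> M}, surj p /\ forall a, p a = 0 <-> gen_ideal s a.

Definition is_ideal (I : R -> Prop) : Prop :=
  [/\ I 0, forall a b, I a -> I b -> I (a + b) & forall a b, I b -> I (a * b)].

Definition noetherian : Prop :=
  forall I, is_ideal I -> exists s, forall a, I a <-> gen_ideal s a.

Definition is_maximal (m : R -> Prop) : Prop :=
  [/\ is_ideal m, ~ m 1 &
      forall I, is_ideal I -> ~ I 1 -> (forall a, m a -> I a) ->
      forall a, I a -> m a].

Definition is_local (m : R -> Prop) : Prop :=
  is_maximal m /\ forall m', is_maximal m' -> forall a, m' a <-> m a.

(* Every simple root, in the residue field R/m, of a monic polynomial over R
   lifts to a root in R. *)
Definition henselian_local : Prop :=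
  exists m : R -> Prop, is_local m /\
    forall (f : {poly R}) (a : R), f \is monic ->
      m f.[a] -> ~ m f^`().[a] -> exists b, root f b /\ m (b - a).

End Modules.

(* Only the zero morphisms of an abelian category are needed to express the
   vanishing of Ext; they are kept as the only structure so that hom-types may
   live in a universe larger than that of zmodType. *)
Record pointed_cat := PointedCat {
  pob :> Type;
  phom : pob -> pob -> Type;
  pid : forall A, phom A A;
  pcomp : forall A B C, phom B C -> phom A B -> phom A C;
  pzero : forall A B, phom A B;
  pcompA : forall A B C D (h : phom C D) (g : phom B C) (f : phom A B),
    pcomp h (pcomp g f) = pcomp (pcomp h g) f;
  pcomp1l : forall A B (f : phom A B), pcomp (pid B) f = f;
  pcomp1r : forall A B (f : phom A B), pcomp f (pid A) = f;
  pcomp0l : forall A B C (f : phom A B), pcomp (pzero B C) f = pzero A C;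
  pcomp0r : forall A B C (g : phom B C), pcomp g (pzero A B) = pzero A C }.

Arguments pid {p} A.
Arguments pzero {p} A B.

Section Abelian.
Variable A : pointed_cat.

Definition epi (X Y : A) (f : phom X Y) : Prop :=
  forall Z (u v : phom Y Z), pcomp u f = pcomp v f -> u = v.

Definition is_kernel (K X Y : A) (k : phom K X) (f : phom X Y) : Prop :=
  pcomp f k = pzero K Y /\
  forall T (h : phom T X), pcomp f h = pzero T Y ->
    exists! u : phom T K, pcomp k u = h.

(* im f = ker g, stated through the factorization of f over its image. *)
Definition exact_at (X Y Z : A) (f : phom X Y) (g : phom Y Z) : Prop :=
  exists (K : A) (k : phom K Y) (e : phom X K),
    [/\ is_kernel k g, epi e & pcomp k e = f].

Definition projective (P : A) : Prop :=
  forall (X Y : A) (p : phom X Y) (g : phom P Y), epi p ->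
    exists h : phom P X, pcomp p h = g.

Record resolution (F : A) := Resolution {
  res_ob :> nat -> A;
  res_d : forall i, phom (res_ob i.+1) (res_ob i);
  res_aug : phom (res_ob 0%N) F;
  res_proj : forall i, projective (res_ob i);
  res_epi : epi res_aug;
  res_exact0 : exact_at (res_d 0) res_aug;
  res_exact : forall i, exact_at (res_d i.+1) (res_d i) }.

(* The complex Hom(P, G) has zero cohomology in degree i. *)
Definition res_acyclic (F : A) (P : resolution F) (i : nat) (G : A) : Prop :=
  forall g : phom (P i) G, pcomp g (res_d P i) = pzero _ _ ->
    match i return phom (P i) G -> Prop with
    | 0 => fun g => g = pzero _ _
    | j.+1 => fun g => exists h : phom (P j) G, pcomp h (res_d P j) = g
    end g.

(* Ext_A^i(F, G) = 0, to be used for A abelian with enough projectives, so that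
   F has resolutions; the cohomology does not depend on the choice. *)
Definition Ext_zero (i : nat) (F G : A) : Prop :=
  forall P : resolution F, res_acyclic P i G.

End Abelian.

Record preadditive := Preadditive {
  ob :> Type;
  hom : ob -> ob -> zmodType;
  idm : forall a, hom a a;
  comp : forall a b c, hom b c -> hom a b -> hom a c;
  compA : forall a b c d (h : hom c d) (g : hom b c) (f : hom a b),
    comp h (comp g f) = comp (comp h g) f;
  comp1l : forall a b (f : hom a b), comp (idm b) f = f;
  comp1r : forall a b (f : hom a b), comp f (idm a) = f;
  compDl : forall a b c (g g' : hom b c) (f : hom a b),
    comp (g + g') f = comp g f + comp g' f;
  compDr : forall a b c (g : hom b c) (f f' : hom a b),
    comp g (f + f') = comp g f + comp g f' }.

Arguments idm {p} a.

Section FunctorModules.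
Variable C : preadditive.

(* additive contravariant functors from C to abelian groups *)
Record cmodule := CModule {
  cm_ob :> C -> zmodType;
  cm_map : forall a b, hom a b -> cm_ob b -> cm_ob a;
  cm_mapDr : forall a b (f : hom a b) x y,
    cm_map f (x + y) = cm_map f x + cm_map f y;
  cm_mapDl : forall a b (f g : hom a b) x,
    cm_map (f + g) x = cm_map f x + cm_map g x;
  cm_map1 : forall a x, cm_map (idm a) x = x;
  cm_mapM : forall a b c (g : hom b c) (f : hom a b) x,
    cm_map (comp g f) x = cm_map f (cm_map g x) }.

Record nat_trans (F G : cmodule) := NatTrans {
  nt_map :> forall a : C, F a -> G a;
  nt_mapD : forall a (x y : F a), @nt_map a (x + y) = @nt_map a x + @nt_map a y;
  nt_nat : forall a b (f : hom a b) x,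
    @nt_map a (cm_map f x) = cm_map f (@nt_map b x) }.

Arguments nt_map {F G} n a x.

Lemma nat_transP (F G : cmodule) (s t : nat_trans F G) :
  (forall a x, s a x = t a x) -> s = t.
Proof.
case: s t => [s s1 s2] [t t1 t2] /= E.
have {}E : s = t by apply: functional_extensionality_dep => a; apply/funext/E.
case: _ / E in t1 t2 *.
by rewrite (Prop_irrelevance s1 t1) (Prop_irrelevance s2 t2).
Qed.

Definition nt_id (F : cmodule) : nat_trans F F :=
  @NatTrans F F (fun a x => x) (fun _ _ _ => erefl) (fun _ _ _ _ => erefl).

Program Definition nt_comp (F G H : cmodule) (t : nat_trans G H) (s : nat_trans F G) :
  nat_trans F H := @NatTrans F H (fun a x => t a (s a x)) _ _.
Next Obligation. by move=> * /=; rewrite !nt_mapD. Qed.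
Next Obligation. by move=> * /=; rewrite !nt_nat. Qed.

Lemma cm_map0 (F : cmodule) a b (f : hom a b) : cm_map f (0 : F b) = 0.
Proof. by apply: (addrI (cm_map f (0 : F b))); rewrite -cm_mapDr !addr0. Qed.

Lemma nt_map0 (F G : cmodule) (t : nat_trans F G) a : t a 0 = 0.
Proof. by apply: (addrI (t a 0)); rewrite -nt_mapD !addr0. Qed.

Program Definition nt_zero (F G : cmodule) : nat_trans F G :=
  @NatTrans F G (fun a x => 0) _ _.
Next Obligation. by move=> * /=; rewrite addr0. Qed.
Next Obligation. by move=> * /=; rewrite cm_map0. Qed.

Definition representable (c : C) : cmodule :=
  @CModule (fun a => hom a c) (fun a b f g => comp g f)
    (fun a b f g g' => compDl g g' f) (fun a b f f' g => compDr g f f')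
    (fun a g => comp1r g) (fun a b d g f h => compA h g f).

Definition fin_presented (F : cmodule) : Prop :=
  exists (x y : C) (s : nat_trans (representable x) (representable y))
         (t : nat_trans (representable y) F),
    (forall a (v : hom a y), t a v = 0 <-> exists u, s a u = v) /\
    (forall a, surj (t a)).

Record fp_cmodule := FpCModule {
  fp_mod :> cmodule;
  fp_modP : fin_presented fp_mod }.

Program Definition fp_cat : pointed_cat :=
  @PointedCat fp_cmodule (fun F G => nat_trans F G) nt_id
    (fun F G H t s => nt_comp t s) nt_zero _ _ _ _ _.
Next Obligation. by move=> *; apply: nat_transP. Qed.
Next Obligation. by move=> *; apply: nat_transP. Qed.
Next Obligation. by move=> *; apply: nat_transP. Qed.
Next Obligation. by move=> *; apply: nat_transP. Qed.
Next Obligation. by move=> *; apply: nat_transP => a x /=; rewrite nt_map0. Qed.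

End FunctorModules.

Arguments nt_map {C F G} n a x.

Section Stable.
Variable R : comNzRingType.

Definition factors_proj (M N : lmodType R) (f : lhom M N) : Prop :=
  exists (P : lmodType R) (u : lhom M P) (v : lhom P N),
    fg_projective P /\ f = lcomp v u.

Lemma fg_projective0 : fg_projective 'rV[R]_0.
Proof.
split.
  by exists [::] => x; exists (fun=> 0); rewrite big_ord0 [x]thinmx0.
move=> A B p g _; exists (\0 : {linear 'rV[R]_0 -> A}) => x /=.
by rewrite [x]thinmx0 !linear0.
Qed.

Section PairMaps.
Variables P Q : lmodType R.

Definition pair_l (x : P) : (P * Q)%type := (x, 0).
Definition pair_r (y : Q) : (P * Q)%type := (0, y).

Lemma pair_l_linear : linear pair_l.
Proof. by move=> a x y; apply/pair_equal_spec; rewrite /= scaler0 addr0. Qed.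
Lemma pair_r_linear : linear pair_r.
Proof. by move=> a x y; apply/pair_equal_spec; rewrite /= scaler0 addr0. Qed.

HB.instance Definition _ := GRing.isLinear.Build R P (P * Q)%type _ pair_l pair_l_linear.
HB.instance Definition _ := GRing.isLinear.Build R Q (P * Q)%type _ pair_r pair_r_linear.

Lemma pair_lr (z : P * Q) : z = pair_l z.1 + pair_r z.2.
Proof. by case: z => x y; apply/pair_equal_spec; rewrite /= addr0 add0r. Qed.

Section Case.
Variables (N : lmodType R) (f : {linear P -> N}) (g : {linear Q -> N}).

Definition pair_case (z : P * Q) : N := f z.1 + g z.2.

Lemma pair_case_linear : linear pair_case.
Proof.
by move=> a x y; rewrite /pair_case !linearP scalerDr addrACA.
Qed.

HB.instance Definition _ :=
  GRing.isLinear.Build R (P * Q)%type N _ pair_case pair_case_linear.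

End Case.

Section Pairing.
Variables (M : lmodType R) (f : {linear M -> P}) (g : {linear M -> Q}).

Definition pairing (x : M) : (P * Q)%type := (f x, g x).

Lemma pairing_linear : linear pairing.
Proof. by move=> a x y; apply/pair_equal_spec; rewrite /= !linearP. Qed.

HB.instance Definition _ :=
  GRing.isLinear.Build R M (P * Q)%type _ pairing pairing_linear.

End Pairing.

Lemma fg_projective_sum :
  fg_projective P -> fg_projective Q -> fg_projective (P * Q)%type.
Proof.
move=> [[s sP] pP] [[t tQ] pQ]; split.
  exists (map pair_l s ++ map pair_r t) => -[x y].
  have [c ->] := sP x; have [d ->] := tQ y.
  exists (fun i => if (i < size s)%N then c i else d (i - size s)%N).
  rewrite [LHS]pair_lr /= !linear_sum /= size_cat !size_map big_split_ord /=.
  congr (_ + _); apply: eq_bigr => i _; rewrite linearZ /=.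
    by rewrite ltn_ord nth_cat size_map ltn_ord (nth_map 0).
  by rewrite nth_cat size_map ltnNge leq_addr /= addKn (nth_map 0).
move=> A B p g sp.
have [h1 e1] := pP _ _ p (g \o pair_l : {linear P -> B}) sp.
have [h2 e2] := pQ _ _ p (g \o pair_r : {linear Q -> B}) sp.
exists (pair_case h1 h2 : {linear (P * Q)%type -> A}) => z /=.
rewrite [in RHS](pair_lr z) linearD /pair_case linearD.
by congr (_ + _); [apply: e1 | apply: e2].
Qed.

End PairMaps.

Section StableHom.
Variables M N : lmodType R.

(* the subgroup divided out in the stable category *)
Definition proj_maps : {pred lhom M N} := fun f => `[< factors_proj f >].

Lemma proj_maps_zmod : zmod_closed proj_maps.
Proof.
split.
  apply/asboolP; exists 'rV[R]_0, 0, 0; split; first exact: fg_projective0.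
  exact: lhomP.
move=> f g /asboolP[P [u [v [pP ->]]]] /asboolP[Q [u' [v' [pQ ->]]]].
apply/asboolP; exists (P * Q)%type.
exists (pairing u u' : {linear _ -> _}), (pair_case v (- v') : {linear _ -> _}).
by split; [exact: fg_projective_sum | exact: lhomP].
Qed.

HB.instance Definition _ := GRing.isZmodClosed.Build (lhom M N) proj_maps
  proj_maps_zmod.

Definition stable_hom : zmodType := Quotient.quot proj_maps.

Definition stable_class (f : lhom M N) : stable_hom := \pi_(Quotient.quot proj_maps) f.

Definition stable_repr (a : stable_hom) : lhom M N := repr (a : Quotient.quot proj_maps).

Lemma stable_reprK a : stable_class (stable_repr a) = a.
Proof. exact: reprK. Qed.

Lemma stable_classP f g : stable_class f = stable_class g <-> factors_proj (f - g).
Proof.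
split=> [/eqP | fg]; last apply/eqP.
  by rewrite /stable_class -Quotient.idealrBE => /asboolP.
by rewrite /stable_class -Quotient.idealrBE; apply/asboolP.
Qed.

Lemma stable_classD f g : stable_class (f + g) = stable_class f + stable_class g.
Proof. exact: raddfD. Qed.

End StableHom.

Definition stable_comp (M N L : lmodType R) (b : stable_hom N L) (a : stable_hom M N) :
  stable_hom M L := stable_class (lcomp (stable_repr b) (stable_repr a)).

Lemma stable_compE (M N L : lmodType R) (g : lhom N L) (f : lhom M N) :
  stable_comp (stable_class g) (stable_class f) = stable_class (lcomp g f).
Proof.
apply/stable_classP.
set g' := stable_repr _; set f' := stable_repr _.
have /stable_classP[P [u [v [pP e]]]] : stable_class g' = stable_class g
  by exact: stable_reprK.
have /stable_classP[Q [u' [v' [pQ e']]]] : stable_class f' = stable_class f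
  by exact: stable_reprK.
exists (P * Q)%type.
exists (pairing (lcomp u f') u' : {linear _ -> _}).
exists (pair_case v (lcomp g v') : {linear _ -> _}).
split; first exact: fg_projective_sum.
apply: lhomP => x /=; rewrite /pair_case /=.
have := congr1 (fun h : lhom N L => h (f' x)) e.
have := congr1 (fun h : lhom M N => g (h x)) e'.
rewrite /= linearB => <- <-; by rewrite addrA subrK.
Qed.

Record stable_ob (X : lmodType R -> Prop) := StableOb {
  st_mod :> lmodType R;
  st_modP : X st_mod }.

Program Definition stable_cat (X : lmodType R -> Prop) : preadditive :=
  @Preadditive (stable_ob X) (fun M N => stable_hom M N)
    (fun M => stable_class (lid M)) (fun M N L b a => stable_comp b a) _ _ _ _ _.
Next Obligation.
move=> X a b c d h g f.
rewrite -(stable_reprK h) -(stable_reprK g) -(stable_reprK f) !stable_compE.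
by congr stable_class; apply: lhomP.
Qed.
Next Obligation.
move=> X a b f; rewrite -(stable_reprK f) stable_compE.
by congr stable_class; apply: lhomP.
Qed.
Next Obligation.
move=> X a b f; rewrite -(stable_reprK f) stable_compE.
by congr stable_class; apply: lhomP.
Qed.
Next Obligation.
move=> X a b c g g' f.
rewrite -(stable_reprK g) -(stable_reprK g') -(stable_reprK f).
rewrite -stable_classD !stable_compE -stable_classD.
by congr stable_class; apply: lhomP.
Qed.
Next Obligation.
move=> X a b c g f f'.
rewrite -(stable_reprK g) -(stable_reprK f) -(stable_reprK f').
rewrite -stable_classD !stable_compE -stable_classD.
by congr stable_class; apply: lhomP => x /=; rewrite linearD.
Qed.

Definition mod_stable (X : lmodType R -> Prop) : pointed_cat :=
  fp_cat (stable_cat X).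

End Stable.

(* Main.v *)
Require Import Defs.
From HB Require Import structures.
From mathcomp Require Import all_boot all_algebra.
From mathcomp Require Import boolp.
Import Defs.

(** Let m be the maximal ideal of R and k = R/m.  By dimension shift along a
    projective resolution it is enough to show, for every M in X, that each
    functional on the (n+1)-st syzygy K of M extends to the n-th projective
    P_n of the resolution (functionals_extend).  Suppose that some functional
    does not extend.

    What the vanishing of Ext says.  A short exact sequence 0 -> A -> B -> C -> 0
    in X gives, in the category of finitely presented modules over the stable
    category, the projective resolution

      ... -> Hom(-,A_1) -> Hom(-,B_1) -> Hom(-,C_1)
          -> Hom(-,A) -> Hom(-,B) -> Hom(-,C) -> F -> 0

    of the cokernel F of the last map between stable Hom functors; here A_j,
    B_j, C_j are the j-th syzygies.  The term of degree 3n+1 is Hom(-,B_n).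
    If A_n is projective, the identity of B_n is a cocycle, hence it factors
    stably through C_n.  Consequently the inclusion i of A_n in B_n has the form
    i = t q i with q from B_n to a projective module and t back
    (syzygy_inclusion_factors).

    Modules of finite projective dimension.  X contains every module of
    projective dimension at most n (X_pd_le).  If 0 -> K -> F -> W -> 0 is exact
    with F projective over R/J, J generated by a regular sequence, and W is of
    finite projective dimension over R/J, then some y regular on R/J kills the
    class of this sequence in Ext(W,K); pushing out along y shows that W is a
    summand of an extension of K/yK by F, and K/yK has smaller projective
    dimension over the next quotient R/(J+yR).  The induction ends at modules
    that are projective over R modulo a regular sequence.

    The universal extension.  As K is (n+1)-torsionfree, it has an exact
    coresolution by free left approximations K -> Q_0 -> ... -> Q_n.  Comparing
    it with the resolution of M gives an exact sequence 0 -> A -> B -> M -> 0 with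
    A of projective dimension at most n, whose n-th syzygy sequence starts with
    the free module Q_0 and through which the bad functional factors
    (universal_extension).  So A and B lie in X, i = t q i holds for i: Q_0 -> B_n,
    and there is a functional on Q_0 that does not extend along i.  Linear
    algebra modulo m then gives a unimodular u in Q_0 such that every functional
    on B_n maps i(u) into m (unimodular_vector).  As q goes to a projective
    module, q(i(u)) lies in m times that module.

    The residue field.  Multiplication by an element of m is null-homotopic on
    a resolution of k, so i(u) = t q i(u) and the syzygy C_n = Omega^n M yield
    Ext^j(k,R) = 0 for j <= n (acyclic_of_minimal).  Hence the dual of the
    resolution of k that starts with minimal generators of m is an exact
    sequence of left approximations

      0 -> R -> F_0 -> F_1 -> ... -> F_n -> E_{n+1} -> 0

    with intermediate cokernels E_1, ..., E_{n+1}.  Two facts contradict each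
    other.

    - E_{n+1} is in X (coresolution_end_in_X).  The map R -> Q_0, 1 |-> u,
      followed by i extends to F_0; descending the syzygies gives a map from
      E_{n+1} to M such that the kernel Y of B + E_{n+1} -> M has projective
      dimension at most n.  So Y is in X, hence so are the extension
      B + E_{n+1} of M by Y and its summand E_{n+1}.

    - E_{n+1} is not in X (coresolution_end_not_in_X).  Choose z in E_1 outside
      m E_1.  The map 1 |-> z from R to E_1 desyzygies to a self-extension of
      E_{n+1} and gives in X a sequence whose n-th syzygy sequence begins with
      R -> E_1 + F_0, 1 |-> (z,y), where y is the vector of the minimal
      generators.  All functionals on E_1 have values in m because the
      generators are minimal, so i = t q i forces z into m E_1. *)

Set Implicit Arguments.
Unset Strict Implicit.
Unset Printing Implicit Defensive.
#[local] Obligation Tactic := idtac.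
Import GRing.Theory.
Local Open Scope ring_scope.
Local Open Scope quotient_scope.

(** * Linear maps, submodules and quotients *)

Section Linear.
Variable R : comNzRingType.
Implicit Types A B C D E F G H I K L M N P Q U V W Y Z : lmodType R.

Definition mklin A B (f : A -> B) (fL : linear f) : {linear A -> B} :=
  HB.pack f (GRing.isLinear.Build R A B *:%R f fL).

(** Linear maps obtained from diagrams are found through their graphs; the
    choice of values is made once, here. *)
Lemma lin_of_rel A B (r : A -> B -> Prop) :
  (forall a, exists b, r a b) ->
  (forall a b b', r a b -> r a b' -> b = b') ->
  (forall k a b a' b', r a b -> r a' b' -> r (k *: a + a') (k *: b + b')) ->
  exists f : {linear A -> B}, forall a, r a (f a).
Proof.
move=> tot uniq lin.
pose f a := projT1 (cid (tot a)).
have fP a : r a (f a) by rewrite /f; case: cid.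
have fL : linear f by move=> k a a'; apply: uniq (fP _) (lin _ _ _ _ _ (fP _) (fP _)).
by exists (mklin fL).
Qed.

(** A map whose values lie in a submodule is a map to that submodule. *)
Lemma lin_factor_inj A B Z (i : {linear A -> B}) (h : {linear Z -> B}) :
  injective i -> (forall z, exists a, i a = h z) ->
  exists h' : {linear Z -> A}, forall z, i (h' z) = h z.
Proof.
move=> ii im; apply: (lin_of_rel (r := fun z a => i a = h z)) => //.
  by move=> a b b' e e'; apply: ii; rewrite e e'.
by move=> k a b a' b' e e'; rewrite !linearP e e'.
Qed.

Lemma lin_factor_surj B C Z (p : {linear B -> C}) (h : {linear B -> Z}) :
  surj p -> (forall b, p b = 0 -> h b = 0) ->
  exists h' : {linear C -> Z}, forall b, h' (p b) = h b.
Proof.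
move=> ps ph.
have ph2 b b' : p b = p b' -> h b = h b'.
  move=> e; apply/eqP; rewrite -subr_eq0 -linearB; apply/eqP/ph.
  by rewrite linearB e subrr.
have [f fP] : exists f : {linear C -> Z}, forall c, exists2 b, p b = c & h b = f c.
  apply: (lin_of_rel (r := fun c z => exists2 b, p b = c & h b = z)).
  - by move=> c; have [b <-] := ps c; exists (h b); exists b.
  - by move=> c z z' [b <- <-] [b' /ph2 e <-].
  - move=> k a b a' b' [x <- <-] [y <- <-]; exists (k *: x + y); by rewrite linearP.
by exists f => b; have [b' /ph2 -> ->] := fP (p b).
Qed.

(** Submodules are given by predicates, so that images, kernels and annihilators
    need no decidability. *)
Definition submod M (S : M -> Prop) :=
  S 0 /\ forall k x y, S x -> S y -> S (k *: x + y).

Lemma lin_inj A B (f : {linear A -> B}) : (forall x, f x = 0 -> x = 0) -> injective f.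
Proof.
move=> fi x y e; apply/eqP; rewrite -subr_eq0; apply/eqP/fi.
by rewrite linearB e subrr.
Qed.

Lemma inj0 A B (f : {linear A -> B}) x : injective f -> f x = 0 -> x = 0.
Proof. by move=> fi e; apply: fi; rewrite e linear0. Qed.

Section Sub.
Variables (M : lmodType R) (S : M -> Prop) (SP : submod S).
(** The proof SP is an argument so that the closure properties of the subset can be
    inferred. *)
Definition subp : {pred M} := let _ := SP in fun x => `[< S x >].
Lemma subp_closed : GRing.submod_closed subp.
Proof.
split; first exact/asboolP/SP.1.
by move=> k x y /asboolP sx /asboolP sy; apply/asboolP/SP.2.
Qed.
HB.instance Definition _ := GRing.isSubmodClosed.Build R M subp subp_closed.
Record subT := SubT { sub_val : M; sub_valP : sub_val \in subp }.
HB.instance Definition _ := [isSub for sub_val].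
HB.instance Definition _ := [Choice of subT by <:].
HB.instance Definition _ := [SubChoice_isSubLmodule of subT by <:].
End Sub.

Lemma sub_exists M (S : M -> Prop) : submod S ->
  exists (N : lmodType R) (i : {linear N -> M}), injective i /\
    forall x, S x <-> exists y, i y = x.
Proof.
move=> SP; exists (subT SP : lmodType R), (val : {linear _ -> M}).
split=> [|x]; first exact: val_inj.
split=> [sx|[[y yS] <-]]; last exact/asboolP.
have xS : x \in subp SP by apply/asboolP.
by exists (SubT xS).
Qed.

Section Quot.
Variables (M : lmodType R) (S : M -> Prop) (SP : submod S).
Definition quotT := Quotient.quot (subp SP).
HB.instance Definition _ := GRing.Zmodule.on quotT.
Definition qpi (x : M) : quotT := \pi_(Quotient.quot (subp SP)) x.
Definition qrepr (x : quotT) : M := repr (x : Quotient.quot (subp SP)).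
Lemma qreprK x : qpi (qrepr x) = x. Proof. exact: reprK. Qed.
Definition qscale (a : R) (x : quotT) : quotT := qpi (a *: qrepr x).
Lemma qpiE x y : (qpi x = qpi y) <-> S (x - y).
Proof.
split=> [/eqP|h]; last apply/eqP.
  by rewrite /qpi -Quotient.idealrBE => /asboolP.
by rewrite /qpi -Quotient.idealrBE; apply/asboolP.
Qed.
Lemma qscaleE a x : qscale a (qpi x) = qpi (a *: x).
Proof.
apply/qpiE; rewrite -scalerBr -[X in S X]addr0; apply: SP.2 SP.1.
by apply/qpiE; rewrite qreprK.
Qed.
Lemma qscaleA a b f : qscale a (qscale b f) = qscale (a * b) f.
Proof. by rewrite -(qreprK f) !qscaleE scalerA. Qed.
Lemma qscale1 : left_id 1 qscale.
Proof. by move=> f; rewrite -(qreprK f) qscaleE scale1r. Qed.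
Lemma qpiD x y : qpi (x + y) = qpi x + qpi y.
Proof. exact: raddfD. Qed.
Lemma qscaleDr : right_distributive qscale +%R.
Proof.
move=> a f g; rewrite -(qreprK f) -(qreprK g).
by rewrite !qscaleE -!qpiD !qscaleE -scalerDr.
Qed.
Lemma qscaleDl f : {morph qscale^~ f : a b / a + b}.
Proof. by move=> a b; rewrite -(qreprK f) !qscaleE -qpiD -scalerDl. Qed.
HB.instance Definition _ := GRing.Zmodule_isLmodule.Build R quotT
  qscaleA qscale1 qscaleDr qscaleDl.
Lemma qpi_linear : linear qpi.
Proof. by move=> a x y; rewrite qpiD -qscaleE. Qed.
End Quot.

Lemma quot_exists M (S : M -> Prop) : submod S ->
  exists (N : lmodType R) (p : {linear M -> N}), surj p /\
    forall x, p x = 0 <-> S x.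
Proof.
move=> SP; exists (quotT SP : lmodType R), (mklin (qpi_linear SP)).
split=> [y|x]; first by exists (qrepr y); exact: qreprK.
have q0 : qpi SP 0 = 0 by exact: raddf0.
by have := qpiE SP x 0; rewrite q0 subr0.
Qed.

End Linear.

(** * Short exact sequences, free and projective modules *)

Section Basics.
Variable R : comNzRingType.
Implicit Types A B C D E F G H I K L M N P Q U V W Y Z : lmodType R.

Lemma ker_exists A B (f : {linear A -> B}) :
  exists K (i : {linear K -> A}), injective i /\ forall x, f x = 0 <-> exists y, i y = x.
Proof.
have [|K [i [ii iP]]] := @sub_exists _ A (fun x => f x = 0).
  by split=> [|k x y fx fy]; rewrite ?linear0 // linearP fx fy scaler0 addr0.
by exists K, i.
Qed.

Lemma ses_ker B C (p : {linear B -> C}) : surj p ->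
  exists K (i : {linear K -> B}), short_exact i p.
Proof. by have [K [i [ii iP]]] := ker_exists p; move=> sp; exists K, i. Qed.

Lemma coker_exists A B (f : {linear A -> B}) :
  exists C (p : {linear B -> C}), surj p /\ exact f p.
Proof.
have [|C [p [sp pP]]] := @quot_exists _ B (fun y => exists x, f x = y).
  split=> [|k x y [x' <-] [y' <-]]; first by exists 0; rewrite linear0.
  by exists (k *: x' + y'); rewrite linearP.
by exists C, p.
Qed.

Lemma ses_coker A B (i : {linear A -> B}) : injective i ->
  exists C (p : {linear B -> C}), short_exact i p.
Proof. by have [C [p [sp pP]]] := coker_exists i; exists C, p. Qed.

Lemma ses_comp0 A B C (f : {linear A -> B}) (g : {linear B -> C}) x :
  short_exact f g -> g (f x) = 0.
Proof. by case=> _ e _; apply/e; exists x. Qed.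

Lemma lift_ses A B C Z (f : {linear A -> B}) (g : {linear B -> C}) (h : {linear Z -> B}) :
  short_exact f g -> (forall z, g (h z) = 0) ->
  exists h' : {linear Z -> A}, forall z, f (h' z) = h z.
Proof. move=> [fi fg _] gh. apply: (lin_factor_inj (h := h) fi) => z. by apply/fg. Qed.

Lemma desc_ses A B C Z (f : {linear A -> B}) (g : {linear B -> C}) (h : {linear B -> Z}) :
  short_exact f g -> (forall z, h (f z) = 0) ->
  exists h' : {linear C -> Z}, forall z, h' (g z) = h z.
Proof. by case=> _ fg gs hf; apply: lin_factor_surj => // b /fg [a <-]. Qed.

Lemma rV_map m N (s : 'I_m -> N) :
  exists f : {linear 'rV[R]_m -> N}, forall x, f x = \sum_i x 0 i *: s i.
Proof.
have fL : linear (fun x : 'rV[R]_m => \sum_i x 0 i *: s i).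
  move=> k x y; rewrite scaler_sumr -big_split; apply: eq_bigr => i _.
  by rewrite !mxE scalerDl scalerA.
by exists (mklin fL).
Qed.

Lemma rV_mapE m N (f : {linear 'rV[R]_m -> N}) x :
  f x = \sum_i x 0 i *: f (delta_mx 0 i).
Proof.
rewrite {1}[x]row_sum_delta linear_sum; apply: eq_bigr => i _; exact: linearZ.
Qed.

Lemma rV_map_delta m N (s : 'I_m -> N) :
  exists f : {linear 'rV[R]_m -> N}, forall i, f (delta_mx 0 i) = s i.
Proof.
have [f fE] := rV_map s; exists f => i; rewrite fE (bigD1 i) //=.
rewrite mxE !eqxx scale1r big1 ?addr0 // => j /negPf jn.
by rewrite mxE eqxx jn scale0r.
Qed.

Lemma rV_ext m N (f g : {linear 'rV[R]_m -> N}) :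
  (forall i, f (delta_mx 0 i) = g (delta_mx 0 i)) -> forall x, f x = g x.
Proof. by move=> e x; rewrite rV_mapE [RHS]rV_mapE; apply: eq_bigr => i _; rewrite e. Qed.

Lemma fin_genP M : fin_gen M <-> exists m (p : {linear 'rV[R]_m -> M}), surj p.
Proof.
split=> [[s sP]|[m [p ps]]].
  have [f fE] := @rV_map (size s) M (fun i => s`_i).
  exists (size s), f => y; have [c ->] := sP y.
  exists (\row_i c i); rewrite fE; apply: eq_bigr => i _; by rewrite mxE.
exists [seq p (delta_mx 0 i) | i <- enum 'I_m] => y.
have [x <-] := ps y.
exists (fun i => if insub i is Some j then x 0 (j : 'I_m) else 0).
have sz : size [seq p (delta_mx 0 i) | i <- enum 'I_m] = m by rewrite size_map size_enum_ord.
rewrite rV_mapE; symmetry.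
rewrite (big_ord_widen_cond _ xpredT (fun i => (if insub i is Some j then x 0 (j : 'I_m) else 0) *: [seq p (delta_mx 0 i) | i <- enum 'I_m]`_i) (eq_leq sz)).
rewrite big_mkcond /=; apply: eq_bigr => i _.
rewrite sz ltn_ord; congr (_ *: _); first by rewrite valK.
rewrite (nth_map i) ?size_enum_ord //; congr (p (delta_mx 0 _)).
by apply: val_inj; rewrite /= nth_enum_ord.
Qed.

Lemma fin_gen_surj M N (p : {linear M -> N}) : surj p -> fin_gen M -> fin_gen N.
Proof.
move=> ps /fin_genP[m [q qs]]; apply/fin_genP; exists m, (p \o q : {linear _ -> _}).
by move=> y; have [x <-] := ps y; have [z <-] := qs x; exists z.
Qed.

Lemma fg_projective_rV m : fg_projective 'rV[R]_m.
Proof.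
split; first by apply/fin_genP; exists m, (idfun : {linear _ -> _}) => y; exists y.
move=> A B p g ps.
have [s sP] := choice (fun i : 'I_m => ps (g (delta_mx 0 i))).
have [f fE] := rV_map_delta s; exists f => x /=.
have := @rV_ext m B (p \o f : {linear _ -> _}) g; apply => i /=.
by rewrite fE.
Qed.

Lemma proj_lift P A B (p : {linear A -> B}) (g : {linear P -> B}) :
  fg_projective P -> surj p -> exists h : {linear P -> A}, forall x, p (h x) = g x.
Proof. by move=> [_ PP] ps; have [h hE] := PP _ _ p g ps; exists h. Qed.

(** Projectivity against a map that is onto only the part of its target that is
    needed: corestrict both maps to the image. *)
Lemma proj_lift_im P A B (p : {linear A -> B}) (g : {linear P -> B}) :
  fg_projective P -> (forall x, exists a, p a = g x) ->
  exists h : {linear P -> A}, forall x, p (h x) = g x.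
Proof.
move=> PP im.
have [|I [i [ii iP]]] := @sub_exists _ B (fun y => exists x, p x = y).
  split=> [|k x y [x' <-] [y' <-]]; first by exists 0; rewrite linear0.
  by exists (k *: x' + y'); rewrite linearP.
have [p' p'E] : exists p' : {linear A -> I}, forall a, i (p' a) = p a.
  by apply: lin_factor_inj => // a; apply/iP; exists a.
have [g' g'E] : exists g' : {linear P -> I}, forall a, i (g' a) = g a.
  by apply: lin_factor_inj => // a; apply/iP.
have p's : surj p'.
  move=> y; have [|a ae] := (iP (i y)).2; first by exists y.
  by exists a; apply: ii; rewrite p'E.
have [h hE] := proj_lift g' PP p's.
by exists h => x; rewrite -p'E hE g'E.
Qed.

Lemma fg_projective_retract P N (e : {linear P -> N}) (s : {linear N -> P}) :
  (forall x, e (s x) = x) -> fg_projective P -> fg_projective N.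
Proof.
move=> es PP; split.
  by apply: fin_gen_surj PP.1; move=> y; exists (s y).
move=> A B p g ps; have [h hE] := proj_lift (g \o e : {linear _ -> _}) PP ps.
by exists (h \o s : {linear _ -> _}) => x /=; rewrite hE /= es.
Qed.

Lemma fg_projective_cover P : fg_projective P ->
  exists m (e : {linear 'rV[R]_m -> P}) (s : {linear P -> 'rV[R]_m}),
  forall x, e (s x) = x.
Proof.
move=> PP; have /fin_genP[m [e es]] := PP.1.
have [s sE] := proj_lift (idfun : {linear P -> P}) PP es.
by exists m, e, s.
Qed.

Lemma ses_split A B C (f : {linear A -> B}) (g : {linear B -> C}) :
  short_exact f g -> fg_projective C ->
  exists (r : {linear B -> A}) (s : {linear C -> B}),
    [/\ forall a, r (f a) = a, forall c, g (s c) = c, forall c, r (s c) = 0 &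
        forall b, f (r b) + s (g b) = b].
Proof.
move=> ses PC; have [fi fg gs] := ses.
have [s sE] := proj_lift (idfun : {linear C -> C}) PC gs.
have [r rE] : exists r : {linear B -> A}, forall b, f (r b) = (idfun \- (s \o g)) b.
  by apply: (lift_ses ses) => b /=; rewrite linearB /= sE subrr.
exists r, s; split=> //.
- by move=> a; apply: fi; rewrite rE /= (ses_comp0 a ses) linear0 subr0.
- by move=> c; apply: fi; rewrite rE /= sE /= subrr linear0.
- by move=> b; rewrite rE /= subrK.
Qed.

Lemma fg_projective_ses A B C (f : {linear A -> B}) (g : {linear B -> C}) :
  short_exact f g -> fg_projective A -> fg_projective C -> fg_projective B.
Proof.
move=> ses PA PC; have [r [s [rf gs rs id]]] := ses_split ses PC.
apply: (@fg_projective_retract _ B (pair_case f s : {linear (A * C)%type -> B})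
  (pairing r g : {linear _ -> _})) (fg_projective_sum PA PC) => x.
exact: id.
Qed.

(** A left approximation by free modules; its dual is onto. *)
Definition left_approx A B (i : {linear A -> B}) :=
  forall f : {linear A -> R^o}, exists g : {linear B -> R^o}, forall x, g (i x) = f x.

Lemma coord_linear m (j : 'I_m) : linear (fun x : 'rV[R]_m => x 0 j : R^o).
Proof. by move=> k x y; rewrite !mxE. Qed.
Definition coordl m (j : 'I_m) : {linear 'rV[R]_m -> R^o} := mklin (@coord_linear m j).

Lemma rV_pair m Z (f : 'I_m -> {linear Z -> R^o}) :
  exists h : {linear Z -> 'rV[R]_m}, forall z i, h z 0 i = f i z.
Proof.
have hL : linear (fun z => \row_i f i z).
  by move=> k x y; apply/rowP => i; rewrite !mxE linearP.
by exists (mklin hL) => z i; rewrite mxE.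
Qed.

(** A finitely generated projective module is a summand of a free one, so a map
    to it is controlled by functionals. *)
Lemma left_approx_proj A B (i : {linear A -> B}) P (f : {linear A -> P}) :
  left_approx i -> fg_projective P ->
  exists g : {linear B -> P}, forall x, g (i x) = f x.
Proof.
move=> ia /fg_projective_cover[m [e [s es]]].
have [g gE] := choice (fun j => ia (coordl j \o s \o f : {linear _ -> _})).
have [h hE] := rV_pair g.
exists (e \o h : {linear _ -> _}) => x /=; rewrite -[RHS]es; congr (e _).
by apply/rowP => j; rewrite hE gE.
Qed.

End Basics.
Arguments coordl {R m} j.

(** * Finitely presented functors on a preadditive category *)

Section FunctorCat.
Variable C : preadditive.

Lemma comp0l (a b c : C) (f : hom a b) : comp (0 : hom b c) f = 0.
Proof. by apply: (addrI (comp 0 f)); rewrite -compDl !addr0. Qed.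
Lemma comp0r (a b c : C) (g : hom b c) : comp g (0 : hom a b) = 0.
Proof. by apply: (addrI (comp g 0)); rewrite -compDr !addr0. Qed.
Lemma compNl (a b c : C) (g : hom b c) (f : hom a b) : comp (- g) f = - comp g f.
Proof. by apply: (addrI (comp g f)); rewrite -compDl !subrr comp0l. Qed.
Lemma compNr (a b c : C) (g : hom b c) (f : hom a b) : comp g (- f) = - comp g f.
Proof. by apply: (addrI (comp g f)); rewrite -compDr !subrr comp0r. Qed.

Section CokerRep.
Variables (x y : C) (l : hom x y).

Definition rep_im (a : C) : {pred hom a y} := fun v => `[< exists u, v = comp l u >].

Lemma rep_im_zmod a : zmod_closed (@rep_im a).
Proof.
split; first by apply/asboolP; exists 0; rewrite comp0r.
move=> _ _ /asboolP[u ->] /asboolP[v ->].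
by apply/asboolP; exists (u - v); rewrite compDr compNr.
Qed.

HB.instance Definition _ (a : C) :=
  GRing.isZmodClosed.Build (hom a y) (@rep_im a) (@rep_im_zmod a).

Definition crep_ob (a : C) : zmodType := Quotient.quot (@rep_im a).
Definition crep_pi a (v : hom a y) : crep_ob a := \pi_(Quotient.quot (@rep_im a)) v.
Definition crep_repr a (v : crep_ob a) : hom a y := repr (v : Quotient.quot (@rep_im a)).
Lemma crep_reprK a (v : crep_ob a) : crep_pi (crep_repr v) = v.
Proof. exact: reprK. Qed.
Lemma crep_piP a (v w : hom a y) :
  crep_pi v = crep_pi w <-> exists u, v - w = comp l u.
Proof.
split=> [/eqP|h]; last apply/eqP.
  by rewrite /crep_pi -Quotient.idealrBE => /asboolP.
by rewrite /crep_pi -Quotient.idealrBE; apply/asboolP.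
Qed.
Lemma crep_piD a (v w : hom a y) : crep_pi (v + w) = crep_pi v + crep_pi w.
Proof. exact: raddfD. Qed.
Lemma crep_pi0 a : @crep_pi a 0 = 0.
Proof. exact: raddf0. Qed.

Definition crep_map a b (f : hom a b) (v : crep_ob b) : crep_ob a :=
  crep_pi (comp (crep_repr v) f).
Lemma crep_mapE a b (f : hom a b) v : crep_map f (crep_pi v) = crep_pi (comp v f).
Proof.
have /crep_piP[u e] : crep_pi (crep_repr (crep_pi v)) = crep_pi v by exact: crep_reprK.
by apply/crep_piP; exists (comp u f); rewrite -compNl -compDl e compA.
Qed.

(** The cokernel of the map of representable functors induced by l.  These
    functors serve as cokernels of arbitrary maps, as kernels in resolutions and
    as the resolved object, so no other functor has to be constructed. *)
Program Definition coker_rep : cmodule C :=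
  @CModule C crep_ob crep_map _ _ _ _.
Next Obligation.
move=> a b f v w; rewrite -(crep_reprK v) -(crep_reprK w).
by rewrite -crep_piD !crep_mapE -crep_piD compDl.
Qed.
Next Obligation.
by move=> a b f g v; rewrite -(crep_reprK v) !crep_mapE -crep_piD compDr.
Qed.
Next Obligation. by move=> a v; rewrite -(crep_reprK v) crep_mapE comp1r. Qed.
Next Obligation.
by move=> a b c g f v; rewrite -(crep_reprK v) !crep_mapE compA.
Qed.

Program Definition crep_proj : nat_trans (representable y) coker_rep :=
  @NatTrans C (representable y) coker_rep crep_pi _ _.
Next Obligation. by move=> a v w; exact: crep_piD. Qed.
Next Obligation. by move=> a b f v /=; rewrite crep_mapE. Qed.

Program Definition rep_map : nat_trans (representable x) (representable y) :=
  @NatTrans C (representable x) (representable y) (fun a u => comp l u) _ _.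
Next Obligation. by move=> a v w /=; exact: compDr. Qed.
Next Obligation. by move=> a b f v /=; rewrite compA. Qed.

Lemma crep_proj_surj a : surj (crep_proj a).
Proof. by move=> v; exists (crep_repr v); exact: crep_reprK. Qed.

Lemma crep_proj_ker a v : crep_proj a v = 0 <-> exists u, comp l u = v.
Proof.
rewrite /= -(crep_pi0 a); split=> [/crep_piP[u]|[u <-]].
  by rewrite subr0 => ->; exists u.
by apply/crep_piP; exists u; rewrite subr0.
Qed.

Lemma coker_rep_fp : fin_presented coker_rep.
Proof.
exists x, y, rep_map, crep_proj; split=> a; last exact: crep_proj_surj.
exact: crep_proj_ker.
Qed.

Definition coker_rep_fpc : fp_cmodule C := FpCModule coker_rep_fp.

End CokerRep.

(** The transformation that corresponds to an element by the Yoneda lemma. *)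
Program Definition rep_elt (F : cmodule C) (y : C) (f : F y) : nat_trans (representable y) F :=
  @NatTrans C (representable y) F (fun a v => cm_map v f) _ _.
Next Obligation. by move=> F y f a v w /=; exact: cm_mapDl. Qed.
Next Obligation. by move=> F y f a b g v /=; rewrite cm_mapM. Qed.

Lemma yoneda (F : cmodule C) (y : C) (t : nat_trans (representable y) F) a v :
  t a v = cm_map v (t y (idm y)).
Proof. by rewrite -(nt_nat t) /= comp1l. Qed.

Lemma nt_mapN (F G : cmodule C) (t : nat_trans F G) a v : t a (- v) = - t a v.
Proof. by apply: (addrI (t a v)); rewrite -nt_mapD !subrr nt_map0. Qed.

(** As for linear maps, transformations are found through their graphs. *)
Lemma nt_of_rel (F G : cmodule C) (r : forall a, F a -> G a -> Prop) :
  (forall a x, exists y, r a x y) ->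
  (forall a x y y', r a x y -> r a x y' -> y = y') ->
  (forall a x y x' y', r a x y -> r a x' y' -> r a (x + x') (y + y')) ->
  (forall a b (f : hom a b) x y, r b x y -> r a (cm_map f x) (cm_map f y)) ->
  exists t : nat_trans F G, forall a x, r a x (t a x).
Proof.
move=> tot uniq add nat.
pose t a x := projT1 (cid (tot a x)).
have tP a x : r a x (t a x) by rewrite /t; case: cid.
have tD a (x y : F a) : t a (x + y) = t a x + t a y.
  exact: uniq (tP _ _) (add _ _ _ _ _ (tP _ _) (tP _ _)).
have tN a b (f : hom a b) x : t a (cm_map f x) = cm_map f (t b x).
  exact: uniq (tP _ _) (nat _ _ _ _ _ (tP _ _)).
by exists (NatTrans tD tN).
Qed.

(** A weak form of direct sums: maps out of one are pairs, and maps into it are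
    sums of maps through the two terms. *)
Definition has_sums := forall a b : C, exists (c : C) (i1 : hom a c) (i2 : hom b c),
  (forall y (s : hom a y) (t : hom b y),
     exists m : hom c y, comp m i1 = s /\ comp m i2 = t) /\
  (forall w (u : hom w c), exists u1 u2, u = comp i1 u1 + comp i2 u2).

Hypothesis sums : has_sums.

Notation cat := (fp_cat C).

(** The cokernel of p is again finitely presented: if F is generated by the
    representable functor of y and G is presented by x' -> y', it is the cokernel of
    a map from the sum of x' and y to y'.  An epimorphism kills it. *)
Lemma epi_surj (F G : cat) (p : phom F G) :
  epi p -> forall a, surj (nt_map (p : nat_trans F G) a).
Proof.
move=> pe.
case: (fp_modP F) => [x [y [s [t [tk ts]]]]].
case: (fp_modP G) => [x' [y' [s' [t' [tk' ts']]]]].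
have [l lE] := ts' y (nt_map (p : nat_trans F G) y (t y (idm y))).
have [c [i1 [i2 [univ dec]]]] := sums x' y.
have [m [mi1 mi2]] := univ _ (s' x' (idm x')) l.
have im1 a u : comp m (comp i1 u) = s' a u.
  by rewrite compA mi1 (yoneda s' u).
have imE a v : (exists u, comp m u = v) <-> exists w, t' a v = nt_map (p : nat_trans F G) a (t a w).
  split=> [[u <-]|[w tw]].
    have [u1 [u2 ->]] := dec _ u; exists u2.
    rewrite compDr im1 nt_mapD compA mi2.
    have -> : t' a (s' a u1) = 0 by apply/tk'; exists u1.
    by rewrite add0r (yoneda t u2) !nt_nat -lE -nt_nat.
  have /tk'[u uE] : t' a (v - comp l w) = 0.
    have lw : t' a (comp l w) = nt_map (p : nat_trans F G) a (t a w).
      by rewrite (yoneda t w) nt_nat -lE -nt_nat.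
    by rewrite nt_mapD nt_mapN lw tw subrr.
  exists (comp i1 u + comp i2 w).
  by rewrite compDr im1 compA mi2 uE subrK.
have [q qP] : exists q : nat_trans G (coker_rep m), forall a g,
    exists2 v, t' a v = g & crep_pi m v = q a g.
  apply: (@nt_of_rel (G : fp_cmodule C) (coker_rep m)
    (fun a g z => exists2 v, t' a v = g & crep_pi m v = z)).
  - by move=> a g; have [v <-] := ts' a g; exists (crep_pi m v), v.
  - move=> a g z z' [v <- <-] [v' e <-].
    apply/crep_piP; have [|u uE] := (imE a (v - v')).2; last by exists u.
    by exists 0; rewrite !nt_map0 nt_mapD nt_mapN e subrr.
  - move=> a g z g' z' [v <- <-] [v' <- <-]; exists (v + v'); first exact: nt_mapD.
    exact: crep_piD.
  - move=> a b f g z [v <- <-]; exists (comp v f); first exact: (nt_nat t' f v).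
    by rewrite /= crep_mapE.
have q0 : (q : phom (G : cat) (coker_rep_fpc m : cat)) = pzero _ _.
  apply: pe; rewrite pcomp0l; apply: nat_transP => a f /=.
  have [v e <-] := qP a (nt_map (p : nat_trans F G) a f).
  have [w wE] := ts a f.
  apply/(@crep_proj_ker _ _ m a v)/imE; exists w; by rewrite e wE.
move=> a g; have [v e] := qP a g.
have -> : q a g = 0 by rewrite q0.
move=> /(@crep_proj_ker _ _ m a v)/imE[w wE].
by exists (t a w); rewrite -wE.
Qed.

Lemma surj_epi (F G : cat) (p : phom F G) :
  (forall a, surj (nt_map (p : nat_trans F G) a)) -> epi p.
Proof.
move=> ps H u v e; apply: nat_transP => a g; have [f <-] := ps a g.
exact: (congr1 (fun h : nat_trans F H => h a f) e).
Qed.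

Lemma rep_fp (y : C) : fin_presented (representable y).
Proof.
exists y, y, (rep_map 0), (nt_id _); split=> a v /=; last by exists v.
by split=> [->|[u <-]]; [exists 0|]; rewrite comp0l.
Qed.
Definition rep_fpc (y : C) : cat := FpCModule (rep_fp y).

Lemma rep_projective (y : C) : projective (rep_fpc y).
Proof.
move=> F G p g /epi_surj ps.
have [f fE] := ps y ((g : nat_trans (representable y) G) y (idm y)).
exists (rep_elt f : nat_trans (representable y) F); apply: nat_transP => a v /=.
by rewrite nt_nat fE -(yoneda (g : nat_trans (representable y) G)).
Qed.

(** The kernel of g is the image of l, which is the cokernel of l' by exactness
    one step further to the left. *)
Lemma rep_exact_at (z x y : C) (G : cat) (l' : hom z x) (l : hom x y)
    (g : phom (rep_fpc y) G) :
  (forall a v, nt_map (g : nat_trans (representable y) G) a v = 0 <->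
     exists u, comp l u = v) ->
  (forall a (v : hom a x), comp l v = 0 <-> exists u, comp l' u = v) ->
  exact_at (rep_map l : phom (rep_fpc x) (rep_fpc y)) g.
Proof.
move=> gl ll'.
have [k kP] : exists k : nat_trans (coker_rep l') (representable y),
    forall a q, exists2 v, crep_pi l' v = q & comp l v = k a q.
  apply: (@nt_of_rel (coker_rep l') (representable y)
    (fun a q z => exists2 v, crep_pi l' v = q & comp l v = z)).
  - by move=> a q; exists (comp l (crep_repr q)), (crep_repr q); rewrite ?crep_reprK.
  - move=> a q w w' [v <- <-] [v' /crep_piP[u e] <-].
    apply/eqP; rewrite eq_sym -subr_eq0 -compNr -compDr; apply/eqP/ll'.
    by exists u; rewrite -e.
  - move=> a q w q' w' [v <- <-] [v' <- <-]; exists (v + v'); first exact: crep_piD.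
    exact: compDr.
  - move=> a b f q w [v <- <-]; exists (comp v f); first by rewrite /= crep_mapE.
    by rewrite /= compA.
have kE a v : k a (crep_pi l' v) = comp l v.
  have [v' /crep_piP[u e] <-] := kP a (crep_pi l' v).
  apply/eqP; rewrite -subr_eq0 -compNr -compDr; apply/eqP/ll'.
  by exists u; rewrite e.
have kinj a q q' : k a q = k a q' -> q = q'.
  rewrite -(crep_reprK q) -(crep_reprK q') !kE => e.
  apply/crep_piP; have [|u uE] := (ll' a (crep_repr q - crep_repr q')).1.
    by rewrite compDr compNr e subrr.
  by exists u.
exists (coker_rep_fpc l' : cat), k, (crep_proj l'); split.
- split.
    apply: nat_transP => a q /=; rewrite -(crep_reprK q) kE.
    by apply/gl; exists (crep_repr q).
  move=> F h gh.
  have h0 a f : exists u, comp l u = nt_map (h : nat_trans F (representable y)) a f.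
    by apply/gl; exact: (congr1 (fun t : nat_trans F G => t a f) gh).
  have [u uP] : exists u : nat_trans F (coker_rep l'),
      forall a f, k a (u a f) = nt_map (h : nat_trans F (representable y)) a f.
    apply: (@nt_of_rel (F : fp_cmodule C) (coker_rep l')
       (fun a f q => k a q = nt_map (h : nat_trans F (representable y)) a f)).
    - by move=> a f; have [v <-] := h0 a f; exists (crep_pi l' v); rewrite kE.
    - by move=> a f q q' e e'; apply: kinj; rewrite e.
    - by move=> a f q f' q' e e'; rewrite !nt_mapD e e'.
    - by move=> a b m f q e; rewrite !nt_nat e.
  exists u; split; first by apply: nat_transP => a f; exact: uP.
  move=> u' e; apply: nat_transP => a f; apply: kinj; rewrite uP.
  by rewrite -e.
- by apply: surj_epi => a; exact: crep_proj_surj.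
- by apply: nat_transP => a v; exact: kE.
Qed.

(** A complex of C that is exact under all functors hom(a, -) is a projective
    resolution of representable functors; by the Yoneda lemma a cocycle with values
    in the representable functor of y is a map to y. *)
Lemma Ext_zero_exact (T : nat -> C) (d : forall i, hom (T i.+1) (T i)) (k : nat) :
  (forall i a (v : hom a (T i.+1)),
     comp (d i) v = 0 <-> exists u, comp (d i.+1) u = v) ->
  (forall F P : cat, projective P -> Ext_zero k.+1 F P) ->
  forall y (g : hom (T k.+1) y), comp g (d k.+1) = 0 ->
    exists h : hom (T k) y, comp h (d k) = g.
Proof.
move=> dex ext y g gd.
pose P : resolution (coker_rep_fpc (d 0) : cat) :=
  @Resolution cat (coker_rep_fpc (d 0)) (fun i => rep_fpc (T i))
    (fun i => rep_map (d i)) (crep_proj (d 0)) (fun i => @rep_projective (T i))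
    (@surj_epi (rep_fpc (T 0)) (coker_rep_fpc (d 0)) (crep_proj (d 0)) (@crep_proj_surj _ _ (d 0)))
    (@rep_exact_at _ _ _ (coker_rep_fpc (d 0)) (d 1) (d 0) (crep_proj (d 0))
       (@crep_proj_ker _ _ (d 0)) (dex 0))
    (fun i => @rep_exact_at _ _ _ (rep_fpc (T i)) (d i.+2) (d i.+1) (rep_map (d i))
       (dex i) (dex i.+1)).
have [|h hE] := ext (coker_rep_fpc (d 0)) (rep_fpc y) (@rep_projective y) P (rep_map g).
  by apply: nat_transP => a v /=; rewrite compA gd comp0l.
exists (nt_map (h : nat_trans (representable (T k)) (representable y)) (T k) (idm _)).
have := congr1 (fun t : nat_trans (representable (T k.+1)) (representable y) =>
  t _ (idm _)) hE.
by rewrite /= !comp1r (yoneda h).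
Qed.
End FunctorCat.

(** * Syzygies of short exact sequences and stable exactness *)

Section SES.
Variable R : comNzRingType.
Implicit Types A B C D E F G H I K L M N P Q U V W Y Z : lmodType R.

Lemma fst_linear A B : linear (fun x : A * B => x.1). Proof. by []. Qed.
Lemma snd_linear A B : linear (fun x : A * B => x.2). Proof. by []. Qed.
Definition fstl A B : {linear (A * B)%type -> A} := mklin (@fst_linear A B).
Definition sndl A B : {linear (A * B)%type -> B} := mklin (@snd_linear A B).

Lemma ses_prod A B : short_exact (@pair_l R A B : {linear _ -> _}) (sndl A B).
Proof.
split=> [x y [] //|[a b] /=|b]; last by exists (0, b).
by split=> [->|[x [_ <-]] //]; exists a.
Qed.

Record ses := Ses {
  sA : lmodType R; sB : lmodType R; sC : lmodType R;
  sf : {linear sA -> sB}; sg : {linear sB -> sC};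
  sP : short_exact sf sg }.

(** S1 is a syzygy of S: a diagram with exact rows and columns whose middle row T
    consists of projective modules.  Keeping the diagram, and not only the outer
    rows, makes the connecting map from the third term of S1 to the first term of S
    available. *)
Inductive syz_step (S S1 : ses) : Prop := SyzStep (T : ses)
  (jA : {linear sA S1 -> sA T}) (jB : {linear sB S1 -> sB T}) (jC : {linear sC S1 -> sC T})
  (pA : {linear sA T -> sA S}) (pB : {linear sB T -> sB S}) (pC : {linear sC T -> sC S})
  of fg_projective (sA T) & fg_projective (sC T)
  & short_exact jA pA & short_exact jB pB & short_exact jC pC
  & (forall x, sf T (jA x) = jB (sf S1 x)) & (forall x, sg T (jB x) = jC (sg S1 x))
  & (forall x, pB (sf T x) = sf S (pA x)) & (forall x, pC (sg T x) = sg S (pB x)).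

Fixpoint syz_iter (n : nat) (S S' : ses) : Prop :=
  if n is n'.+1 then exists2 S1, syz_step S S1 & syz_iter n' S1 S' else S = S'.

(** The case of the snake lemma in which the cokernels vanish. *)
Lemma ses_kernels (S T : ses) (KA KB KC : lmodType R)
    (jA : {linear KA -> sA T}) (jB : {linear KB -> sB T}) (jC : {linear KC -> sC T})
    (pA : {linear sA T -> sA S}) (pB : {linear sB T -> sB S}) (pC : {linear sC T -> sC S}) :
  short_exact jA pA -> short_exact jB pB -> short_exact jC pC ->
  (forall x, pB (sf T x) = sf S (pA x)) -> (forall x, pC (sg T x) = sg S (pB x)) ->
  exists (f : {linear KA -> KB}) (g : {linear KB -> KC}),
    [/\ short_exact f g, forall x, sf T (jA x) = jB (f x) & forall x, sg T (jB x) = jC (g x)].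
Proof.
move=> sesA sesB sesC e1 e2.
have [f1 f1E] := lift_ses (h := sf T \o jA : {linear _ -> _}) sesB (fun x =>
  etrans (e1 (jA x)) (etrans (congr1 (sf S) (ses_comp0 x sesA)) (linear0 _))).
have [g1 g1E] := lift_ses (h := sg T \o jB : {linear _ -> _}) sesC (fun x =>
  etrans (e2 (jB x)) (etrans (congr1 (sg S) (ses_comp0 x sesB)) (linear0 _))).
have [jAi jAe spA] := sesA; have [jBi jBe _] := sesB; have [jCi jCe _] := sesC.
have [Sfi Se Sgs] := sP S; have [Tfi Te Tgs] := sP T.
exists f1, g1; split=> //; split.
- apply: lin_inj => x f1x; apply: inj0 jAi _; apply: inj0 Tfi _.
  by have /= <- := f1E x; rewrite f1x linear0.
- move=> y; split=> [g1y|[x <-]].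
    have /Te[t tE] : sg T (jB y) = 0 by have /= <- := g1E y; rewrite g1y linear0.
    have /jAe[x xE] : pA t = 0.
      by apply: inj0 Sfi _; rewrite -e1 tE (ses_comp0 y sesB).
    by exists x; apply: jBi; rewrite f1E /= xE.
  by apply: inj0 jCi _; rewrite g1E /= f1E /= (ses_comp0 _ (sP T)).
- move=> z; have [t tE] := Tgs (jC z).
  have /Se[a aE] : sg S (pB t) = 0 by rewrite -e2 tE (ses_comp0 z sesC).
  have [t' t'E] := spA a.
  have /jBe[y yE] : pB (t - sf T t') = 0 by rewrite linearB e1 t'E aE subrr.
  exists y; apply: jCi; rewrite g1E /= yE linearB tE (ses_comp0 _ (sP T)).
  by rewrite subr0.
Qed.

Lemma snake (S T : ses) (pA : {linear sA T -> sA S}) (pB : {linear sB T -> sB S})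
    (pC : {linear sC T -> sC S}) :
  fg_projective (sA T) -> fg_projective (sC T) -> surj pA -> surj pC -> surj pB ->
  (forall x, pB (sf T x) = sf S (pA x)) -> (forall x, pC (sg T x) = sg S (pB x)) ->
  exists S1, syz_step S S1.
Proof.
move=> PA PC spA spC spB e1 e2.
have [A1 [jA sesA]] := ses_ker spA.
have [B1 [jB sesB]] := ses_ker spB.
have [C1 [jC sesC]] := ses_ker spC.
have [f [g [ses1 e3 e4]]] := ses_kernels sesA sesB sesC e1 e2.
by exists (Ses ses1); apply: (@SyzStep S (Ses ses1) T jA jB jC pA pB pC).
Qed.

(** The horseshoe construction. *)
Lemma syz_step_exists (S : ses) : fin_gen (sA S) -> fin_gen (sC S) ->
  exists S1, syz_step S S1.
Proof.
move=> /fin_genP[m [pA spA]] /fin_genP[q [pC spC]].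
have [Sfi Se Sgs] := sP S.
have [l lE] := proj_lift pC (fg_projective_rV R q) Sgs.
pose T := Ses (ses_prod 'rV[R]_m 'rV[R]_q).
apply: (@snake S T pA (pair_case (sf S \o pA : {linear _ -> _}) l : {linear _ -> _}) pC) => //.
- exact: fg_projective_rV.
- exact: fg_projective_rV.
- move=> b; have [c cE] := spC (sg S b).
  have /Se[a aE] : sg S (b - l c) = 0 by rewrite linearB lE cE subrr.
  have [x xE] := spA a.
  by exists (x, c); rewrite /= /pair_case /= xE aE subrK.
- by move=> x /=; rewrite /pair_case /= linear0 addr0.
- by move=> x; rewrite /= /pair_case /= linearD lE (ses_comp0 _ (sP S)) add0r.
Qed.

Lemma factors_projP M N (f : lhom M N) : factors_proj f <->
  exists P (u : {linear M -> P}) (v : {linear P -> N}),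
    fg_projective P /\ forall x, (f : {linear M -> N}) x = v (u x).
Proof.
split=> [[P [u [v [PP e]]]]|[P [u [v [PP e]]]]].
  by exists P, u, v; rewrite e.
by exists P, u, v; split=> //; apply: lhomP.
Qed.

Lemma stable_class0 M N (f : lhom M N) : stable_class f = 0 <-> factors_proj f.
Proof.
have <- : stable_class (0 : lhom M N) = 0 by exact: raddf0.
by have := stable_classP f 0; rewrite subr0.
Qed.

Section Exact.
Variables (W : lmodType R).

(** If g v factors through a projective P, lift P -> C to B and subtract; what
    remains lies in A. *)
Lemma stable_exact_B (S : ses) (v : {linear W -> sB S}) :
  factors_proj (lcomp (sg S) v) <->
  exists u : {linear W -> sA S}, factors_proj ((v : lhom _ _) - lcomp (sf S) u).
Proof.
have [Sfi Se Sgs] := sP S.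
split=> [/factors_projP[P [a [b [PP e]]]]|[u /factors_projP[P [a [b [PP e]]]]]]; last first.
  apply/factors_projP; exists P, a, (sg S \o b : {linear _ -> _}); split=> // x /=.
  by have /= <- := e x; rewrite linearB /= (ses_comp0 _ (sP S)) subr0.
have [b' b'E] := proj_lift b PP Sgs.
have [u uE] : exists u : {linear W -> sA S}, forall x, sf S (u x) = (v \- (b' \o a)) x.
  by apply: (lift_ses (sP S)) => x /=; rewrite linearB /= b'E; have /= -> := e x; rewrite subrr.
exists u; apply/factors_projP; exists P, a, b'; split=> // x.
by rewrite /= uE /= opprB addrC subrK.
Qed.

End Exact.

(** The connecting map d sends x to the element of A that maps to minus the image in
    B of a lift of x to the middle row.  It continues the stable sequence to the left
    because both 0 -> C_1 -> A + T_C -> B -> 0 and 0 -> B_1 -> C_1 + T_A -> A -> 0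
    are exact, with T_A and T_C the projective covers in the diagram. *)
Lemma stable_connecting (S S1 : ses) : syz_step S S1 ->
  exists d : {linear sC S1 -> sA S},
   (forall W (v : {linear W -> sA S}),
     factors_proj (lcomp (sf S) v) <->
     exists u : {linear W -> sC S1}, factors_proj ((v : lhom _ _) - lcomp d u)) /\
   (forall W (v : {linear W -> sC S1}),
     factors_proj (lcomp d v) <->
     exists u : {linear W -> sB S1}, factors_proj ((v : lhom _ _) - lcomp (sg S1) u)).
Proof.
case=> T jA jB jC pA pB pC PA PC sesA sesB sesC e1 e2 e3 e4.
have [jAi jAe pAs] := sesA; have [jBi jBe pBs] := sesB; have [jCi jCe pCs] := sesC.
have [Sfi Se Sgs] := sP S; have [Tfi Te Tgs] := sP T.
have [r [s [rf gs rs rsE]]] := ses_split (sP T) PC.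
have gl x : sg S (pB (s x)) = pC x by rewrite -e4 gs.
have [d dE] : exists d : {linear sC S1 -> sA S}, forall x, sf S (d x) = (\- (pB \o s \o jC)) x.
  apply: (lift_ses (sP S)) => x /=; rewrite linearN /= gl.
  by rewrite (ses_comp0 x sesC) oppr0.
exists d; split=> W v; split.
- move=> /factors_projP[P [a [b [PP e]]]].
  pose q : {linear (sA S * sC T)%type -> sB S} :=
    pair_case (sf S) (pB \o s : {linear _ -> _}).
  have qs : surj q.
    move=> y; have [c cE] := pCs (sg S y).
    have /Se[x xE] : sg S (y - pB (s c)) = 0 by rewrite linearB gl cE subrr.
    by exists (x, c); rewrite /= /pair_case /= xE subrK.
  have [b' b'E] := proj_lift b PP qs.
  have eq x : sf S (v x - (b' (a x)).1) = pB (s (b' (a x)).2).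
    have := e x; rewrite /= -b'E /= /pair_case /= linearB /= => ->.
    by rewrite addrAC subrr add0r.
  have [u uE] : exists u : {linear W -> sC S1}, forall x,
      jC (u x) = (sndl _ _ \o b' \o a) x.
    apply: (lift_ses sesC) => x /=.
    by rewrite -gl -eq (ses_comp0 _ (sP S)).
  exists (\- u : {linear _ -> _}); apply/factors_projP.
  exists P, a, (fstl _ _ \o b' : {linear _ -> _}); split=> // x /=.
  apply/eqP; rewrite -subr_eq0 addrAC; apply/eqP; apply: inj0 Sfi _.
  rewrite linearB /= eq linearN !linearN /= opprK dE /=.
  by have /= -> := uE x; rewrite subrr.
- move=> [u /factors_projP[P [a [b [PP e]]]]].
  apply/factors_projP; exists (P * sC T)%type.
  exists (pairing a (jC \o u : {linear _ -> _}) : {linear _ -> _}).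
  exists (pair_case (sf S \o b : {linear _ -> _}) (\- (pB \o s) : {linear _ -> _}) : {linear _ -> _}).
  split=> [|x]; first exact: fg_projective_sum.
  rewrite /= /pair_case /=; have /= <- := e x.
  by rewrite linearB /= dE /= subrK.
- move=> /factors_projP[P [a [b [PP e]]]].
  have [b' b'E] := proj_lift b PP pAs.
  have [u uE] : exists u : {linear W -> sB S1}, forall x,
     jB (u x) = ((sf T \o b' \o a) \+ (s \o jC \o v)) x.
    apply: (lift_ses sesB) => x; rewrite /= linearD e3 b'E.
    have /= <- := e x; rewrite dE /=; exact: addNr.
  exists u; apply/factors_projP; exists P, a, (0 : lhom P (sC S1)); split=> // x /=.
  apply/eqP; rewrite subr_eq0; apply/eqP; apply: jCi.
  rewrite -e2 uE /= linearD /= (ses_comp0 _ (sP T)) add0r.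
  by rewrite gs.
- move=> [u /factors_projP[P [a [b [PP e]]]]].
  apply/factors_projP; exists (P * sA T)%type.
  exists (pairing a (r \o jB \o u : {linear _ -> _}) : {linear _ -> _}).
  exists (pair_case (d \o b : {linear _ -> _}) pA : {linear _ -> _}).
  split=> [|x]; first exact: fg_projective_sum.
  rewrite /= /pair_case /=; have /= <- := e x.
  rewrite linearB /=.
  suff -> : d (sg S1 (u x)) = pA (r (jB (u x))) by rewrite subrK.
  apply: Sfi; rewrite dE /= -e2 -e3.
  have <- := addrK (s (sg T (jB (u x)))) (sf T (r (jB (u x)))).
  by rewrite rsE linearB (ses_comp0 _ sesB) sub0r.
Qed.
End SES.

(** * The consequence of the vanishing of Ext *)

Section StableChain.
Variables (R : comNzRingType) (X : lmodType R -> Prop) (HX : resolving X).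

Record ses_in := SesIn { ses_of :> ses R; xsA : X (sA ses_of); xsB : X (sB ses_of); xsC : X (sC ses_of) }.

Notation SC := (stable_cat X).

Definition obA (S : ses_in) : SC := StableOb (xsA S).
Definition obB (S : ses_in) : SC := StableOb (xsB S).
Definition obC (S : ses_in) : SC := StableOb (xsC S).

(** The terms C, B, A, C_1, B_1, A_1, and so on, of the resolution attached to a
    chain of syzygies.  The recursion shifts the chain, so that the terms and the maps
    reduce by computation in steps of three. *)
Fixpoint tri_ob (s : nat -> ses_in) (k : nat) {struct k} : SC :=
  match k with
  | 0 => obC (s 0) | 1 => obB (s 0) | 2 => obA (s 0)
  | k'.+3 => tri_ob (fun j => s j.+1) k'
  end.

Definition connecting_maps (s : nat -> ses_in) := forall j, {linear sC (s j.+1) -> sA (s j)}.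

Definition stable_map (M N : SC) (f : {linear st_mod M -> st_mod N}) : hom M N := stable_class f.

Fixpoint tri_map (s : nat -> ses_in) (d : connecting_maps s) (k : nat) {struct k} :
    hom (tri_ob s k.+1) (tri_ob s k) :=
  match k return hom (tri_ob s k.+1) (tri_ob s k) with
  | 0 => @stable_map (obB (s 0)) (obC (s 0)) (sg (s 0))
  | 1 => @stable_map (obA (s 0)) (obB (s 0)) (sf (s 0))
  | 2 => @stable_map (obC (s 1)) (obA (s 0)) (d 0)
  | k'.+3 => tri_map (fun j => d j.+1) k'
  end.

Definition stable_exact (A B D : lmodType R) (f : {linear A -> B}) (g : {linear B -> D}) :=
  forall (W : lmodType R) (v : {linear W -> B}), factors_proj (lcomp g v) <->
    exists u : {linear W -> A}, factors_proj ((v : lhom _ _) - lcomp f u).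

Lemma stable_map_exact (A B D W : SC) (f : {linear st_mod A -> st_mod B})
    (g : {linear st_mod B -> st_mod D}) (v : hom W B) :
  stable_exact f g -> comp (stable_map g) v = 0 <-> exists u, comp (stable_map f) u = v.
Proof.
move=> fg; rewrite -(stable_reprK v); set w := stable_repr v.
have -> : comp (stable_map g) (stable_class w : hom W B) = stable_class (lcomp g w) by exact: stable_compE.
split=> [/stable_class0/fg[u uE]|[u uE]].
  exists (@stable_map W A u); transitivity (stable_class (lcomp f u)); first exact: stable_compE.
  by symmetry; apply/stable_classP.
apply/stable_class0/fg; exists (stable_repr u); apply/stable_classP.
rewrite -uE -{1}(stable_reprK u); exact: stable_compE.
Qed.

Lemma tri_map_exact (s : nat -> ses_in) (d : connecting_maps s) :
  (forall j, stable_exact (sf (s j)) (sg (s j))) ->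
  (forall j, stable_exact (d j) (sf (s j))) ->
  (forall j, stable_exact (sg (s j.+1)) (d j)) ->
  forall k (W : SC) (v : hom W (tri_ob s k.+1)),
    comp (tri_map d k) v = 0 <-> exists u, comp (tri_map d k.+1) u = v.
Proof.
move=> e1 e2 e3 k.
have [m] := ubnP k; elim: m => // m IH in s d e1 e2 e3 k *.
case: k => [|[|[|k]]] km W v.
- exact: (@stable_map_exact (obA (s 0)) (obB (s 0)) (obC (s 0)) W (sf (s 0)) (sg (s 0)) v (e1 0)).
- exact: (@stable_map_exact (obC (s 1)) (obA (s 0)) (obB (s 0)) W (d 0) (sf (s 0)) v (e2 0)).
- exact: (@stable_map_exact (obB (s 1)) (obC (s 1)) (obA (s 0)) W (sg (s 1)) (d 0) v (e3 0)).
apply: (IH (fun j => s j.+1) (fun j => d j.+1)) => [j|j|j|];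
  [exact: e1|exact: e2|exact: e3|exact: ltnW (ltnW km)].
Qed.

(** The recursion makes tri_ob compute on multiples of three. *)
Fixpoint triple n := if n is n'.+1 then (triple n').+3 else 0%N.
Lemma tripleE n : triple n = (3 * n)%N.
Proof. by elim: n => // n /= ->; rewrite mulnS. Qed.

Lemma tri_map_zero n s (d : connecting_maps s) : fg_projective (sA (s n)) -> tri_map d (triple n).+1 = 0.
Proof.
elim: n s d => [|n IH] s d PA /=; last exact: (IH (fun j => s j.+1) (fun j => d j.+1) PA).
apply/stable_class0/factors_projP.
by exists (sA (s 0)), idfun, (sf (s 0)).
Qed.

Lemma tri_map_split n s (d : connecting_maps s) :
  (exists h, comp h (tri_map d (triple n)) = idm (tri_ob s (triple n).+1)) ->
  exists h : hom (obC (s n)) (obB (s n)),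
    comp h (@stable_map (obB (s n)) (obC (s n)) (sg (s n))) = idm _.
Proof.
elim: n s d => [|n IH] s d //= h.
exact: (IH (fun j => s j.+1) (fun j => d j.+1) h).
Qed.

Lemma stable_has_sums : has_sums SC.
Proof.
move=> a b; exists (StableOb (resolving_sum HX (st_modP a) (st_modP b))).
exists (stable_class (@pair_l R a b : {linear _ -> _})).
exists (stable_class (@pair_r R a b : {linear _ -> _})); split.
  move=> y s t; exists (stable_class (pair_case (stable_repr s) (stable_repr t) : {linear _ -> _})).
  split; [rewrite -[RHS]stable_reprK|rewrite -[RHS]stable_reprK];
    apply: etrans (stable_compE _ _) _; congr stable_class; apply: lhomP => x /=;
    by rewrite /pair_case /= linear0 ?addr0 ?add0r.
move=> w u.
exists (stable_class (lcomp (fstl a b) (stable_repr u))).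
exists (stable_class (lcomp (sndl a b) (stable_repr u))).
rewrite -[LHS]stable_reprK; symmetry.
have e1 := stable_compE (@pair_l R a b : {linear _ -> _}) (lcomp (fstl a b) (stable_repr u)).
have e2 := stable_compE (@pair_r R a b : {linear _ -> _}) (lcomp (sndl a b) (stable_repr u)).
apply: etrans (congr2 +%R e1 e2) _; rewrite -stable_classD; congr stable_class.
by apply: lhomP => x /=; rewrite -pair_lr.
Qed.

Lemma syz_step_X (S S1 : ses R) : syz_step S S1 ->
  X (sA S) -> X (sB S) -> X (sC S) -> [/\ X (sA S1), X (sB S1) & X (sC S1)].
Proof.
case=> T jA jB jC pA pB pC PA PC sA_ sB_ sC_ _ _ _ _ XA XB XC.
have P := resolving_proj HX.
split; [apply: resolving_ker sA_ _ XA|apply: resolving_ker sB_ _ XB|apply: resolving_ker sC_ _ XC] => //; apply: P => //.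
exact: fg_projective_ses (sP T) _ _.
Qed.

Lemma infinite_chain (S : ses_in) :
  exists s : nat -> ses_in, s 0 = S /\ forall j, syz_step (s j) (s j.+1).
Proof.
have ex (T : ses_in) : exists T1 : ses_in, syz_step T T1.
  have [T1 st] := syz_step_exists (resolving_fg HX (xsA T)) (resolving_fg HX (xsC T)).
  have [XA XB XC] := syz_step_X st (xsA T) (xsB T) (xsC T).
  by exists (SesIn XA XB XC).
have [f fP] := choice ex.
by exists (fun j => iter j f S).
Qed.

(** A resolution is infinite, but only its terms up to the n-th syzygies are
    prescribed. *)
Lemma chain_through n (S S' : ses R) : X (sA S) -> X (sB S) -> X (sC S) ->
  syz_iter n S S' ->
  exists s : nat -> ses_in, [/\ ses_of (s 0) = S, ses_of (s n) = S' & forall j, syz_step (s j) (s j.+1)].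
Proof.
elim: n S => [|n IH] S XA XB XC /= => [<-|[S1 st it]].
  by have [s [s0 sP]] := infinite_chain (SesIn XA XB XC); exists s; rewrite s0.
have [YA YB YC] := syz_step_X st XA XB XC.
have [s [s0 sn sP]] := IH S1 YA YB YC it.
exists (fun j => if j is j'.+1 then s j' else SesIn XA XB XC); split=> // -[|j] //=.
by rewrite s0.
Qed.

(** The identity of B_n in degree 3n+1 is a cocycle because A_n vanishes stably.
    Hence it equals h g up to a map v u through a projective module, and restricting
    to A_n kills h g. *)
Lemma syzygy_inclusion_factors n (S S' : ses R) :
  (forall F P : mod_stable X, projective P -> Ext_zero (3 * n + 1)%N F P) ->
  X (sA S) -> X (sB S) -> X (sC S) -> syz_iter n S S' -> fg_projective (sA S') ->
  exists (P : lmodType R) (q : {linear sB S' -> P}) (t : {linear P -> sB S'}),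
    fg_projective P /\ forall x, sf S' x = t (q (sf S' x)).
Proof.
rewrite -tripleE addn1 => ext XA XB XC it PA.
have [s [s0 sn st]] := chain_through XA XB XC it.
have conn_exists j := stable_connecting (st j).
pose d : connecting_maps s := fun j => projT1 (cid (conn_exists j)).
have dP j : stable_exact (d j) (sf (s j)) /\ stable_exact (sg (s j.+1)) (d j).
  by rewrite /d; case: cid.
have ex := @tri_map_exact s d (fun j => fun W v => stable_exact_B v)
  (fun j => (dP j).1) (fun j => (dP j).2).
have [h hE] : exists h, comp h (tri_map d (triple n)) = idm (tri_ob s (triple n).+1).
  apply: (Ext_zero_exact stable_has_sums ex ext).
  by rewrite comp1l tri_map_zero // sn.
have [{hE}h hE] := tri_map_split (ex_intro _ h hE).
have e := stable_compE (stable_repr h) (sg (s n) : lhom _ _).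
have /stable_classP/factors_projP[P [u [v [PP uv]]]] :
    stable_class (lcomp (stable_repr h) (sg (s n))) = stable_class (lid (sB (s n))).
  by rewrite -e stable_reprK.
rewrite -sn; exists P, u, (\- v : {linear _ -> _}); split=> // x.
have := uv (sf (s n) x); rewrite /= (ses_comp0 _ (sP (s n))) linear0 add0r => <-.
by rewrite opprK.
Qed.
End StableChain.

(** * Regular elements in annihilators *)

Section Noetherian.
Variable R : comNzRingType.
Hypothesis noe : noetherian R.
Implicit Types A B C D E F G H I K L M N P Q U V W Y Z : lmodType R.

Lemma mem_tail (T : eqType) (p q : T) (qs : seq T) : q \in qs -> q \in p :: qs.
Proof. by rewrite inE => ->; rewrite orbT. Qed.

Lemma gen_ideal_nth (s : seq R) (k : 'I_(size s)) : gen_ideal s s`_k.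
Proof.
exists (fun i => (i == k :> nat)%:R); rewrite (bigD1 k) //= eqxx scale1r.
rewrite big1 ?addr0 // => l /negPf lk.
by rewrite (inj_eq val_inj) lk scale0r.
Qed.

Lemma fin_gen_ses A B C (f : {linear A -> B}) (g : {linear B -> C}) :
  short_exact f g -> fin_gen A -> fin_gen C -> fin_gen B.
Proof.
move=> ses /fin_genP[m [p ps]] /fin_genP[k [q qs]]; have [fi fg gs] := ses.
have [q' q'E] := proj_lift q (fg_projective_rV R k) gs.
have : fin_gen ('rV[R]_m * 'rV[R]_k)%type.
  exact: (fg_projective_sum (fg_projective_rV R m) (fg_projective_rV R k)).1.
apply: (fin_gen_surj (p := pair_case (f \o p : {linear _ -> _}) q' : {linear _ -> _})) => b.
have [c cE] := qs (g b).
have /fg[a aE] : g (b - q' c) = 0 by rewrite linearB q'E cE subrr.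
have [x xE] := ps a.
by exists (x, c); rewrite /= /pair_case /= xE aE subrK.
Qed.

(** Induction on the rank: the first coordinates form an ideal, and the elements
    whose first coordinate is zero embed in the free module of rank one less. *)
Lemma fin_gen_sub_rV m N (i : {linear N -> 'rV[R]_m}) : injective i -> fin_gen N.
Proof.
elim: m N i => [|m IH] N i ii.
  exists [::] => x; exists (fun=> 0); rewrite big_ord0.
  by apply: (inj0 ii); apply/rowP => -[].
pose g := coordl ord0 \o i : {linear N -> R^o}.
have [K [j [ji jP]]] := ker_exists g.
have [h hE] := @rV_pair R m N (fun k => coordl (lift ord0 k) \o i : {linear N -> R^o}).
have KF : fin_gen K.
  apply: (IH K (h \o j : {linear _ -> _})); apply: lin_inj => x /= hx.
  apply: (inj0 ji); apply: (inj0 ii); apply/rowP => k; rewrite mxE.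
  case: (unliftP ord0 k) => [k' ->|->].
    by have := congr1 (fun v : 'rV_m => v 0 k') hx; rewrite mxE hE.
  by apply: ((jP (j x)).2 (ex_intro _ x erefl)).
have [|C [c [ci cP]]] := @sub_exists _ R^o (fun y => exists x, g x = y).
  split=> [|k x y [x' <-] [y' <-]]; first by exists 0; rewrite linear0.
  by exists (k *: x' + y'); rewrite linearP.
have [g' g'E] : exists g' : {linear N -> C}, forall x, c (g' x) = g x.
  by apply: (lin_factor_inj ci) => x; apply/cP; exists x.
have CF : fin_gen C.
  have [|s sP] := @noe (fun y : R^o => exists x, g x = y).
    split; first by exists 0; rewrite linear0.
    - by move=> a b [x <-] [y <-]; exists (x + y); rewrite linearD.
    - by move=> a b [x <-]; exists (a *: x); rewrite linearZ.
  have im (k : 'I_(size s)) : exists z, c z = s`_k.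
    by apply/cP/sP; exact: gen_ideal_nth.
  have [z zE] := choice im; have [p pE] := rV_map z.
  apply/fin_genP; exists (size s), p => y.
  have [co coE] := (sP (c y)).1 ((cP (c y)).2 (ex_intro _ y erefl)).
  exists (\row_k co k); apply: ci; rewrite pE linear_sum [RHS]coE.
  by apply: eq_bigr => k _; rewrite linearZ /= zE mxE.
apply: (@fin_gen_ses K N C j g') => //; split=> //.
  move=> y; split=> [e|yj]; first by apply/jP; rewrite -g'E e linear0.
  by apply: (inj0 ci); rewrite g'E; apply/jP.
by move=> y; have [x xE] := (cP (c y)).2 (ex_intro _ y erefl); exists x; apply: ci; rewrite g'E.
Qed.

Lemma fin_gen_sub M N (i : {linear N -> M}) : injective i -> fin_gen M -> fin_gen N.
Proof.
move=> ii /fin_genP[m [p ps]].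
have [|K [j [ji jP]]] := @sub_exists _ 'rV[R]_m (fun x => exists y, i y = p x).
  split=> [|k x y [x' e] [y' e']]; first by exists 0; rewrite !linear0.
  by exists (k *: x' + y'); rewrite !linearP e e'.
have KF := fin_gen_sub_rV ji.
have [q qE] : exists q : {linear K -> N}, forall x, i (q x) = (p \o j) x.
  by apply: (lin_factor_inj ii) => z /=; apply/jP; exists z.
apply: (fin_gen_surj (p := q)) KF => y.
have [x xE] := ps (i y); have [z zE] := (jP x).1 (ex_intro _ y (esym xE)).
by exists z; apply: ii; rewrite qE /= zE.
Qed.

Lemma fin_gen_ker M N (p : {linear M -> N}) K (i : {linear K -> M}) :
  short_exact i p -> fin_gen M -> fin_gen K.
Proof. by case=> ii _ _; apply: fin_gen_sub ii. Qed.

(** The ascending chain condition, from finite generation of the union of a chain. *)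
Lemma noetherian_maximal (S : (R -> Prop) -> Prop) J : S J -> (forall J, S J -> is_ideal J) ->
  exists I : R -> Prop, [/\ S I, forall a, J a -> I a &
    forall I' : R -> Prop, S I' -> (forall a, I a -> I' a) -> forall a, I' a -> I a].
Proof.
move=> SJ Sid; apply: contrapT => nmax.
pose T := {I : R -> Prop | S I /\ forall a, J a -> I a}.
have step (I : T) : exists I' : T, (forall a, sval I a -> sval I' a) /\
    exists2 a, sval I' a & ~ sval I a.
  case: I => I [SI JI]; apply: contrapT => no; apply: nmax; exists I; split=> // I' SI' II' a I'a.
  apply: contrapT => nIa; apply: no.
  exists (exist _ I' (conj SI' (fun a Ja => II' a (JI a Ja)))); split=> //.
  by exists a.
have [f fP] := choice step.
pose c k := iter k f (exist _ J (conj SJ (fun a (h : J a) => h)) : T).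
have mono k l a : (k <= l)%N -> sval (c k) a -> sval (c l) a.
  elim: l => [|l IH]; first by rewrite leqn0 => /eqP->.
  rewrite leq_eqVlt => /orP[/eqP<- //|/IH kl /kl]; exact: (fP (c l)).1.
have cid k : is_ideal (sval (c k)) by apply: Sid; case: (c k) => I [].
have [|s sP] := @noe (fun a => exists k, sval (c k) a).
  split; first by exists 0%N; case: (cid 0%N).
  - move=> a b [k ka] [l lb]; exists (maxn k l); have [_ ad _] := cid (maxn k l).
    by apply: ad; [apply: mono ka|apply: mono lb]; rewrite ?leq_maxl ?leq_maxr.
  - by move=> a b [k kb]; exists k; have [_ _ mu] := cid k; exact: mu.
have st (k : 'I_(size s)) : exists l, sval (c l) s`_k.
  by apply/sP; exact: gen_ideal_nth.
have [l lE] := choice st; pose m := \max_k l k.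
have [a ca nca] := (fP (c m)).2.
apply: nca; have [co ->] := (sP a).1 (ex_intro _ m.+1 ca).
have [i0 iD iM] := cid m.
apply: (big_ind (sval (c m))) => // k _.
by apply: (iM (co k) s`_k); apply: mono (lE k); exact: leq_bigmax.
Qed.

Section RegularElement.
Variable J : R -> Prop.
Hypothesis Jid : is_ideal J.

Definition annJ (q : R) : R -> Prop := fun a => J (a * q).
(** R/J is treated through representatives: annJ q is the annihilator of the
    class of q, and maxann singles out the maximal annihilators, which are the
    maximal associated primes. *)
Definition maxann q := ~ J q /\ forall q', ~ J q' ->
  (forall a, annJ q a -> annJ q' a) -> forall a, annJ q' a -> annJ q a.

Lemma annJ_ideal q : is_ideal (annJ q).
Proof.
have [J0 JD JM] := Jid; rewrite /annJ; split; first by rewrite mul0r.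
  by move=> a b; rewrite mulrDl; exact: JD.
by move=> a b; rewrite -mulrA; exact: JM.
Qed.

Lemma maxann_above q : ~ J q -> exists2 q', maxann q' & forall a, annJ q a -> annJ q' a.
Proof.
move=> nq; pose S (I : R -> Prop) := exists2 q', ~ J q' & I = annJ q'.
have Sq : S (annJ q) by exists q.
have Sid (I' : R -> Prop) : S I' -> is_ideal I' by case=> q' _ ->; exact: annJ_ideal.
have [I [[q' nq' ->] qq' mx]] := noetherian_maximal Sq Sid.
exists q' => //; split=> // q2 nq2; apply: mx; by exists q2.
Qed.

Lemma maxann_prime q a b : maxann q -> annJ q (a * b) -> annJ q a \/ annJ q b.
Proof.
move=> [nq mx] ab; have [qb|nqb] := pselect (annJ q b); [by right|left].
apply: (mx (b * q)) => //; last by rewrite /annJ mulrA.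
move=> c cor_dim; rewrite /annJ mulrCA; have [_ _ JM] := Jid; exact: JM.
Qed.

Fixpoint spanl (qs : seq R) (a : R) : Prop :=
  if qs is q :: qs' then exists c b, a = c * q + b /\ spanl qs' b else a = 0.

Lemma spanl0 qs : spanl qs 0.
Proof. by elim: qs => //= q qs IH; exists 0, 0; rewrite mul0r addr0. Qed.
Lemma spanlD qs a b : spanl qs a -> spanl qs b -> spanl qs (a + b).
Proof.
elim: qs a b => [|q qs IH] a b /= => [-> ->|[c [d [-> sd]]] [c' [d' [-> sd']]]].
  by rewrite addr0.
by exists (c + c'), (d + d'); split; [rewrite mulrDl addrACA|exact: IH].
Qed.
Lemma spanlM qs a b : spanl qs b -> spanl qs (a * b).
Proof.
elim: qs b => [|q qs IH] b /= => [->|[c [d [-> sd]]]]; first by rewrite mulr0.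
by exists (a * c), (a * d); split; [rewrite mulrDr mulrA|exact: IH].
Qed.
Lemma spanl_catr ps qs a : spanl qs a -> spanl (ps ++ qs) a.
Proof. by elim: ps => //= p ps IH /IH h; exists 0, a; rewrite mul0r add0r. Qed.
Lemma spanl_catl ps qs a : spanl ps a -> spanl (ps ++ qs) a.
Proof.
elim: ps a => [|p ps IH] a /= => [->|[c [d [-> /IH h]]]]; first exact: spanl0.
by exists c, d.
Qed.

(** The q with maximal annihilator generate an ideal with finitely many generators
    among them.  Any other maximal annihilator contains the intersection of these
    primes, hence one of them, hence equals it. *)
Lemma maxann_finite : exists qs : seq R, (forall q, q \in qs -> maxann q) /\
  forall q, maxann q -> exists2 q', q' \in qs & forall a, annJ q a -> annJ q' a.
Proof.
have [J0 JD JM] := Jid.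
pose G (a : R) := exists qs : seq R, (forall q, q \in qs -> maxann q) /\ spanl qs a.
have [|s sP] := @noe G.
  split; first by exists [::].
  - move=> a b [qs [mq sa]] [ps [mp sb]]; exists (qs ++ ps); split.
      by move=> q; rewrite mem_cat => /orP[/mq|/mp].
    by apply: spanlD; [exact: spanl_catl|exact: spanl_catr].
  - by move=> a b [qs [mq sb]]; exists qs; split=> //; exact: spanlM.
have [qs [mq qsP]] : exists qs : seq R, (forall q, q \in qs -> maxann q) /\
    forall k, (k < size s)%N -> spanl qs s`_k.
  have : forall k, (k < size s)%N -> G s`_k.
    by move=> k ks; apply/sP; exact: (gen_ideal_nth (Ordinal ks)).
  elim: s {sP} => [|x s IH] sG; first by exists [::].
  have [qs [mq qsP]] := IH (fun k ks => sG k.+1 ks).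
  have [ps [mp psP]] := sG 0%N isT.
  exists (ps ++ qs); split; first by move=> q; rewrite mem_cat => /orP[/mp|/mq].
  by case=> [|k] ks; [exact: spanl_catl|apply: spanl_catr; exact: qsP].
exists qs; split=> // q qm.
have qG : spanl qs q.
  have /sP[c ->] : G q.
    by exists [:: q]; split=> [q'|]; [rewrite inE => /eqP->|exists 1, 0; rewrite mul1r addr0].
  apply: (big_ind (spanl qs)); [exact: spanl0|exact: spanlD|].
  by move=> i _; apply: spanlM; exact: qsP.
(* The prime annJ q contains the intersection of the others, hence one of them. *)
suff [q' q'qs q'q] : exists2 q', q' \in qs & forall a, annJ q' a -> annJ q a.
  exists q' => //; exact: (mq q' q'qs).2 q qm.1 q'q.
apply: contrapT => no.
have [x xqs nxq] : exists2 x, forall q', q' \in qs -> annJ q' x & ~ annJ q x.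
  have {no} : forall q', q' \in qs -> exists2 a, annJ q' a & ~ annJ q a.
    move=> q' q'qs; apply: contrapT => na; apply: no; exists q' => // a qa.
    by apply: contrapT => nqa; apply: na; exists a.
  elim: qs {mq qsP qG} => [|p qs IH] no.
    by exists 1 => //; rewrite /annJ mul1r; exact: qm.1.
  have [x xP nx] := IH (fun q' h => no q' (mem_tail _ h)).
  have [a aP na] := no p (mem_head _ _).
  exists (a * x); last by move=> /(maxann_prime qm)[].
  move=> q'; rewrite inE => /orP[/eqP->|/xP h].
    by rewrite mulrC; have [_ _ M] := annJ_ideal p; exact: M.
  by have [_ _ M] := annJ_ideal q'; exact: M.
apply: nxq; rewrite /annJ; elim: qs q {qm mq qsP no} qG xqs => [|p qs IH] q /=.
  by move=> -> _; rewrite mulr0.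
move=> [c [b [-> sb]]] xP; rewrite mulrDr; apply: JD.
  rewrite mulrCA; apply: JM; exact: (xP p (mem_head _ _)).
by apply: IH => // q' h; apply: xP; exact: mem_tail.
Qed.

(** Prime avoidance over the maximal associated primes of R/J: zero divisors on
    R/J lie in one of them, and I lies in none by the hypothesis. *)
Lemma regular_elt (I : R -> Prop) : is_ideal I ->
  (forall q, (forall a, I a -> J (a * q)) -> J q) ->
  exists2 y, I y & forall q, J (y * q) -> J q.
Proof.
move=> [I0 ID IM] Iq; have [qs [mq qsP]] := maxann_finite.
suff [y Iy yP] : exists2 y, I y & forall q, q \in qs -> ~ annJ q y.
  exists y => // q yq; apply: contrapT => nq.
  have [q1 mq1 qq1] := maxann_above nq; have [q2 q2s q12] := qsP q1 mq1.
  by apply: (yP q2 q2s); apply: q12; exact: qq1.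
elim: qs mq {qsP} => [|q qs IH] mq; first by exists 0.
have [y Iy yP] := IH (fun q' h => mq q' (mem_tail _ h)).
have [yq|nyq] := pselect (annJ q y); last first.
  by exists y => // q'; rewrite inE => /orP[/eqP->|/yP].
have mqq := mq q (mem_head _ _).
have [z Iz [zq zqs]] : exists2 z, I z & ~ annJ q z /\ forall q', q' \in qs -> annJ q' z.
  have : forall q', q' \in qs -> exists2 b, annJ q' b & ~ annJ q b.
    move=> q' q's; apply: contrapT => no; apply: (yP q' q's).
    have mq' := mq q' (mem_tail q q's).
    apply: (mq'.2 q mqq.1) yq => a aq'.
    by apply: contrapT => na; apply: no; exists a.
  elim: qs {IH mq yP} => [|p qs IH] no.
    have [a [Ia naq]] : exists a, I a /\ ~ annJ q a.
      apply: contrapT => no'; apply: mqq.1; apply: Iq => a Ia.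
      by apply: contrapT => na; apply: no'; exists a.
    by exists a.
  have [z Iz [zq zP]] := IH (fun q' h => no q' (mem_tail _ h)).
  have [b bp nb] := no p (mem_head _ _).
  exists (b * z); first exact: IM.
  split; first by move=> /(maxann_prime mqq)[].
  move=> q'; rewrite inE => /orP[/eqP->|/zP h].
    by rewrite mulrC; have [_ _ M] := annJ_ideal p; exact: M.
  by have [_ _ M] := annJ_ideal q'; exact: M.
have sub p a b : annJ p (a + b) -> annJ p a -> annJ p b.
  move=> ab pa; have [_ D M] := annJ_ideal p.
  by rewrite -[b](addKr a) -mulN1r; apply: D ab; apply: M.
exists (y + z); first exact: ID.
move=> q'; rewrite inE => /orP[/eqP->|q's].
  by move=> yz; apply: zq; apply: sub yz yq.
by rewrite addrC => yz; apply: (yP q' q's); apply: sub yz (zqs q' q's).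
Qed.

(** Induction on the number of generators reduces to a cyclic module: if y' maps U
    into R u1, then every q killed by the annihilator of u1 gives a map U -> R/J by
    u |-> c q, where y' u = c u1. *)
Lemma regular_ann Q (p : {linear R^o -> Q}) U : surj p ->
  (forall a, p a = 0 <-> J a) -> fin_gen U ->
  (forall f : {linear U -> Q}, forall u, f u = 0) ->
  exists y : R, (forall q, J (y * q) -> J q) /\ forall u : U, y *: u = 0.
Proof.
move=> ps pJ /fin_genP[m [g gs]].
elim: m U g gs => [|m IH] U g gs h0.
  exists 1; split=> [q|u]; first by rewrite mul1r.
  by have [x <-] := gs u; rewrite scale1r [x]thinmx0 linear0.
pose u1 := g (delta_mx 0 ord0).
have [V [r [rs rP]]] : exists (V : lmodType R) (r : {linear U -> V}), surj r /\
    forall x, r x = 0 <-> exists c : R, x = c *: u1.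
  apply: quot_exists; split; first by exists 0; rewrite scale0r.
  by move=> k x y [c ->] [d ->]; exists (k * c + d); rewrite scalerDl scalerA.
have [g' g'E] := rV_map_delta (fun i : 'I_m => r (g (delta_mx 0 (lift ord0 i)))).
have g's : surj g'.
  move=> v; have [u <-] := rs v; have [x <-] := gs u.
  exists (\row_i x 0 (lift ord0 i)).
  rewrite rV_mapE [in RHS]rV_mapE linear_sum big_ord_recl /= linearZ /=.
  rewrite (_ : r (g _) = 0) ?scaler0 ?add0r; last by apply/rP; exists 1; rewrite scale1r.
  by apply: eq_bigr => i _; rewrite g'E mxE linearZ.
have [y' [y'r y'V]] := IH V g' g's (fun f v =>
  let: ex_intro u e := rs v in
  etrans (congr1 f (esym e)) (h0 (f \o r : {linear _ -> _}) u)).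
have y'U u : exists c : R, y' *: u = c *: u1.
  by apply/rP; rewrite linearZ /= y'V.
have [||y'' y''1 y''r] := @regular_elt (fun a => a *: u1 = 0).
- split; first by rewrite scale0r.
    by move=> a b ea eb; rewrite scalerDl ea eb addr0.
  by move=> a b eb; rewrite -scalerA eb scaler0.
- move=> q Iq; apply: y'r; apply/pJ.
  have [f fP] : exists f : {linear U -> Q}, forall u, exists2 c : R,
      y' *: u = c *: u1 & f u = p (c * q).
    apply: (lin_of_rel (r := fun u z => exists2 c : R, y' *: u = c *: u1 & z = p (c * q))).
    - by move=> u; have [c cE] := y'U u; exists (p (c * q)), c.
    - move=> u z z' [c e ->] [c' e' ->]; apply/eqP; rewrite -subr_eq0 -linearB; apply/eqP/pJ.
      rewrite -mulrBl; apply: Iq; rewrite scalerBl -e -e' subrr //.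
    - move=> k u z u' z' [c e ->] [c' e' ->]; exists (k * c + c').
        by rewrite scalerDr scalerDl e' -scalerA -e !scalerA mulrC.
      by rewrite mulrDl -mulrA linearD -linearZ.
  have [c e] := fP u1; rewrite h0 => e0.
  have : J ((y' - c) * q) by apply: Iq; rewrite scalerBl e subrr.
  move=> /pJ; rewrite mulrBl linearB -e0 subr0 //.
exists (y' * y''); split=> [q|u].
  by rewrite -mulrA => /y'r/y''r.
by have [c e] := y'U u; rewrite mulrC -scalerA e scalerA mulrC -scalerA y''1 scaler0.
Qed.

End RegularElement.
End Noetherian.

(** * Projective dimension and regular sequences *)

Section ProjDim.
Variable R : comNzRingType.
Implicit Types A B C D E F G H K L M N P Q U V W Y Z : lmodType R.

(** Projective dimension at most n, by recursion on the first syzygy. *)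
Fixpoint pd_le (n : nat) A : Prop :=
  if n is n'.+1 then
    exists K P (i : {linear K -> P}) (p : {linear P -> A}),
      [/\ fg_projective P, short_exact i p & pd_le n' K]
  else fg_projective A.

Lemma pd_leS n A : pd_le n A -> pd_le n.+1 A.
Proof.
elim: n A => [|n IH] A /=; last first.
  by move=> [K [P [i [p [PP ses /IH pK]]]]]; exists K, P, i, p.
move=> PA; exists 'rV[R]_0, A, (\0 : {linear 'rV[R]_0 -> A}), (idfun : {linear A -> A}).
split=> //; last exact: fg_projective_rV.
split=> [x y _|y /=|y]; first by rewrite [x]thinmx0 [y]thinmx0.
  by split=> [->|[x <-] //]; exists 0.
by exists y.
Qed.

Lemma pd_le_ses n (S : ses R) : pd_le n (sA S) -> pd_le n (sC S) -> pd_le n (sB S).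
Proof.
elim: n S => [|n IH] S /=; first exact: fg_projective_ses (sP S).
move=> [KA [PA [jA [pA [PPA sesA pKA]]]]] [KC [PC [jC [pC [PPC sesC pKC]]]]].
have [Sfi Se Sgs] := sP S; have [_ _ spA] := sesA; have [_ _ spC] := sesC.
have [l lE] := proj_lift pC PPC Sgs.
pose pB : {linear (PA * PC)%type -> sB S} := pair_case (sf S \o pA : {linear _ -> _}) l.
have spB : surj pB.
  move=> b; have [c cE] := spC (sg S b).
  have /Se[a aE] : sg S (b - l c) = 0 by rewrite linearB lE cE subrr.
  have [x xE] := spA a.
  by exists (x, c); rewrite /= /pair_case /= xE aE subrK.
have [KB [jB sesB]] := ses_ker spB.
exists KB, (PA * PC)%type, jB, pB; split=> //; first exact: fg_projective_sum.
have [||f [g [ses1 _ _]]] := @ses_kernels R S (Ses (ses_prod PA PC)) _ _ _ jA jB jC pA pB pC sesA sesB sesC.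
- by move=> x; rewrite /pB /= /pair_case /= linear0 addr0.
- by move=> x; rewrite /pB /= /pair_case /= linearD lE (ses_comp0 _ (sP S)) add0r.
exact: (IH (Ses ses1)).
Qed.

(** The kernel of P -> C is an extension of A by the first syzygy of B. *)
Lemma pd_le_cokernel n (S : ses R) : pd_le n (sA S) -> pd_le n.+1 (sB S) -> pd_le n.+1 (sC S).
Proof.
move=> pA [K [P [i [p [PP sesP pK]]]]].
have [Sfi Se Sgs] := sP S; have [ii ip ps] := sesP.
have qs : surj (sg S \o p : {linear _ -> _}).
  by move=> c; have [b <-] := Sgs c; have [x <-] := ps b; exists x.
have [L [j sesL]] := ses_ker qs.
exists L, P, j, (sg S \o p : {linear _ -> _}); split=> //.
have [ji jq _] := sesL.
have [f fE] : exists f : {linear K -> L}, forall x, j (f x) = i x.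
  by apply: (lift_ses sesL) => x /=; rewrite (ses_comp0 x sesP) linear0.
have [g gE] : exists g : {linear L -> sA S}, forall x, sf S (g x) = (p \o j) x.
  by apply: (lift_ses (sP S)) => x /=; exact: (ses_comp0 x sesL).
have ses : short_exact f g.
  split.
  - by apply: lin_inj => x fx; apply: (inj0 ii); rewrite -fE fx linear0.
  - move=> y; split=> [gy|[x <-]].
      have /ip[x xE] : p (j y) = 0 by have /= <- := gE y; rewrite gy linear0.
      by exists x; apply: ji; rewrite fE.
    by apply: (inj0 Sfi); rewrite gE /= fE (ses_comp0 x sesP).
  - move=> a; have [x xE] := ps (sf S a).
    have /jq[y yE] : sg S (p x) = 0 by rewrite xE (ses_comp0 _ (sP S)).
    by exists y; apply: Sfi; rewrite gE /= yE.
exact: (@pd_le_ses n (Ses ses)).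
Qed.

Lemma pd_le_resolution n A : pd_le n A ->
  exists P : fg_resolution A, forall i, (n < i)%N -> forall x : P i, x = 0.
Proof.
elim: n A => [|n IH] A /=.
  move=> PA; pose Z : lmodType R := 'rV[R]_0.
  have Z0 (x : Z) : x = 0 by rewrite [x]thinmx0.
  pose P i : lmodType R := if i is 0 then A else Z.
  pose d i : {linear P i.+1 -> P i} := \0.
  have Pp i : fg_projective (P i) by case: i => // i; exact: fg_projective_rV.
  have ex0 : exact (d 0) (idfun : {linear A -> A}).
    by move=> y; split=> [/= ->|[x <-] //]; exists 0.
  have ex i : exact (d i.+1) (d i).
    by move=> y; split=> [_|//]; exists 0; rewrite (Z0 y).
  have su : surj (idfun : {linear A -> A}) by move=> y; exists y.
  exists (@FgResolution R A P d idfun Pp su ex0 ex) => -[|i] // _ x; exact: Z0.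
move=> [K [P0 [f [p [PP [fi fp ps] /IH[P Pz]]]]]].
pose P' i : lmodType R := if i is j.+1 then P j else P0.
pose d' i : {linear P' i.+1 -> P' i} :=
  match i return {linear P' i.+1 -> P' i} with
  | 0 => f \o fres_aug P | j.+1 => fres_d P j end.
have Pp i : fg_projective (P' i) by case: i => // i; exact: fres_proj.
have ex0 : exact (d' 0) p.
  move=> y; split=> [/fp[x <-]|[x <-]]; last by apply/fp; exists (fres_aug P x).
  by have [z <-] := fres_surj P x; exists z.
have ex i : exact (d' i.+1) (d' i).
  case: i => [|i]; last exact: fres_exact.
  move=> y; split=> [/= e|[x <-] /=].
    by apply/fres_exact0; apply: (inj0 fi).
  by rewrite ((@fres_exact0 R K P (fres_d P 0 x)).2 _) ?linear0 //; exists x.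
exists (@FgResolution R A P' d' p Pp ps ex0 ex) => -[|i] // ni x; exact: Pz.
Qed.

Lemma pd_le_pd_lt n m A : (n < m)%N -> pd_le n A -> pd_lt m A.
Proof.
move=> nm /pd_le_resolution[P Pz]; exists P => i mi; apply: Pz; exact: leq_trans mi.
Qed.

Lemma gen_ideal_ideal (s : seq R) : is_ideal (gen_ideal s).
Proof.
split.
- by exists (fun=> 0); rewrite big1 // => i _; rewrite scale0r.
- move=> a b [c ->] [d ->]; exists (fun i => c i + d i); rewrite -big_split.
  by apply: eq_bigr => i _; rewrite scalerDl.
- move=> a b [c ->]; exists (fun i => a * c i); rewrite mulr_sumr.
  by apply: eq_bigr => i _; rewrite -scalerA.
Qed.

Lemma gen_ideal_nil a : gen_ideal [::] a <-> a = 0 :> R.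
Proof. by split=> [[c ->]|->]; [rewrite big_ord0|exists (fun=> 0); rewrite big_ord0]. Qed.

Lemma gen_ideal_rcons (s : seq R) y a :
  gen_ideal (rcons s y) a <-> exists b c : R, gen_ideal s b /\ a = b + c * y.
Proof.
rewrite /gen_ideal /span size_rcons; split=> [[c ->]|[_ [d [[c ->] ->]]]].
  exists (\sum_(i < size s) c i * s`_i), (c (size s)); split; first by exists c.
  rewrite big_ord_recr /= nth_rcons ltnn eqxx; congr (_ + _).
  by apply: eq_bigr => i _; rewrite nth_rcons ltn_ord.
exists (fun i => if (i < size s)%N then c i else d).
rewrite big_ord_recr /= nth_rcons ltnn eqxx; congr (_ + _).
by apply: eq_bigr => i _; rewrite nth_rcons ltn_ord.
Qed.

Lemma regular_seq_rcons (s : seq R) y : regular_seq (rcons s y) <->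
  [/\ regular_seq s, forall a, gen_ideal s (y * a) -> gen_ideal s a &
      ~ gen_ideal (rcons s y) 1].
Proof.
split=> [[reg n1]|[[reg n1] yr n1']].
  split=> //; last first.
    by have := reg (size s); rewrite size_rcons ltnSn nth_rcons ltnn eqxx -cats1 take_size_cat //; apply.
  split=> [i si a|s1].
    have := reg i; rewrite size_rcons nth_rcons si ltnS (ltnW si) -cats1 takel_cat ?(ltnW si) //.
    by apply.
  by apply: n1; apply/gen_ideal_rcons; exists 1, 0; rewrite mul0r addr0.
split=> // i; rewrite size_rcons ltnS leq_eqVlt => /orP[/eqP->|si] a.
  by rewrite nth_rcons ltnn eqxx -cats1 take_size_cat //; exact: yr.
by rewrite nth_rcons si -cats1 takel_cat ?(ltnW si) //; exact: reg.
Qed.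

Lemma quotient_ring_exists (s : seq R) : exists Q, is_quotient_ring_module s Q.
Proof.
have [Q [p pP]] := @quot_exists R R^o (gen_ideal s) (conj (let: And3 h _ _ := gen_ideal_ideal s in h)
  (fun k x y hx hy => let: And3 _ ad mu := gen_ideal_ideal s in ad _ _ (mu k x hx) hy)).
by exists Q, p.
Qed.

(** Multiplication by the last element of the sequence is injective on the previous
    quotient, so each element raises the projective dimension by at most one. *)
Lemma pd_le_quotient_ring (s : seq R) Q :
  regular_seq s -> is_quotient_ring_module s Q -> pd_le (size s) Q.
Proof.
elim/last_ind: s Q => [|s y IH] Q.
  move=> _ [p [ps pk]] /=.
  have pi : injective p by apply: lin_inj => x /pk/gen_ideal_nil.
  have [h hE] : exists h : {linear Q -> R^o}, forall x, h (p x) = x.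
    apply: (lin_factor_surj (h := idfun : {linear R^o -> R^o}) ps) => x px.
    by apply: pi; rewrite px linear0.
  have [g gE] := rV_map_delta (fun i : 'I_1 => 1 : R^o).
  have kL : linear (fun q : Q => \row_(j < 1) h q : 'rV[R]_1).
    by move=> k x z; apply/rowP => i; rewrite !mxE linearP.
  apply: (@fg_projective_retract R 'rV[R]_1 Q (p \o g : {linear _ -> _}) (mklin kL)).
  - move=> q /=; have [x <-] := ps q.
    rewrite rV_mapE big_ord1 gE mxE hE; congr (p _); exact: mulr1.
  - exact: fg_projective_rV.
move=> /regular_seq_rcons[rs yr n1] [p [ps pk]]; rewrite size_rcons.
have [Q' [p' [ps' pk']]] := quotient_ring_exists s.
have mL : linear (fun q : Q' => y *: q).
  by move=> k a b; rewrite scalerDr !scalerA mulrC.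
have [g gE] : exists g : {linear Q' -> Q}, forall x, g (p' x) = p x.
  apply: (lin_factor_surj ps') => x /pk' sx; apply/pk/gen_ideal_rcons.
  by exists x, 0; rewrite mul0r addr0.
have ses : short_exact (mklin mL) g.
  split.
  - apply: lin_inj => q; have [a <-] := ps' q => /=.
    by rewrite -linearZ => /pk'/yr/pk'.
  - move=> q; split=> [|[q' <-]].
      have [a <-] := ps' q; rewrite gE => /pk/gen_ideal_rcons[b [c [sb ->]]].
      exists (p' c); rewrite /= -linearZ linearD /= (pk' b).2 // add0r.
      by rewrite /GRing.scale /= mulrC.
    have [a <-] := ps' q'; rewrite /= -linearZ gE; apply/pk/gen_ideal_rcons.
    have [s0 _ _] := gen_ideal_ideal s.
    by exists 0, a; rewrite add0r mulrC.
  - by move=> q; have [a <-] := ps q; exists (p' a).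
have pQ' := IH Q' rs (ex_intro _ p' (conj ps' pk')).
exact: (@pd_le_cokernel (size s) (Ses ses) pQ' (pd_leS pQ')).
Qed.

End ProjDim.

(** * Modules of finite projective dimension over a quotient ring *)

Section Relative.
Variable R : comNzRingType.
Implicit Types A B C D E F G H K L M N P Q U V W Y Z : lmodType R.
Implicit Types J : R -> Prop.

Definition killed J M := forall a (x : M), J a -> a *: x = 0.

(** Projectivity over R/J, phrased for R-modules killed by J to avoid changing the
    base ring. *)
Definition projective_mod J P :=
  [/\ fin_gen P, killed J P & forall A B (p : {linear A -> B}) (g : {linear P -> B}),
     killed J A -> surj p -> exists h : {linear P -> A}, forall x, p (h x) = g x].

Fixpoint pd_le_mod J (m : nat) W : Prop :=
  if m is m'.+1 then
    exists K P (i : {linear K -> P}) (p : {linear P -> W}),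
      [/\ projective_mod J P, short_exact i p & pd_le_mod J m' K]
  else projective_mod J W.

Lemma projective_mod0 J P : (forall a, J a <-> a = 0) -> fg_projective P -> projective_mod J P.
Proof.
move=> J0 [PF PP]; split=> // [a x /J0->|A B p g _ ps]; first exact: scale0r.
by have [h hE] := PP _ _ p g ps; exists h.
Qed.

Lemma pd_le_mod0 J m W : (forall a, J a <-> a = 0) -> pd_le m W -> pd_le_mod J m W.
Proof.
move=> J0; elim: m W => [|m IH] W /=; first exact: projective_mod0.
move=> [K [P [i [p [PP ses /IH pK]]]]]; exists K, P, i, p; split=> //; exact: projective_mod0.
Qed.

(** The direct sum of m copies of Q, as an iterated product so that membership in a
    resolving subcategory follows by induction. *)
Fixpoint power_module (Q : lmodType R) (m : nat) : lmodType R :=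
  if m is m'.+1 then (Q * power_module Q m')%type else 'rV[R]_0.

Lemma power_module_sum Q P m (f : nat -> {linear Q -> P}) :
  exists e : {linear power_module Q m -> P}, forall c : nat -> Q, exists z,
    e z = \sum_(i < m) f i (c i).
Proof.
elim: m f => [|m IH] f.
  by exists (\0 : {linear 'rV[R]_0 -> P}) => c; exists 0; rewrite big_ord0.
have [e eP] := IH (fun i => f i.+1).
exists (pair_case (f 0%N) e : {linear (Q * power_module Q m)%type -> P}) => c.
have [z zE] := eP (fun i => c i.+1); exists (c 0%N, z).
by rewrite big_ord_recl /= /pair_case /= zE.
Qed.

Lemma power_module_pairing Q Z m (f : nat -> {linear Z -> Q}) :
  exists h : {linear Z -> power_module Q m}, forall z, h z = 0 -> forall i, (i < m)%N -> f i z = 0.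
Proof.
elim: m f => [|m IH] f; first by exists \0.
have [h hP] := IH (fun i => f i.+1).
exists (pairing (f 0%N) h : {linear Z -> (Q * power_module Q m)%type}) => z /= [f0 /hP h0] [|i] //.
exact: h0.
Qed.

Lemma power_module_killed J Q m : killed J Q -> killed J (power_module Q m).
Proof.
move=> kQ; elim: m => [|m IH] a x Ja; first by rewrite [x]thinmx0 scaler0.
case: x => q z; apply/pair_equal_spec; split; [exact: kQ|exact: IH].
Qed.

Lemma power_module_regular Q m (y : R) : (forall q : Q, y *: q = 0 -> q = 0) ->
  forall x : power_module Q m, y *: x = 0 -> x = 0.
Proof.
move=> yQ; elim: m => [|m IH] x; first by rewrite [x]thinmx0.
by case: x => q z [/yQ -> /IH ->].
Qed.

Lemma power_module_fg Q m : fin_gen Q -> fin_gen (power_module Q m).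
Proof.
move=> QF; elim: m => [|m IH] /=; first exact: (fg_projective_rV R 0).1.
exact: fin_gen_ses (ses_prod Q (power_module Q m)) QF IH.
Qed.

Section WithQ.
Variables (J : R -> Prop) (Q : lmodType R) (p : {linear R^o -> Q}).
Hypothesis Jid : is_ideal J.
Hypothesis ps : surj p.
Hypothesis pJ : forall a, p a = 0 <-> J a.

Lemma quotient_killed : killed J Q.
Proof.
move=> a x Ja; have [b <-] := ps x; rewrite -linearZ; apply/pJ.
by have [_ _ JM] := Jid; rewrite /GRing.scale /= mulrC; exact: JM.
Qed.

Lemma map_from_quotient P (s : P) : killed J P -> exists f : {linear Q -> P}, forall a, f (p a) = a *: s.
Proof.
move=> kP; have hL : linear (fun a : R^o => a *: s).
  by move=> k a b; rewrite scalerDl scalerA.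
by apply: (lin_factor_surj (h := mklin hL) ps) => a /= /pJ /kP.
Qed.

Lemma projective_mod_retract P : projective_mod J P -> exists m (e : {linear power_module Q m -> P})
  (s : {linear P -> power_module Q m}), forall x, e (s x) = x.
Proof.
move=> [[s sP] kP PP].
have [f fE] := choice (fun i => map_from_quotient s`_i kP).
have [e eP] := power_module_sum (size s) f.
have es : surj e.
  move=> x; have [c ->] := sP x; have [z zE] := eP (fun i => p (c i)).
  by exists z; rewrite zE; apply: eq_bigr => i _; rewrite fE.
have [h hE] := PP _ _ e (idfun : {linear P -> P}) (power_module_killed (m := _) quotient_killed) es.
by exists (size s), e, h.
Qed.

Lemma projective_mod_regular P (y : R) : (forall q, J (y * q) -> J q) -> projective_mod J P ->
  forall x : P, y *: x = 0 -> x = 0.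
Proof.
move=> yr /projective_mod_retract[m [e [s es]]] x yx.
rewrite -(es x) (_ : s x = 0) ?linear0 //.
apply: (power_module_regular (y := y)); last by rewrite -linearZ yx linear0.
by move=> q; have [a <-] := ps q; rewrite -linearZ => /pJ/yr/pJ.
Qed.

(** Hom(Q, Q) = R/J for Q = R/J: a map P -> Q is a combination of coordinates, so
    the form t only sees its values on the coordinates of a. *)
Lemma form_on_homs K P (t : {linear lhom K Q -> Q}) (a : {linear K -> P}) : projective_mod J P ->
  exists k : P, forall f : {linear P -> Q}, t (lcomp f a) = f k.
Proof.
move=> /projective_mod_retract[m [e [s es]]].
have powE : forall n (a : {linear K -> power_module Q n}),
    exists k : power_module Q n, forall f : {linear power_module Q n -> Q}, t (lcomp f a) = f k.
  elim=> [|n IH] b.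
    exists 0 => f; rewrite (_ : lcomp f b = 0) ?linear0 //.
    by apply: lhomP => x /=; rewrite [b x]thinmx0 linear0.
  have [k kE] := IH (sndl _ _ \o b : {linear K -> power_module Q n}).
  exists (t (lcomp (fstl Q (power_module Q n)) b), k) => f.
  pose f0 : lhom Q Q := f \o @pair_l R Q (power_module Q n) : {linear _ -> _}.
  pose f1 := f \o @pair_r R Q (power_module Q n) : {linear power_module Q n -> Q}.
  have [r rE] := ps (f0 (p 1)).
  have f0E q : f0 q = r *: q.
    have pZ (x z : R) : x *: p z = p (x * z) by rewrite -linearZ.
    have [c <-] := ps q; have -> : p c = c *: p 1 by rewrite pZ mulr1.
    by rewrite linearZZ -rE !pZ mulr1 mulrC.
  rewrite [in RHS](pair_lr (_, k)) linearD /=.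
  rewrite (_ : lcomp f b = (r : R) *: lcomp (fstl Q (power_module Q n)) b + lcomp f1 (sndl _ _ \o b : {linear _ -> _})).
    by rewrite linearD linearZ kE /= -f0E.
  apply: lhomP => x /=; rewrite [in LHS](pair_lr (b x)) linearD; congr (_ + _).
  exact: (f0E (b x).1).
have [k kE] := powE m (s \o a : {linear _ -> _}).
exists (e k) => f; rewrite -[RHS](kE (f \o e : {linear _ -> _})); congr (t _).
by apply: lhomP => x /=; rewrite es.
Qed.

Lemma fin_gen_lhom K : noetherian R -> fin_gen K -> fin_gen (lhom K Q).
Proof.
move=> noe [s sP].
have eL i : linear (fun f : lhom K Q => f s`_i) by [].
have [h hP] := power_module_pairing (size s) (fun i => mklin (eL i)).
have QF : fin_gen Q.
  exists [:: p 1] => q; have [a <-] := ps q; exists (fun=> a).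
  by rewrite big_ord1 /= -linearZ; congr (p _); rewrite /GRing.scale /= mulr1.
apply: (fin_gen_sub noe (i := h)) (power_module_fg _ QF).
apply: lin_inj => f /hP f0; apply: lhomP => x /=.
have [c ->] := sP x; rewrite linear_sum big1 // => i _.
by rewrite linearZ; have /= -> := f0 i (ltn_ord i); exact: scaler0.
Qed.

End WithQ.

Definition regular_mod J (y : R) := forall q, J (y * q) -> J q.

Lemma pd_le_mod_fg J m K : pd_le_mod J m K -> fin_gen K.
Proof.
case: m => [[]//|m] /= [L [P [i [g [[PF _ _] [_ _ gs] _]]]]].
exact: fin_gen_surj PF.
Qed.

(** Let U be the cokernel of Hom(F, Q) -> Hom(K, Q).  A form on U, composed
    with the map f |-> f a, is evaluation at some k in P.  It vanishes on the f b with
    f extending to F, so b k = 0, and then y kills the form.  So Hom(U, Q) = 0, and U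
    is killed by an element w regular on Q.  Then y w kills the class of the sequence. *)
Lemma extend_multiple J K F W (i : {linear K -> F}) (g : {linear F -> W}) P
    (a : {linear K -> P}) (b : {linear P -> K}) (y : R) :
  noetherian R -> is_ideal J -> regular_mod J y -> fin_gen K -> projective_mod J F -> projective_mod J P ->
  (forall x, b (a x) = y *: x) -> short_exact i g ->
  exists (z : R) (c : {linear F -> K}), regular_mod J z /\ forall x, c (i x) = z *: x.
Proof.
move=> noe Jid yr KF FP PP ab ses; have [ii ig gs] := ses; have [J0 JD JM] := Jid.
have [Q [p [ps pJ]]] := @quot_exists R R^o J
  (conj J0 (fun k x y hx hy => JD _ _ (JM k x hx) hy)).
pose S (f : lhom K Q) := exists f' : {linear F -> Q}, forall x, f' (i x) = f x.
have Ssub : submod S.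
  split; first by exists \0.
  move=> k f f' [h hE] [h' h'E]; exists (k \*: h \+ h' : {linear _ -> _}) => x /=.
  by rewrite hE h'E.
have [U [r [rs rP]]] := quot_exists Ssub.
have UF : fin_gen U := fin_gen_surj rs (fin_gen_lhom ps noe KF).
have [w [wr wU]] : exists w : R, regular_mod J w /\ forall u : U, w *: u = 0.
  apply: (regular_ann noe Jid ps pJ UF) => t u.
  have [f <-] := rs u.
  have [k kE] := form_on_homs Jid ps pJ (t \o r : {linear lhom K Q -> Q}) a PP.
  have bk : b k = 0.
    apply: (inj0 ii).
    have [m [e [s es]]] := projective_mod_retract Jid ps pJ FP.
    (* The restriction of h to K is zero in U, and i (b k) lies in F, which embeds
       in a power of Q. *)
    have van (h : {linear F -> Q}) : h (i (b k)) = 0.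
      have := kE (h \o i \o b : {linear _ -> _}) => /= <-.
      rewrite (_ : r _ = 0) ?linear0 //; apply/rP.
      exists (y \*: h : {linear _ -> _}) => x /=.
      by rewrite ab !linearZ.
    rewrite -(es (i (b k))) (_ : s _ = 0) ?linear0 //.
    elim: m {e es} s => [|m IHm] s; first by rewrite [s _]thinmx0.
    rewrite [s _](surjective_pairing); apply/pair_equal_spec; split.
      exact: (van (fstl _ _ \o s : {linear _ -> _})).
    exact: (IHm (sndl _ _ \o s : {linear _ -> _})).
  have yt : y *: t (r f) = 0.
    have := kE (f \o b : {linear _ -> _}); rewrite /= bk linear0 => <-.
    rewrite -!linearZ; congr (t (r _)); apply: lhomP => x /=.
    by rewrite ab linearZ.
  have [q qE] := ps (t (r f)); move: yt; rewrite -qE -linearZ => /pJ/yr/pJ //.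
have [m [e [s es]]] := projective_mod_retract Jid ps pJ PP.
have powE : forall n (h : {linear K -> power_module Q n}),
    exists h' : {linear F -> power_module Q n}, forall x, h' (i x) = w *: h x.
  elim=> [|n IH] h; first by exists \0 => x; rewrite [h x]thinmx0 scaler0.
  have [h2 h2E] := IH (sndl _ _ \o h : {linear _ -> _}).
  have [h1 h1E] : S (w *: lcomp (fstl Q (power_module Q n)) h).
    by apply/rP; rewrite linearZ /= wU.
  exists (pairing h1 h2 : {linear _ -> _}) => x.
  by apply/pair_equal_spec; split; [rewrite h1E|rewrite h2E].
have [h hE] := powE m (s \o a : {linear _ -> _}).
exists (y * w), (b \o e \o h : {linear _ -> _}); split=> [q|x].
  by rewrite -mulrA => /yr/wr.
by rewrite /= hE !linearZ /= es ab scalerA mulrC.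
Qed.

(** Multiplication by some y regular on R/J factors on W through a projective
    module over R/J: modulo J, W is projective after inverting y. *)
Lemma pd_le_mod_multiple J m W : noetherian R -> is_ideal J -> pd_le_mod J m W ->
  exists (y : R) P (a : {linear W -> P}) (b : {linear P -> W}),
    [/\ regular_mod J y, projective_mod J P & forall x, b (a x) = y *: x].
Proof.
move=> noe Jid; elim: m W => [|m IH] W.
  move=> WP; exists 1, W, idfun, idfun; split=> // [q|x]; first by rewrite mul1r.
  by rewrite /= scale1r.
move=> [K [F [i [g [FP ses pK]]]]].
have [y [P [a [b [yr PP ab]]]]] := IH K pK.
have [z [c [zr cE]]] := extend_multiple noe Jid yr (pd_le_mod_fg pK) FP PP ab ses.
have [h hE] : exists h : {linear W -> F}, forall f, h (g f) = (z \*: idfun \- (i \o c)) f.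
  by apply: (desc_ses ses) => x /=; rewrite cE linearZ subrr.
exists z, F, h, g; split=> // x; have [_ _ gs] := ses; have [f <-] := gs x.
by rewrite hE /= linearB /= (ses_comp0 _ ses) subr0 linearZ.
Qed.

Lemma pd_le_mod_extend J m K F W (i : {linear K -> F}) (g : {linear F -> W}) :
  noetherian R -> is_ideal J -> pd_le_mod J m K -> projective_mod J F -> short_exact i g ->
  exists (z : R) (c : {linear F -> K}), regular_mod J z /\ forall x, c (i x) = z *: x.
Proof.
move=> noe Jid pK FP ses; have [y [P [a [b [yr PP ab]]]]] := pd_le_mod_multiple noe Jid pK.
exact: extend_multiple noe Jid yr (pd_le_mod_fg pK) FP PP ab ses.
Qed.

(** As y is regular on K, reduction modulo y keeps a resolution of K exact. *)
Lemma pd_le_mod_quotient (J J' : R -> Prop) (y : R) m K V (r : {linear K -> V}) :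
  is_ideal J -> (forall a, J' a <-> exists b c : R, J b /\ a = b + c * y) ->
  regular_mod J y -> (forall k : K, y *: k = 0 -> k = 0) ->
  pd_le_mod J m K -> surj r -> (forall k, r k = 0 <-> exists k', k = y *: k') -> pd_le_mod J' m V.
Proof.
move=> Jid J'E yr; have [J0 JD JM] := Jid.
have [Q [p [ps pJ]]] := @quot_exists R R^o J
  (conj J0 (fun k x y hx hy => JD _ _ (JM k x hx) hy)).
have main K' V' (r' : {linear K' -> V'}) : projective_mod J K' -> surj r' ->
    (forall k, r' k = 0 <-> exists k', k = y *: k') -> projective_mod J' V'.
  move=> [KF kK PK] rs rP; split; first exact: fin_gen_surj KF.
    move=> a v /J'E[b [c [Jb ->]]]; have [k <-] := rs v.
    rewrite scalerDl -!linearZ kK // linear0 add0r; apply/rP; exists (c *: k).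
    by rewrite !scalerA mulrC.
  move=> A B q g kA qs.
  have [|h hE] := PK A B q (g \o r' : {linear _ -> _}) _ qs.
    by move=> a x Ja; apply: kA; apply/J'E; exists a, 0; rewrite mul0r addr0.
  have [h' h'E] : exists h' : {linear V' -> A}, forall k, h' (r' k) = h k.
    apply: (lin_factor_surj rs) => k /rP[k' ->]; rewrite linearZ; apply: kA.
    by apply/J'E; exists 0, 1; rewrite mul1r add0r.
  by exists h' => v; have [k <-] := rs v; rewrite h'E hE.
elim: m K V r => [|m IH] K V r yK /=; first exact: main.
move=> [L [F [i [g [FP ses pL]]]]] rs rP.
have [ii ig gs] := ses.
have yF (f : F) : y *: f = 0 -> f = 0 by exact: (projective_mod_regular Jid ps pJ yr FP).
have yL (l : L) : y *: l = 0 -> l = 0.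
  by move=> yl; apply: (inj0 ii); apply: yF; rewrite -linearZ yl linear0.
have modex Z : exists V (s : {linear Z -> V}), surj s /\ forall k, s k = 0 <-> exists k', k = y *: k'.
  apply: quot_exists; split; first by exists 0; rewrite scaler0.
  move=> k x z [x' ->] [z' ->]; exists (k *: x' + z').
  by rewrite scalerDr !scalerA mulrC.
have [V1 [rF [rFs rFP]]] := modex F.
have [V2 [rL [rLs rLP]]] := modex L.
have [i' i'E] : exists i' : {linear V2 -> V1}, forall l, i' (rL l) = (rF \o i) l.
  apply: (lin_factor_surj rLs) => l /rLP[l' ->] /=; apply/rFP; exists (i l'); exact: linearZ.
have [g' g'E] : exists g' : {linear V1 -> V}, forall l, g' (rF l) = (r \o g) l.
  apply: (lin_factor_surj rFs) => l /rFP[l' ->] /=; apply/rP; exists (g l'); exact: linearZ.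
exists V2, V1, i', g'; split.
- exact: main FP rFs rFP.
- split.
  + apply: lin_inj => v; have [l <-] := rLs v; rewrite i'E /= => /rFP[f fE].
    have /ig[l' l'E] : g f = 0.
      by apply: yK; rewrite -linearZ -fE (ses_comp0 _ ses).
    by apply/rLP; exists l'; apply: ii; rewrite fE -l'E linearZ.
  + move=> v; have [f <-] := rFs v; rewrite g'E /=; split=> [/rP[k kE]|[v' e]].
      have [f' f'E] := gs k.
      have /ig[l lE] : g (f - y *: f') = 0 by rewrite linearB linearZ /= f'E kE subrr.
      exists (rL l); rewrite i'E /= lE linearB (rFP (y *: f')).2 ?subr0 //; by exists f'.
    have [l lE] := rLs v'; move: e; rewrite -lE i'E /= => e.
    have /rFP[f' f'E] : rF (f - i l) = 0 by rewrite linearB e subrr.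
    apply/rP; exists (g f'); rewrite -linearZ -f'E linearB.
    by rewrite (ses_comp0 _ ses) subr0.
  + by move=> v; have [k <-] := rs v; have [f <-] := gs k; exists (rF f); rewrite g'E.
- exact: IH yL pL rLs rLP.
Qed.

End Relative.

(** * Modules of projective dimension at most n lie in the resolving subcategory *)

Section FiniteProjDim.
Variables (R : comNzRingType) (X : lmodType R -> Prop) (HX : resolving X).
Implicit Types A B C D E F G H K L M N P Q U V W Y Z : lmodType R.

(** A retract is a direct summand, with the kernel of the retraction as complement. *)
Lemma X_retract M N (e : {linear M -> N}) (s : {linear N -> M}) :
  (forall x, e (s x) = x) -> X M -> X N.
Proof.
move=> es XM; have [K [i [ii iP]]] := ker_exists e.
have [k kE] : exists k : {linear M -> K}, forall x, i (k x) = (idfun \- (s \o e)) x.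
  by apply: (lin_factor_inj ii) => x; apply/iP; rewrite /= linearB es subrr.
apply: (resolving_summand HX (N := K)); apply: (@resolving_iso R X HX M (N * K)%type _ XM).
exists (pairing e k : {linear _ -> _}).
exists (pair_case s i) => [x|[n x]]; first by rewrite /pair_case /= kE /= addrC subrK.
have ei : e (i x) = 0 by apply/iP; exists x.
apply/pair_equal_spec; split; rewrite /pair_case /=.
  by rewrite linearD es ei addr0.
by apply: ii; rewrite kE /= linearD es ei addr0 addrAC subrr add0r.
Qed.

Lemma X_zero M : (forall x : M, x = 0) -> X M.
Proof.
move=> M0; apply: (@X_retract 'rV[R]_0 M \0 \0) => [x|]; first by rewrite /= (M0 x).
exact: (resolving_proj HX (fg_projective_rV R 0)).
Qed.

Lemma X_power_module Q m : X Q -> X (power_module Q m).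
Proof.
move=> XQ; elim: m => [|m IH]; first exact: (resolving_proj HX (fg_projective_rV R 0)).
exact: (@resolving_sum R X HX Q (power_module Q m) XQ IH).
Qed.

Variable n : nat.
Hypothesis noe : noetherian R.
Hypothesis X_pd : forall M : lmodType R, pd_lt n M -> X M.
Hypothesis X_quotients : forall x : n.-tuple R, regular_seq x ->
  forall M : lmodType R, is_quotient_ring_module x M -> X M.

Lemma X_quotient_ring (s : seq R) Q : regular_seq s -> (size s <= n)%N ->
  is_quotient_ring_module s Q -> X Q.
Proof.
move=> rs; rewrite leq_eqVlt => /orP[/eqP sn|sn] sQ.
  have sz : size s == n by apply/eqP.
  exact: (X_quotients (x := Tuple sz)).
by apply: X_pd; apply: pd_le_pd_lt sn _; exact: pd_le_quotient_ring.
Qed.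

Lemma X_projective_mod (s : seq R) P : regular_seq s -> (size s <= n)%N ->
  projective_mod (gen_ideal s) P -> X P.
Proof.
move=> rs sn PP; have [Q [p [ps pk]]] := quotient_ring_exists s.
have XQ : X Q by apply: X_quotient_ring rs sn _; exists p.
have [m [e [f ef]]] := projective_mod_retract (gen_ideal_ideal s) ps pk PP.
exact: X_retract ef (X_power_module m XQ).
Qed.

(** Pushing the class of 0 -> K -> F -> W -> 0 out along multiplication by y splits
    it; this yields the exact sequence 0 -> F -> K + W -> K/yK -> 0. *)
Lemma X_pd_le_mod m (s : seq R) W : regular_seq s -> (size s + m <= n)%N ->
  pd_le_mod (gen_ideal s) m W -> X W.
Proof.
elim: m s W => [|m IH] s W rs sn; first by apply: X_projective_mod; rewrite ?addn0 in sn *.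
move=> /= [K [F [i [g [FP ses pK]]]]]; have [ii ig gs] := ses.
have [y [c [yr cE]]] := pd_le_mod_extend noe (gen_ideal_ideal s) pK FP ses.
have [Q [p [ps pk]]] := quotient_ring_exists s.
have yF (x : F) : y *: x = 0 -> x = 0 := projective_mod_regular (gen_ideal_ideal s) ps pk yr FP (x := x).
have yK (x : K) : y *: x = 0 -> x = 0.
  by move=> yx; apply: (inj0 ii); apply: yF; rewrite -linearZ yx linear0.
have [V [r [rV rP]]] : exists V (r : {linear K -> V}), surj r /\
    forall k, r k = 0 <-> exists k', k = y *: k'.
  apply: quot_exists; split; first by exists 0; rewrite scaler0.
  move=> k x z [x' ->] [z' ->]; exists (k *: x' + z').
  by rewrite scalerDr !scalerA mulrC.
have pV : pd_le_mod (gen_ideal (rcons s y)) m V.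
  by apply: (pd_le_mod_quotient (gen_ideal_ideal s) _ yr yK pK rV rP) => a; exact: gen_ideal_rcons.
have XV : X V.
  have [s1|ns1] := pselect (gen_ideal (rcons s y) 1).
    have kV : killed (gen_ideal (rcons s y)) V.
      by case: (m) pV => [[]//|k [L [P [j [q [[_ kP _] [_ _ qs] _]]]]]] a v /kP ka;
        have [x <-] := qs v; rewrite -linearZ ka linear0.
    by apply: X_zero => v; rewrite -(scale1r v); exact: kV.
  apply: IH pV; last by rewrite size_rcons addSnnS.
  exact/regular_seq_rcons.
have XF : X F by apply: X_projective_mod FP => //; apply: leq_trans sn; exact: leq_addr.
(* The map h sends (k, g x) to the class of k - c x, which depends only on g x
   because c extends multiplication by y on K. *)
pose f : {linear F -> (K * W)%type} := pairing c g.
have [h hE] : exists h : {linear (K * W)%type -> V}, forall kf : K * F,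
    h (kf.1, g kf.2) = r (kf.1 - c kf.2).
  have gg : surj (pairing (fstl K F) (g \o sndl K F : {linear _ -> _}) : {linear (K * F)%type -> (K * W)%type}).
    by move=> [k w]; have [x <-] := gs w; exists (k, x).
  have [h hE] : exists h : {linear (K * W)%type -> V}, forall kf : K * F,
      h ((pairing (fstl K F) (g \o sndl K F : {linear _ -> _}) : {linear (K * F)%type -> (K * W)%type}) kf) = (r \o (fstl K F \- (c \o sndl K F))) kf.
    apply: (lin_factor_surj gg) => -[k x] [/= -> /ig[l <-]].
    by rewrite cE; apply/rP; exists (- l); rewrite sub0r scalerN.
  by exists h => kf; have := hE kf.
have sesf : short_exact f h.
  split.
  - apply: lin_inj => x [cx /ig[k kE]]; move: cx; rewrite -kE cE => /yK->.
    exact: linear0.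
  - move=> [k w]; have [x <-] := gs w; rewrite (hE (k, x)) /=.
    split=> [/rP[k' k'E]|[x' [<- gx]]].
      exists (x + i k'); apply/pair_equal_spec; split=> /=.
        by rewrite linearD cE -k'E addrC subrK.
      by rewrite linearD (ses_comp0 _ ses) addr0.
    have /ig[l lE] : g (x' - x) = 0 by rewrite linearB gx subrr.
    by rewrite -linearB -lE cE; apply/rP; exists l.
  - by move=> v; have [k <-] := rV v; exists (k, g 0); rewrite (hE (k, 0)) /= linear0 subr0.
have XKW := resolving_ext HX sesf XF XV.
by apply: (X_retract (e := sndl K W) (s := @pair_r R K W : {linear _ -> _})) XKW.
Qed.

Lemma X_pd_le W : pd_le n W -> X W.
Proof.
move=> pW; apply: (@X_pd_le_mod n [::]) => //; last first.
  exact: pd_le_mod0 (@gen_ideal_nil R) pW.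
by split=> // /gen_ideal_nil/eqP; rewrite oner_eq0.
Qed.

End FiniteProjDim.

(** * Duality for free modules *)

Section Dual.
Variable R : comNzRingType.

(** The standard pairing, through which a free module of row vectors is identified
    with its dual. *)
Definition dot m (x y : 'rV[R]_m) : R := \sum_i x 0 i * y 0 i.

Lemma dotC m (x y : 'rV[R]_m) : dot x y = dot y x.
Proof. by apply: eq_bigr => i _; rewrite mulrC. Qed.

Lemma dot_linear m (y : 'rV[R]_m) : linear (fun x => dot x y : R^o).
Proof.
move=> k u v; rewrite /dot scaler_sumr -big_split; apply: eq_bigr => i _.
by rewrite !mxE mulrDl -mulrA.
Qed.
Definition dotl m (y : 'rV[R]_m) : {linear 'rV[R]_m -> R^o} := mklin (@dot_linear m y).

Lemma dot_delta m i (y : 'rV[R]_m) : dot (delta_mx 0 i) y = y 0 i.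
Proof.
rewrite /dot (bigD1 i) //= mxE !eqxx mul1r big1 ?addr0 // => j /negPf ji.
by rewrite mxE ji andbF mul0r.
Qed.

Lemma dot_inj m (y z : 'rV[R]_m) : (forall x, dot x y = dot x z) -> y = z.
Proof. by move=> e; apply/rowP => i; rewrite -!dot_delta. Qed.

Lemma dot_functional m (w : {linear 'rV[R]_m -> R^o}) : exists y, forall x, w x = dot x y.
Proof.
exists (\row_i w (delta_mx 0 i)) => x; rewrite rV_mapE; apply: eq_bigr => i _.
by rewrite mxE.
Qed.

Lemma transpose_exists a b (D : {linear 'rV[R]_a -> 'rV[R]_b}) :
  exists D' : {linear 'rV[R]_b -> 'rV[R]_a}, forall x y, dot x (D' y) = dot (D x) y.
Proof.
have L : linear (fun y => \row_i dot (D (delta_mx 0 i)) y : 'rV[R]_a).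
  move=> k u v; apply/rowP => i; rewrite !mxE /dot mulr_sumr -big_split.
  by apply: eq_bigr => j _; rewrite !mxE mulrDr mulrCA.
exists (mklin L) => x y /=.
have := rV_mapE (dotl y \o D : {linear _ -> _}) x => /= ->.
by apply: eq_bigr => i _; rewrite mxE.
Qed.

End Dual.

(** * Coresolutions by free left approximations and torsionfree modules *)

Section Coresolution.
Variable R : comNzRingType.
Hypothesis noe : noetherian R.
Implicit Types A B C D E F G H K L M N P Q U V W Y Z : lmodType R.

(** A left approximation with its cokernel; it need not be injective. *)
Record free_approx C := FreeApprox {
  la_q : nat; la_next : lmodType R;
  la_e : {linear C -> 'rV[R]_la_q}; la_k : {linear 'rV[R]_la_q -> la_next};
  la_surj : surj la_k; la_exact : exact la_e la_k; la_approx : left_approx la_e }.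

Lemma free_approx_exists C : fin_gen C -> exists2 a : free_approx C, fin_gen (la_next a) & True.
Proof.
move=> CF; have Rq : is_quotient_ring_module [::] (R^o : lmodType R).
  exists (idfun : {linear R^o -> R^o}); split=> [y|a]; first by exists y.
  by split=> [/gen_ideal_nil|/gen_ideal_nil].
have [s sP] : fin_gen (lhom C R^o).
  apply: (fin_gen_lhom (p := idfun : {linear R^o -> R^o})) noe CF; by move=> y; exists y.
have [e eE] := @rV_pair R (size s) C (fun i => s`_i).
have [D [k [ks kE]]] := coker_exists e.
have ea : left_approx e.
  move=> f; have [c cE] := sP f; exists (dotl (\row_i c i)) => x /=.
  rewrite cE /dot.
  have -> : (\sum_(i < size s) c i *: s`_i : lhom C R^o) x = \sum_(i < size s) c i *: s`_i x.
    by elim/big_ind2: _ => //= f1 z1 f2 z2 <- <-.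
  by apply: eq_bigr => i _; rewrite mxE eE mulrC.
exists (FreeApprox ks kE ea) => //=; apply: fin_gen_surj ks _.
exact: (fg_projective_rV R _).1.
Qed.

Definition approx_of (C : {C : lmodType R | fin_gen C}) : free_approx (sval C) :=
  s2val (cid2 (free_approx_exists (svalP C))).
Definition approx_next (C : {C : lmodType R | fin_gen C}) : {C : lmodType R | fin_gen C} :=
  exist _ (la_next (approx_of C)) (s2valP (cid2 (free_approx_exists (svalP C)))).

Section Sequence.
Variables (C : lmodType R) (CF : fin_gen C).
(** The iterated cokernels C, C_1, C_2, and so on, of free left approximations.  They
    are bundled with finite generation to iterate, and indexed so that the zeroth one
    is C by computation. *)
Definition cor_seq (i : nat) : {C : lmodType R | fin_gen C} := iter i approx_next (exist _ C CF).
Definition cor_mod i : lmodType R := sval (cor_seq i).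
Definition cor_dim i : nat := la_q (approx_of (cor_seq i)).
Definition cor_emb i : {linear cor_mod i -> 'rV[R]_(cor_dim i)} := la_e (approx_of (cor_seq i)).
Definition cor_proj i : {linear 'rV[R]_(cor_dim i) -> cor_mod i.+1} := la_k (approx_of (cor_seq i)).
Lemma cor_proj_surj i : surj (cor_proj i). Proof. exact: la_surj. Qed.
Lemma cor_exact i : exact (cor_emb i) (cor_proj i). Proof. exact: la_exact. Qed.
Lemma cor_approx i : left_approx (cor_emb i). Proof. exact: la_approx. Qed.

Variables (a b : nat) (D0 : {linear 'rV[R]_a -> 'rV[R]_b}) (pi : {linear 'rV[R]_b -> C}).
Hypothesis pi_surj : surj pi.
Hypothesis D0_exact : exact D0 pi.

Definition cor_diff_dim (i : nat) : nat := match i with 0 => a | 1 => b | j.+2 => cor_dim j end.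
(** The complex of free modules that consists of a presentation of C followed by the
    coresolution. *)
Definition cor_diff (i : nat) : {linear 'rV[R]_(cor_diff_dim i) -> 'rV[R]_(cor_diff_dim i.+1)} :=
  match i return {linear 'rV[R]_(cor_diff_dim i) -> 'rV[R]_(cor_diff_dim i.+1)} with
  | 0 => D0 | 1 => cor_emb 0 \o pi | j.+2 => cor_emb j.+1 \o cor_proj j end.

Definition cor_codiff i : {linear 'rV[R]_(cor_diff_dim i.+1) -> 'rV[R]_(cor_diff_dim i)} :=
  projT1 (cid (transpose_exists (cor_diff i))).
Lemma cor_codiffE i x y : dot x (cor_codiff i y) = dot (cor_diff i x) y.
Proof. by rewrite /cor_codiff; case: cid. Qed.

(** The dual complex is exact by construction: every map out of C_i extends to the
    next free module. *)
Lemma cor_diff_exact i (w : {linear 'rV[R]_(cor_diff_dim i.+1) -> R^o}) :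
  (forall x, w (cor_diff i x) = 0) <->
  exists w' : {linear 'rV[R]_(cor_diff_dim i.+2) -> R^o}, forall x, w' (cor_diff i.+1 x) = w x.
Proof.
case: i w => [|[|i]] w; split.
- move=> w0; have [v vE] := lin_factor_surj (h := w) pi_surj (fun x px =>
    let: ex_intro z e := (D0_exact x).1 px in etrans (congr1 w (esym e)) (w0 z)).
  by have [w' w'E] := @cor_approx 0 v; exists w' => x; rewrite /= w'E vE.
- move=> [w' w'E] x; rewrite -w'E /=.
  by rewrite ((D0_exact (D0 x)).2 _) ?linear0 //; exists x.
- move=> w0; have [v vE] := lin_factor_surj (h := w) (cor_proj_surj (i := 0)) (fun x px =>
    let: ex_intro z e := (cor_exact x).1 px in
    let: ex_intro z' e' := pi_surj z in
    etrans (congr1 w (esym e)) (etrans (congr1 (fun t => w (cor_emb 0 t)) (esym e')) (w0 z'))).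
  by have [w' w'E] := @cor_approx 1 v; exists w' => x; rewrite /= w'E vE.
- move=> [w' w'E] x; rewrite -w'E /=.
  by rewrite ((@cor_exact 0 (cor_emb 0 (pi x))).2 _) ?linear0 //; exists (pi x).
- move=> w0; have [v vE] := lin_factor_surj (h := w) (cor_proj_surj (i := i.+1)) (fun x px =>
    let: ex_intro z e := (cor_exact x).1 px in
    let: ex_intro z' e' := cor_proj_surj (i := i) z in
    etrans (congr1 w (esym e)) (etrans (congr1 (fun t => w (cor_emb i.+1 t)) (esym e')) (w0 z'))).
  by have [w' w'E] := @cor_approx i.+2 v; exists w' => x; rewrite /= w'E vE.
- move=> [w' w'E] x; rewrite -w'E /=.
  by rewrite ((@cor_exact i.+1 (cor_emb i.+1 (cor_proj i x))).2 _) ?linear0 //; exists (cor_proj i x).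
Qed.

Lemma dot0r m (x : 'rV[R]_m) : dot x 0 = 0.
Proof. by rewrite /dot big1 // => i _; rewrite mxE mulr0. Qed.

Lemma cor_codiff_exact i : exact (cor_codiff i.+1) (cor_codiff i).
Proof.
move=> y; have [e1 e2] := cor_diff_exact (dotl y); split.
  move=> y0; have [|w' w'E] := e1.
    by move=> x; rewrite /= -cor_codiffE y0 dot0r.
  have [z zE] := dot_functional w'; exists z; apply: dot_inj => x.
  by rewrite cor_codiffE -zE w'E.
move=> [z <-]; apply: dot_inj => x; rewrite dot0r cor_codiffE.
have [_ f2] := cor_diff_exact (dotl (cor_codiff i.+1 z)); apply: f2.
by exists (dotl z) => x'; exact: esym (cor_codiffE _ _).
Qed.

Variables (T : lmodType R) (r : {linear 'rV[R]_a -> T}).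
Hypothesis r_surj : surj r.
Hypothesis r_exact : exact (cor_codiff 0) r.

(** The dual of the complex resolves the cokernel of the transpose of D0. *)
Definition dual_resolution : fg_resolution T :=
  @FgResolution R T (fun i => 'rV[R]_(cor_diff_dim i)) cor_codiff r (fun i => fg_projective_rV R (cor_diff_dim i))
    r_surj r_exact cor_codiff_exact.

Lemma dual_acyclic_exact j : fres_acyclic dual_resolution j.+1 R^o ->
  forall x, cor_diff j.+1 x = 0 -> exists x', cor_diff j x' = x.
Proof.
move=> ac x Dx; have [|h hE] := ac (dotl x).
  move=> y; transitivity (dot x (cor_codiff j.+1 y)); first exact: dotC.
  by rewrite cor_codiffE Dx dotC dot0r.
have [z zE] := dot_functional h; exists z; apply: dot_inj => y.
rewrite dotC -cor_codiffE dotC; exact: etrans (esym (zE _)) (hE y).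
Qed.

Lemma dual_acyclic_inj0 : fres_acyclic dual_resolution 0 R^o -> injective D0.
Proof.
move=> ac; apply: lin_inj => x Dx; apply: dot_inj => y; rewrite dot0r.
apply: (ac (dotl x)) => z; transitivity (dot x (cor_codiff 0 z)); first exact: dotC.
by rewrite (cor_codiffE (i := 0) x z) [cor_diff 0 x]Dx dotC dot0r.
Qed.

(** Dualizing the resolution again gives back the original complex, so vanishing of
    Ext into R is exactness of that complex. *)
Lemma dual_acyclic_inj j : fres_acyclic dual_resolution j.+1 R^o -> injective (cor_emb j).
Proof.
move=> ac; apply: lin_inj; case: j ac => [|j] ac x ex.
  have [z zE] := pi_surj x.
  have [|z' z'E] := dual_acyclic_exact ac (x := z); first by rewrite /= zE.
  by rewrite -zE; apply/D0_exact; exists z'.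
have [z zE] := cor_proj_surj x.
have [|z' z'E] := dual_acyclic_exact ac (x := z); first by rewrite /= zE.
rewrite -zE; apply/cor_exact; case: j {ac ex zE x} z z' z'E => [|j] z z' /= <-.
  by exists (pi z').
by exists (cor_proj j z').
Qed.

End Sequence.

Lemma presentation_exists C : fin_gen C -> exists a b (D0 : {linear 'rV[R]_a -> 'rV[R]_b})
  (pi : {linear 'rV[R]_b -> C}), surj pi /\ exact D0 pi.
Proof.
move=> /fin_genP[b [pi ps]]; have [K [i sesK]] := ses_ker ps.
have /fin_genP[a [q qs]] := fin_gen_ker noe sesK (fg_projective_rV R b).1.
exists a, b, (i \o q : {linear _ -> _}), pi; split=> // y.
have [_ iP _] := sesK; split=> [/iP[x <-]|[x <-]]; last by apply/iP; exists (q x).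
by have [z <-] := qs x; exists z.
Qed.

(** The cokernel of the transpose of a presentation of C is a transpose of C. *)
Lemma torsionfree_inj C (CF : fin_gen C) m : torsionfree m C ->
  forall j, (j < m)%N -> injective (cor_emb CF j).
Proof.
move=> tf j jm; have [a [b [D0 [pi [ps pe]]]]] := presentation_exists CF.
have [T [r [rs re]]] := coker_exists (cor_codiff CF D0 pi 0).
suff ac : fres_acyclic (dual_resolution ps pe rs re) j.+1 R^o by exact: dual_acyclic_inj ac.
apply: (tf T) => //; have L : linear (fun w : lhom 'rV[R]_a R^o => \row_i (w (delta_mx 0 i) : R) : 'rV[R]_a).
  by move=> k u v; apply/rowP => i; rewrite !mxE.
have LE (w : lhom 'rV[R]_a R^o) x : dot x (mklin L w) = w x.
  rewrite [RHS]rV_mapE; by apply: eq_bigr => i _; rewrite mxE.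
exists a, b, D0, pi, (r \o mklin L : {linear _ -> _}); split=> //.
  move=> w /=; split=> [/re[y yE]|[g <-]].
    exists (dotl y); apply: lhomP => x /=.
    by rewrite -LE /= -yE (cor_codiffE D0 pi (i := 0)).
  have [y yE] := dot_functional g.
  apply/re; exists y; apply: dot_inj => x; rewrite (cor_codiffE D0 pi (i := 0)).
  by have /= -> := LE (lcomp g D0) x; rewrite yE.
move=> t; have [y <-] := rs t; exists (dotl y); congr (r _); apply: dot_inj => x.
exact: (LE (dotl y) x).
Qed.

End Coresolution.

(** * The universal extension *)

Section Universal.
Variable R : comNzRingType.
Implicit Types A B C D E F G H K L M N P Q U V W Y Z : lmodType R.

(** As P is projective, i extends along c to t, and (-t, k) embeds the free module
    in P + C.  The kernel of P + C -> M is thus free. *)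
Lemma approx_top K P M (i : {linear K -> P}) (p : {linear P -> M}) q C
    (c : {linear K -> 'rV[R]_q}) (k : {linear 'rV[R]_q -> C}) :
  fg_projective P -> short_exact i p -> left_approx c -> short_exact c k ->
  exists (h : {linear C -> M}) (f : {linear 'rV[R]_q -> (P * C)%type}),
    short_exact f (pair_case p h : {linear _ -> _}) /\ forall x, (f (c x)).1 = - i x /\ (f (c x)).2 = 0.
Proof.
move=> PP ses ca [ci cE ks]; have [ii ip ps] := ses.
have [t tE] := left_approx_proj i ca PP.
have [h hE] : exists h : {linear C -> M}, forall x, h (k x) = (p \o t) x.
  apply: (lin_factor_surj ks) => x /cE[y <-] /=.
  by rewrite tE (ses_comp0 y ses).
exists h, (pairing (\- t) k : {linear _ -> _}); split=> [|x]; last first.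
  by rewrite /= tE; split=> //; apply/cE; exists x.
split.
- apply: lin_inj => x [/= tx /cE[y yE]]; move: tx; rewrite -yE tE => /eqP.
  by rewrite oppr_eq0 => /eqP/(inj0 ii)->; rewrite linear0.
- move=> [x y]; have [z <-] := ks y; rewrite /= /pair_case /= hE /=.
  split=> [|[z' [<- e]]].
    rewrite -linearD => /ip[w wE]; exists (z - c w); apply/pair_equal_spec; split=> /=.
      by rewrite linearB tE wE opprB -addrA subrr addr0.
    by rewrite linearB (cE (c w)).2 ?subr0 //; exists w.
  by rewrite linearN -[p (t z')]hE e hE /= addNr.
- by move=> m; have [x xE] := ps m; exists (x, 0); rewrite /= /pair_case /= linear0 addr0.
Qed.

(** The sequences 0 -> A -> P + C -> K -> 0 attached to maps h: C -> K.  If C' is the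
    kernel of a left approximation Q -> C and K' the syzygy of K, a map h' between
    the kernels extends to Q -> P by the approximation property and induces h; the
    two sequences are then related by a syzygy step. *)
Lemma approx_step K' P K P' Q C' C A'
    (i : {linear K' -> P}) (p : {linear P -> K}) (p' : {linear P' -> K'})
    (c : {linear C' -> Q}) (k : {linear Q -> C}) (h' : {linear C' -> K'})
    (f' : {linear A' -> (P' * C')%type})
    (ses' : short_exact f' (pair_case p' h' : {linear _ -> _})) :
  fg_projective P -> fg_projective P' -> fg_projective Q ->
  short_exact i p -> surj p' -> left_approx c -> short_exact c k ->
  exists (h : {linear C -> K}) A (f : {linear A -> (P * C)%type})
    (ses : short_exact f (pair_case p h : {linear _ -> _})),
    syz_step (Ses ses) (Ses ses').
Proof.
move=> PP PP' PQ sesP p's ca sesc.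
have [ii ip ps] := sesP; have [ci cE ks] := sesc; have [f'i f'e _] := ses'.
have [t tE] := left_approx_proj (i \o h' : {linear _ -> _}) ca PP.
have [h hE] : exists h : {linear C -> K}, forall x, h (k x) = (p \o t) x.
  apply: (lin_factor_surj ks) => x /cE[y <-] /=.
  by rewrite tE (ses_comp0 _ sesP).
have sg : surj (pair_case p h : {linear (P * C)%type -> K}).
  by move=> m; have [x xE] := ps m; exists (x, 0); rewrite /= /pair_case /= linear0 addr0.
have [A [f ses]] := ses_ker sg; exists h, A, f, ses.
have [fi fe _] := ses.
pose phi : {linear (P' * Q)%type -> (P * C)%type} :=
  pairing ((i \o p' \o fstl P' Q) \- (t \o sndl P' Q) : {linear _ -> _}) (k \o sndl P' Q : {linear _ -> _}).
have [pA pAE] : exists pA : {linear (P' * Q)%type -> A}, forall x, f (pA x) = phi x.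
  apply: (lift_ses ses) => x; rewrite /= /pair_case /= hE /= linearB.
  by rewrite (ses_comp0 _ sesP) sub0r addNr.
pose T := Ses (ses_prod (P' * Q)%type P).
pose pB : {linear ((P' * Q) * P)%type -> (P * C)%type} :=
  (phi \o fstl (P' * Q)%type P) \+ (@pair_l R P C \o sndl (P' * Q)%type P).
pose jB : {linear (P' * C')%type -> ((P' * Q) * P)%type} :=
  pairing (pairing (\- fstl P' C') (c \o sndl P' C' : {linear _ -> _}) : {linear (P' * C')%type -> (P' * Q)%type})
    (i \o pair_case p' h' : {linear _ -> _}).
pose jA : {linear A' -> (P' * Q)%type} := fstl (P' * Q)%type P \o jB \o f'.
have f'0 a : p' (f' a).1 + h' (f' a).2 = 0 by exact: (ses_comp0 a ses').
have kc x : k (c x) = 0 by exact: ses_comp0 x sesc.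
apply: (@SyzStep R (Ses ses) (Ses ses') T jA jB i pA pB p) => //.
- exact: fg_projective_sum.
- split.
  + apply: lin_inj => a [/= /eqP]; rewrite oppr_eq0 => /eqP f1 /(inj0 ci) f2.
    by apply: (inj0 f'i); rewrite [f' a]surjective_pairing f1 f2.
  + move=> [x q]; split.
      move=> /(congr1 f); rewrite pAE linear0 => -[/= e1 /cE[y yE]].
      have e2 : p' x = h' y.
        apply: ii; apply/eqP; rewrite -subr_eq0 -[i (h' y)]tE yE; exact/eqP.
      have /f'e[a aE] : (pair_case p' h' : {linear _ -> _}) (- x, y) = 0.
        by rewrite /= /pair_case /= linearN e2 addNr.
      exists a; rewrite /jA /jB /= aE; apply/pair_equal_spec; split=> /=; [exact: opprK|exact: yE].
    move=> [a <-]; apply: (inj0 fi); rewrite pAE; apply/pair_equal_spec; split=> /=; last exact: kc.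
    rewrite tE /= -linearB linearN -opprD f'0 oppr0; exact: linear0.
  + move=> a; pose z := f a; have z0 : p z.1 + h z.2 = 0 by exact: (ses_comp0 a ses).
    have [q qE] := ks z.2.
    have /ip[k' k'E] : p (z.1 + t q) = 0 by rewrite linearD -[p (t q)]hE qE.
    have [x xE] := p's k'; exists (x, q); apply: fi; rewrite pAE.
    rewrite [RHS](surjective_pairing z); apply/pair_equal_spec; split=> //=.
    by rewrite xE k'E addrK.
- split.
  + apply: lin_inj => -[x y] [/= /eqP]; rewrite oppr_eq0 => /eqP-> /(inj0 ci)->.
    by [].
  + move=> [[x q] y]; split.
      move=> [/= e1 /eqP]; rewrite addr0 => /eqP/cE[z zE].
      exists (- x, z); apply/pair_equal_spec; split=> /=.
        by apply/pair_equal_spec; rewrite /= opprK.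
      move: e1; rewrite /pair_case /= linearN -zE tE => /eqP.
      rewrite addrC addr_eq0 => /eqP->; rewrite opprB /= linearD linearN addrC //.
    move=> [[x' z] <-]; apply/pair_equal_spec; split=> /=; last by rewrite kc addr0.
    rewrite tE /pair_case /= linearN linearD !linearN /=.
    by rewrite addrACA addNr add0r addNr.
  + move=> [x y]; have [q qE] := ks y.
    exists ((0, q), x + t q); apply/pair_equal_spec; split=> /=.
      by rewrite !linear0 sub0r addrC addrK.
    by rewrite qE addr0.
- move=> a; apply/pair_equal_spec; split=> //=.
  by rewrite /pair_case f'0 linear0.
- by move=> x; rewrite pAE /pB /=; apply/pair_equal_spec; split; rewrite /= addr0.
- move=> [[x q] y] /=; rewrite /pair_case /= addr0 hE /= !linearD linearN.
  by rewrite (ses_comp0 _ sesP) add0r addrAC addNr add0r.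
Qed.

(** Descending from the (n+1)-st syzygy of M to M along the coresolution: each step
    replaces a syzygy by the previous one and the term of the coresolution by the
    next one. *)
Lemma approx_chain n (K P : nat -> lmodType R)
    (i : forall j, {linear K j.+1 -> P j}) (p : forall j, {linear P j -> K j})
    q0 (c0 : {linear K n.+1 -> 'rV[R]_q0}) (E : nat -> lmodType R) (k0 : {linear 'rV[R]_q0 -> E 0%N})
    (q : nat -> nat) (c : forall j, {linear E j -> 'rV[R]_(q j)})
    (k : forall j, {linear 'rV[R]_(q j) -> E j.+1}) :
  (forall j, fg_projective (P j)) -> (forall j, short_exact (i j) (p j)) ->
  left_approx c0 -> short_exact c0 k0 ->
  (forall j, left_approx (c j)) -> (forall j, (j < n)%N -> short_exact (c j) (k j)) ->
  exists S : ses R, sC S = K 0%N /\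
    exists (h : {linear E 0%N -> K n}) (f : {linear 'rV[R]_q0 -> (P n * E 0%N)%type})
      (ses' : short_exact f (pair_case (p n) h : {linear _ -> _})),
      syz_iter n S (Ses ses') /\ forall x, (f (c0 x)).1 = - i n x /\ (f (c0 x)).2 = 0.
Proof.
move=> PP ses ca0 ses0 ca sesc.
have [h1 [f1 [ses1 f1E]]] := approx_top (PP n) (ses n) ca0 ses0.
have main l m : (l + m = n)%N ->
    exists (h : {linear E m -> K l}) A (f : {linear A -> (P l * E m)%type})
    (ses' : short_exact f (pair_case (p l) h : {linear _ -> _})), syz_iter m (Ses ses') (Ses ses1).
  elim: m l => [|m IH] l.
    by rewrite addn0 => ->; exists h1, 'rV[R]_q0, f1, ses1.
  rewrite addnS -addSn => lm; have [h' [A' [f' [ses' it]]]] := IH _ lm.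
  have mn : (m < n)%N by rewrite -lm addSn ltnS leq_addl.
  have [_ _ psl] := ses l.+1.
  have [h [A [f [sesn st]]]] := approx_step ses' (PP l) (PP l.+1) (fg_projective_rV R _) (ses l) psl
     (ca m) (sesc m mn).
  by exists h, A, f, sesn, (Ses ses').
have [h [A [f [ses' it]]]] := main 0%N n erefl.
by exists (Ses ses'); split=> //; exists h1, f1, ses1.
Qed.

(** The functional g0 factors through the first left approximation as w.  An
    extension of w to the middle term would extend g0 to P n. *)
Lemma universal_extension (noe : noetherian R) n (K P : nat -> lmodType R)
    (i : forall j, {linear K j.+1 -> P j}) (p : forall j, {linear P j -> K j})
    (g0 : {linear K n.+1 -> R^o}) :
  (forall j, fg_projective (P j)) -> (forall j, short_exact (i j) (p j)) ->
  torsionfree n.+1 (K n.+1) ->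
  ~ (exists h : {linear P n -> R^o}, forall x, h (i n x) = g0 x) ->
  exists S : ses R, sC S = K 0%N /\
    exists q B C (f : {linear 'rV[R]_q -> B}) (g : {linear B -> C}) (ses' : short_exact f g),
      syz_iter n S (Ses ses') /\
      exists w : {linear 'rV[R]_q -> R^o}, ~ exists h : {linear B -> R^o}, forall x, h (f x) = w x.
Proof.
move=> PP ses tf nex.
have CF : fin_gen (K n.+1).
  by have [_ _ ps] := ses n.+1; apply: fin_gen_surj ps (PP n.+1).1.
have inj j : (j < n.+1)%N -> injective (cor_emb noe CF j) by exact: torsionfree_inj tf _.
have sesc j : (j < n.+1)%N -> short_exact (cor_emb noe CF j) (cor_proj noe CF j).
  by move=> jn; split; [exact: inj|exact: cor_exact|exact: cor_proj_surj].
have [S [SC [h [f [ses' [it fE]]]]]] := approx_chain (k0 := cor_proj noe CF 0)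
  (k := fun j => cor_proj noe CF j.+1) PP ses (@cor_approx R noe _ CF 0) (sesc 0%N isT)
  (fun j => @cor_approx R noe _ CF j.+1) (fun j jn => sesc j.+1 jn).
exists S; split=> //; do 6!eexists; split; first exact: it.
have [w wE] := @cor_approx R noe _ CF 0 g0; exists w => -[g gE].
apply: nex; exists (\- (g \o @pair_l R (P n) (cor_mod noe CF 1)) : {linear _ -> _}) => x.
have [e1 e2] := fE x; rewrite -wE -gE [f (cor_emb noe CF 0 x)]surjective_pairing e1 e2.
by rewrite /= -linearN; congr (g _); apply/pair_equal_spec; rewrite /= oppr0.
Qed.

End Universal.

(** * Local rings *)

Section LocalRing.
Variable R : comNzRingType.
Implicit Types A B C D E F G H K L M N P Q U V W Y Z : lmodType R.

Lemma local_unit (noe : noetherian R) (m : R -> Prop) : is_local m ->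
  forall a, ~ m a -> exists b, a * b = 1.
Proof.
move=> [mM uniq] a nma; apply: contrapT => nu.
pose S (I : R -> Prop) := is_ideal I /\ ~ I 1.
have Sa : S (fun x => exists b, x = a * b).
  split; last by case=> b e; apply: nu; exists b.
  split; first by exists 0; rewrite mulr0.
    by move=> x y [b ->] [c ->]; exists (b + c); rewrite mulrDr.
  by move=> x y [b ->]; exists (x * b); rewrite mulrCA.
have Sid (I : R -> Prop) : S I -> is_ideal I by case.
have [I [[Iid I1] aI Imax]] := noetherian_maximal noe Sa Sid.
have IM : is_maximal I.
  split=> // I' I'id I'1 II'; exact: Imax.
apply: nma; apply/(uniq I IM); apply: aI; exists 1; by rewrite mulr1.
Qed.

Variables (m : R -> Prop).
Hypothesis mid : is_ideal m.
Hypothesis munit : forall a, ~ m a -> exists b, a * b = 1.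


Lemma dotDl k (x y z : 'rV[R]_k) : dot (x + y) z = dot x z + dot y z.
Proof. exact: (linearD (dotl z) x y). Qed.
Lemma dotZl k a (x z : 'rV[R]_k) : dot (a *: x) z = a * dot x z.
Proof. exact: (linearZZ (dotl z) a x). Qed.
Lemma dot_recl k (x y : 'rV[R]_k.+1) : dot x y = x 0 ord0 * y 0 ord0 +
  dot (\row_i x 0 (lift ord0 i)) (\row_i y 0 (lift ord0 i)).
Proof. by rewrite /dot big_ord_recl; congr (_ + _); apply: eq_bigr => i _; rewrite !mxE. Qed.

(** Induction on the rank by the first coordinate: if some d in D has a unit there,
    eliminate that coordinate and solve for it at the end; otherwise the first basis
    vector works. *)
Lemma unimodular_vector q (D : 'rV[R]_q -> Prop) : submod D -> ~ (forall x, D x) ->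
  exists u : 'rV[R]_q, (exists v, dot u v = 1) /\ forall d, D d -> m (dot d u).
Proof.
elim: q D => [|q IH] D [D0 DL] nD.
  by case: nD => x; rewrite (_ : x = 0) //; apply/rowP => -[].
have [[d [Dd nd]]|nod] := pselect (exists d, D d /\ ~ m (d 0 ord0)); last first.
  exists (delta_mx 0 ord0); split; last first.
    by move=> d Dd; rewrite dotC dot_delta; apply: contrapT => nd; apply: nod; exists d.
  by exists (delta_mx 0 ord0); rewrite dot_delta mxE !eqxx.
have [b db] := munit nd.
pose ext (y : 'rV[R]_q) : 'rV[R]_q.+1 := \row_i (if unlift ord0 i is Some j then y 0 j else 0).
have extS y i : ext y 0 (lift ord0 i) = y 0 i by rewrite mxE liftK.
have ext0 y : ext y 0 ord0 = 0 by rewrite mxE unlift_none.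
(* Subtract the multiple of d that clears the first coordinate. *)
pose cut (x : 'rV[R]_q.+1) : 'rV[R]_q := \row_i (x 0 (lift ord0 i) - x 0 ord0 * b * d 0 (lift ord0 i)).
have xE (x : 'rV[R]_q.+1) : x = (x 0 ord0 * b) *: d + ext (cut x).
  apply/rowP => i; rewrite !mxE; case: (unliftP ord0 i) => [j ->|->].
    by rewrite mxE addrC subrK.
  by rewrite addr0 -mulrA [b * _]mulrC db mulr1.
have extL k x y : ext (k *: x + y) = k *: ext x + ext y.
  by apply/rowP => i; rewrite !mxE; case: unlift => [j|]; rewrite ?mxE // mulr0 addr0.
have [u' [[v' uv'] u'P]] : exists u : 'rV[R]_q, (exists v, dot u v = 1) /\
    forall y, D (ext y) -> m (dot y u).
  apply: (IH (fun y => D (ext y))).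
    split; first by rewrite (_ : ext 0 = 0) //; apply/rowP => i; rewrite !mxE; case: unlift => // j; rewrite mxE.
    by move=> k x y Dx Dy; rewrite extL; exact: DL.
  by move=> all; apply: nD => x; rewrite (xE x); apply: DL.
pose u0 := - (b * dot (\row_i d 0 (lift ord0 i)) u').
pose u : 'rV[R]_q.+1 := \row_i (if unlift ord0 i is Some j then u' 0 j else u0).
have uS : (\row_i u 0 (lift ord0 i)) = u' by apply/rowP => i; rewrite !mxE liftK.
have u00 : u 0 ord0 = u0 by rewrite mxE unlift_none.
have du : dot d u = 0.
  by rewrite dot_recl uS u00 /u0 mulrN mulrA db mul1r addNr.
have eu y : dot (ext y) u = dot y u'.
  rewrite dot_recl uS ext0 mul0r add0r; congr (dot _ _).
  by apply/rowP => i; rewrite mxE extS.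
exists u; split.
  by exists (ext v'); rewrite dotC eu dotC.
move=> x Dx; rewrite (xE x) dotDl dotZl du mulr0 add0r eu; apply: u'P.
rewrite -[ext _](addKr ((x 0 ord0 * b) *: d)) -xE -scaleNr; exact: DL.
Qed.

(** Take the least possible number of generators: a relation with a unit coefficient
    would eliminate a generator. *)
Lemma minimal_generators (noe : noetherian R) : exists r (y : 'rV[R]_r),
  (forall a, m a <-> exists b, a = dot y b) /\ forall b, dot y b = 0 -> forall i, m (b 0 i).
Proof.
pose gens r := exists y : 'rV[R]_r, forall a, m a <-> exists b, a = dot y b.
have ex : exists r, `[< gens r >].
  have [s sP] := noe m mid; exists (size s); apply/asboolP.
  exists (\row_i s`_i) => a; apply: iff_trans (sP a) _; split=> [[c ->]|[b ->]].
    by exists (\row_i c i); apply: eq_bigr => i _; rewrite !mxE mulrC.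
  exists (fun i => if insub i is Some j then b 0 j else 0); apply: eq_bigr => i _.
  by rewrite valK !mxE mulrC.
case: (ex_minnP ex) => r /asboolP[y yP] rmin.
exists r, y; split=> // b yb i; apply: contrapT => nbi.
have [c cE] := munit nbi.
case: r y yP rmin b yb i nbi cE => [|r] y yP rmin b yb i nbi cE; first by case: i {nbi cE}.
suff : (r.+1 <= r)%N by rewrite ltnn.
apply: rmin; apply/asboolP; exists (\row_j y 0 (lift i j)) => a.
apply: iff_trans (yP a) _; split=> [[b' ->]|[b' ->]].
  exists (\row_j (b' 0 (lift i j) - b' 0 i * c * b 0 (lift i j))).
  rewrite -[LHS]subr0 -(mulr0 (b' 0 i * c)) -yb /dot mulr_sumr -sumrB (bigD1_ord i) //=.
  rewrite [X in X + _](_ : _ = 0) ?add0r.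
    by apply: eq_bigr => j _; rewrite !mxE mulrBr; congr (_ - _); rewrite mulrCA.
  by rewrite mulrCA -!mulrA [c * _]mulrC cE mulr1 subrr.
exists (\row_j (if unlift i j is Some k then b' 0 k else 0)).
rewrite /dot (bigD1_ord i) //= mxE unlift_none mulr0 add0r.
by apply: eq_bigr => j _; rewrite !mxE liftK.
Qed.

Variables (r : nat) (y : 'rV[R]_r).
Hypothesis yP : forall a, m a <-> exists b, a = dot y b.

(** Membership in m M when y lists generators of m: a linear combination of the
    entries of y with coefficients in M is the value at y of a linear map. *)
Definition in_mM M (x : M) := exists c : {linear 'rV[R]_r -> M}, c y = x.

Lemma in_mM_map M N (f : {linear M -> N}) x : in_mM x -> in_mM (f x).
Proof. by move=> [c cx]; exists (f \o c : {linear _ -> _}); rewrite /= cx. Qed.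

Lemma in_mM_proj P (x : P) : fg_projective P ->
  (forall f : {linear P -> R^o}, m (f x)) -> in_mM x.
Proof.
move=> /fg_projective_cover[k [e [s es]]] fx; rewrite -(es x); apply: in_mM_map.
have [b bE] := choice (fun i => (yP _).1 (fx (coordl i \o s : {linear _ -> _}))).
have [c cE] := rV_pair (fun i => dotl (b i)).
by exists c; apply/rowP => i; rewrite cE /= -bE.
Qed.

Lemma functional_y (f : {linear 'rV[R]_r -> R^o}) : m (f y).
Proof. by have [b bE] := dot_functional f; apply/yP; exists b. Qed.

End LocalRing.

(** * Vanishing of Ext from the residue field *)

Section Acyclic.
Variable R : comNzRingType.
Implicit Types A B C D E F G H K L M N Q U V W Y Z : lmodType R.
Variables (T : lmodType R) (P : fg_resolution T).

Lemma acyclic_projective j F : fg_projective F -> fres_acyclic P j R^o -> fres_acyclic P j F.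
Proof.
move=> /fg_projective_cover[k [e [s es]]] ac g g0.
pose gi i : {linear P j -> R^o} := coordl i \o s \o g.
have gi0 i x : gi i (fres_d P j x) = 0 by rewrite /gi /= g0 linear0 mxE.
case: j ac g g0 @gi gi0 => [|j] ac g g0 gi gi0.
  move=> x; rewrite -(es (g x)) (_ : s (g x) = 0) ?linear0 //.
  by apply/rowP => i; rewrite mxE; have := ac (gi i) (gi0 i) x.
have [h hE] := choice (fun i => ac (gi i) (gi0 i)).
have [c cE] := rV_pair h; exists (e \o c : {linear _ -> _}) => x /=.
rewrite -[RHS]es; congr (e _); apply/rowP => i; rewrite cE; exact: hE.
Qed.

Lemma fres_dd j x : fres_d P j (fres_d P j.+1 x) = 0.
Proof. by apply/fres_exact; exists x. Qed.

(** One step of the long exact Ext sequence: a map to the middle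
    term that is a cocycle modulo A can be corrected by a coboundary to one with
    values in A. *)
Lemma acyclic_lift A B C (f : {linear A -> B}) (g : {linear B -> C}) j (W : {linear P j -> B}) :
  short_exact f g -> fres_acyclic P j C -> (forall x, g (W (fres_d P j x)) = 0) ->
  exists h : {linear P j -> A}, forall x, f (h (fres_d P j x)) = W (fres_d P j x).
Proof.
move=> ses; have [fi fe gs] := ses.
case: j W => [|j] W ac gW.
  have gW0 x : g (W x) = 0 := ac (g \o W : {linear _ -> _}) gW x.
  by have [h hE] := lift_ses ses gW0; exists h.
have [v vE] := ac (g \o W : {linear _ -> _}) gW.
have [v' v'E] := proj_lift v (fres_proj P j) gs.
have [h hE] : exists h : {linear P j.+1 -> A}, forall x, f (h x) = (W \- (v' \o fres_d P j)) x.
  apply: (lift_ses ses) => x; rewrite /= linearB v'E; have /= -> := vE x; exact: subrr.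
by exists h => x; rewrite hE /= fres_dd linear0 subr0.
Qed.

Lemma acyclic_ses A B C (f : {linear A -> B}) (g : {linear B -> C}) j :
  short_exact f g -> fres_acyclic P j.+1 B -> fres_acyclic P j C -> fres_acyclic P j.+1 A.
Proof.
move=> ses acB acC v v0; have [fi fe gs] := ses.
have [|w wE] := acB (f \o v : {linear _ -> _}).
  by move=> x /=; rewrite v0 linear0.
have [|h hE] := @acyclic_lift A B C f g j w ses acC.
  by move=> x; have /= -> := wE x; exact: ses_comp0.
exists h => x /=; apply: fi; rewrite hE; exact: wE.
Qed.

Lemma acyclic0_sub A B (f : {linear A -> B}) : injective f -> fres_acyclic P 0 B -> fres_acyclic P 0 A.
Proof.
move=> fi ac v v0 x; apply: (inj0 fi).
by apply: (ac (f \o v : {linear _ -> _})) => z /=; rewrite v0 linear0.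
Qed.

Lemma syz_iter_last n (S S' : ses R) : syz_iter n.+1 S S' ->
  exists2 S2, syz_iter n S S2 & syz_step S2 S'.
Proof.
elim: n S => [|n IH] S /= [S1 st]; first by move=> <-; exists S.
by move=> /IH[S2 it st2]; exists S2 => //; exists S1.
Qed.

(** Depth increases along syzygies: dimension shift reduces Ext^j of an n-th syzygy
    to Ext of projective modules in degrees at most j. *)
Lemma syz_acyclic n d (S S' : ses R) : (forall j, (j < d)%N -> fres_acyclic P j R^o) ->
  syz_iter n S S' -> forall j, (j < d)%N -> (j < n)%N -> fres_acyclic P j (sC S').
Proof.
move=> ac; elim: n S' => [|n IH] S' // /syz_iter_last[S2 it].
case=> T' jA jB jC pA pB pC PA PC _ _ sesC _ _ _ _ [|j] jd jn.
  by have [ji _ _] := sesC; apply: acyclic0_sub ji (acyclic_projective PC (ac 0%N jd)).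
apply: acyclic_ses sesC (acyclic_projective PC (ac _ jd)) _; apply: (IH S2 it) => //; exact: ltnW.
Qed.

(** Multiplication by an element that kills T is homotopic to zero on a resolution
    of T; h is one component of the homotopy. *)
Lemma multiple_coboundary (a : R) : (forall t : T, a *: t = 0) ->
  forall j, exists h : {linear P j -> P j.+1}, forall v : {linear P j.+1 -> R^o},
    (forall x, v (fres_d P j.+1 x) = 0) -> forall x, a * v x = v (h (fres_d P j x)).
Proof.
move=> aT j.
suff [h hE] : exists h : {linear P j -> P j.+1}, forall x,
    fres_d P j (h (fres_d P j x)) = a *: fres_d P j x.
  exists h => v v0 x; apply/eqP; rewrite -subr_eq0; apply/eqP.
  have /fres_exact[z zE] : fres_d P j (a *: x - h (fres_d P j x)) = 0.
    by rewrite linearB hE linearZ subrr.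
  have := v0 z; rewrite zE linearB linearZ //.
elim: j => [|j [h hE]].
  have [h hE] : exists h : {linear P 0 -> P 1}, forall x, fres_d P 0 (h x) = a *: x.
    have aL : linear (fun x : P 0 => a *: x).
      by move=> k x z; rewrite scalerDr !scalerA mulrC.
    apply: (proj_lift_im (g := mklin aL) (fres_proj P 0)) => x /=.
    by apply/fres_exact0; rewrite linearZ /= aT.
  by exists h => x; rewrite hE.
have aL : linear (fun x : P j.+1 => a *: x - h (fres_d P j x)).
  move=> k x z; have -> : h (fres_d P j (k *: x + z)) = k *: h (fres_d P j x) + h (fres_d P j z).
    by rewrite !linearP.
  by rewrite scalerDr opprD addrACA scalerBr !scalerA [a * k]mulrC.
have [h' h'E] : exists h' : {linear P j.+1 -> P j.+2}, forall x,
    fres_d P j.+1 (h' x) = mklin aL x.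
  apply: (proj_lift_im (fres_proj P j.+1)) => x /=.
  by apply/fres_exact; rewrite linearB hE linearZ subrr.
by exists h' => x; rewrite h'E /= fres_dd linear0 subr0.
Qed.

(** Let w be a cocycle of degree d.  The cocycle w u with values in B goes through
    t and s (f u), which has coefficients in m; each y_i w is a coboundary, so f (w u)
    is one.  As Ext^(d-1)(T, C) = 0 for the n-th syzygy C, already w u is a coboundary,
    and pairing with v gives w back. *)
Lemma acyclic_of_minimal r (y : 'rV[R]_r) n (S : ses R) q B C
    (f : {linear 'rV[R]_q -> B}) (g : {linear B -> C}) (ses' : short_exact f g)
    (u v : 'rV[R]_q) Q (s : {linear B -> Q}) (t : {linear Q -> B}) :
  (forall b (x : T), dot y b *: x = 0) -> 
  syz_iter n S (Ses ses') -> dot u v = 1 ->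
  f u = t (s (f u)) -> in_mM y (s (f u)) ->
  forall d, (d <= n)%N -> fres_acyclic P d R^o.
Proof.
move=> yT it uv fu [c cE]; elim/ltn_ind => d IH dn w w0.
have [fi fe gs] := ses'.
have fwu x : f (w x *: u) = \sum_i (y 0 i * w x) *: t (c (delta_mx 0 i)).
  rewrite linearZ /= fu -cE rV_mapE linear_sum scaler_sumr; apply: eq_bigr => i _.
  by rewrite linearZ scalerA mulrC.
have wE x : w x = dot (w x *: u) v.
  by transitivity (w x * dot u v); [rewrite uv mulr1|exact: esym (dotZl _ _ _)].
have yi i (x : T) : y 0 i *: x = 0 by rewrite -[y 0 i]dot_delta dotC yT.
case: d IH dn w w0 fwu wE => [|d] IH dn w w0 fwu wE.
  move=> x; rewrite wE (_ : w x *: u = 0); first by rewrite dotC; exact: dot0r.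
  apply: (inj0 fi); rewrite fwu big1 // => i _.
  have /fres_exact0[z zE] : fres_aug P (y 0 i *: x) = 0 by rewrite linearZ /= yi.
  have -> : y 0 i * w x = w (y 0 i *: x) by rewrite linearZ.
  by rewrite -zE w0 scale0r.
have [h hE] := choice (fun i => multiple_coboundary (yi i) d).
have WL : linear (fun x => \sum_i w (h i x) *: t (c (delta_mx 0 i))).
  move=> k x z; rewrite scaler_sumr -big_split; apply: eq_bigr => i _.
  by rewrite !linearP scalerDl scalerA.
pose W := mklin WL.
have WE x : W (fres_d P d x) = f (w x *: u).
  by rewrite fwu; apply: eq_bigr => i _; rewrite hE.
have ac : fres_acyclic P d C.
  by apply: (syz_acyclic (d := d.+1) _ it) => // j jd; apply: IH => //; apply: leq_trans dn; exact: ltnW.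
have [|l lE] := acyclic_lift (W := W) ses' ac.
  by move=> x; rewrite WE; apply/fe; exists (w x *: u).
exists (dotl v \o l : {linear _ -> _}) => x /=; rewrite [RHS]wE.
by congr (dot _ v); apply: fi; rewrite lE.
Qed.

End Acyclic.

(** * Descending along syzygies *)

Section Desyzygy.
Variable R : comNzRingType.
Implicit Types A B C D E F G H K L M N P Q U V W Y Z : lmodType R.

(** The retraction of the projective middle row onto its first term turns c into a
    map that induces a' on cokernels; the other component vanishes on E and extends
    over the left approximation, giving c'.  The two cokernels are related by a syzygy
    because T and F' are projective. *)
Lemma desyzygy_step (S S1 : ses R) E F E' F' E'' (e : {linear E -> F}) (k : {linear F -> E'})
    (e' : {linear E' -> F'}) (k' : {linear F' -> E''})
    (a : {linear E -> sA S1}) (c : {linear F -> sB S1}) n :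
  syz_step S S1 -> short_exact e k -> short_exact e' k' -> left_approx e' -> fg_projective F' ->
  (forall x, c (e x) = sf S1 (a x)) ->
  (forall Y (r : {linear (sA S1 * F)%type -> Y}), short_exact (pairing a e) r -> pd_le n Y) ->
  exists (a' : {linear E' -> sA S}) (c' : {linear F' -> sB S}),
    (forall x, c' (e' x) = sf S (a' x)) /\
    (forall Y (r : {linear (sA S * F')%type -> Y}), short_exact (pairing a' e') r -> pd_le n.+1 Y).
Proof.
case=> T jA jB jC pA pB pC PA PC sesA sesB sesC e1 e2 e3 e4 sese sese' appr PF' ca pY.
have [rr [s [rf gs rs rsE]]] := ses_split (sP T) PC.
have [ei ek ks] := sese; have [e'i e'k k's] := sese'.
have [jAi jAe pAs] := sesA; have [jBi jBe pBs] := sesB; have [Tfi Te Tgs] := sP T.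
have rce x : rr (jB (c (e x))) = jA (a x) by rewrite ca -e1 rf.
have [a' a'E] : exists a' : {linear E' -> sA S}, forall x, a' (k x) = (pA \o rr \o jB \o c) x.
  apply: (lin_factor_surj ks) => x /ek[z <-] /=.
  by rewrite rce (ses_comp0 _ sesA).
have [d dE] : exists d : {linear E' -> sC T}, forall x, d (k x) = (sg T \o jB \o c) x.
  apply: (lin_factor_surj ks) => x /ek[z <-] /=.
  by rewrite ca -e1 (ses_comp0 _ (sP T)).
have [d' d'E] := left_approx_proj d appr PC.
exists a', (\- (pB \o s \o d') : {linear _ -> _}); split.
  move=> z; have [x <-] := ks z; rewrite /= d'E dE /= a'E /= -e3.
  have -> : sf T (rr (jB (c x))) = jB (c x) - s (sg T (jB (c x))).
    by rewrite -{2}(rsE (jB (c x))) addrK.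
  by rewrite linearB (ses_comp0 _ sesB) sub0r.
move=> Y r sesr; have [ri rk rs'] := sesr.
have [Y1 [r1 ses1]] := ses_coker (i := pairing a e : {linear _ -> (sA S1 * F)%type})
  (fun x y (h : pairing a e x = pairing a e y) => ei x y (congr1 snd h)).
have [r1i r1k r1s] := ses1.
have [i iE] : exists i : {linear Y1 -> (sA T * F')%type},
    forall z, i (r1 z) = pairing ((rr \o jB \o c \o sndl (sA S1) F) \- (jA \o fstl (sA S1) F) : {linear _ -> _})
       (e' \o k \o sndl (sA S1) F : {linear _ -> _}) z.
  apply: (lin_factor_surj r1s) => z /r1k[x <-]; apply/pair_equal_spec; split=> /=.
    by rewrite rce subrr.
  by rewrite (ses_comp0 x sese) linear0.
pose p : {linear (sA T * F')%type -> Y} :=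
  r \o (pairing (pA \o fstl (sA T) F') (sndl (sA T) F') : {linear (sA T * F')%type -> (sA S * F')%type}).
exists Y1, (sA T * F')%type, i, p; split; last exact: pY ses1.
  exact: fg_projective_sum.
split.
- apply: lin_inj => z; have [[x y] <-] := r1s z; rewrite iE => -[/= h1 h2].
  have /ek[w wE] : k y = 0 by apply: (inj0 e'i).
  apply/r1k; exists w; apply/pair_equal_spec; split=> //=.
  by apply: jAi; rewrite -rce wE; apply/eqP; rewrite -subr_eq0; apply/eqP.
- move=> [t x]; split.
    move=> /rk[z [z1 z2]].
    have [y yE] := ks z; move: z1 z2; rewrite -yE a'E /= => z1 z2.
    have /jAe[w wE] : pA (rr (jB (c y)) - t) = 0 by rewrite linearB z1 subrr.
    exists (r1 (w, y)); rewrite iE; apply/pair_equal_spec; split=> //=.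
    by rewrite wE opprB addrC subrK.
  move=> [z]; have [[w y] <-] := r1s z; rewrite iE => -[<- <-].
  apply/rk; exists (k y); apply/pair_equal_spec; split=> //=.
  by rewrite a'E /= linearB (ses_comp0 _ sesA) subr0.
- move=> z; have [[x y] <-] := rs' z; have [t tE] := pAs x.
  by exists (t, y); congr (r _); apply/pair_equal_spec.
Qed.

Lemma desyzygy (E F : nat -> lmodType R) (e : forall j, {linear E j -> F j})
    (k : forall j, {linear F j -> E j.+1}) n (S S' : ses R)
    (a : {linear E 0%N -> sA S'}) (c : {linear F 0%N -> sB S'}) :
  (forall j, (j <= n)%N -> short_exact (e j) (k j)) ->
  (forall j, left_approx (e j.+1)) -> (forall j, fg_projective (F j)) ->
  syz_iter n S S' -> (forall x, c (e 0%N x) = sf S' (a x)) ->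
  (forall Y (r : {linear (sA S' * F 0%N)%type -> Y}), short_exact (pairing a (e 0%N)) r -> pd_le 0 Y) ->
  exists (a' : {linear E n -> sA S}) (c' : {linear F n -> sB S}),
    (forall x, c' (e n x) = sf S (a' x)) /\
    (forall Y (r : {linear (sA S * F n)%type -> Y}), short_exact (pairing a' (e n)) r -> pd_le n Y).
Proof.
move=> ses appr PF + ca pY; elim: n S ses => [|n IH] S ses /=.
  by move=> ->; exists a, c.
move=> [S1 st it]; have [|a1 [c1 [ca1 pY1]]] := IH S1 _ it.
  by move=> j jn; apply: ses; exact: leqW.
by have := desyzygy_step st (ses n (leqnSn n)) (ses n.+1 (leqnn _)) (appr n) (PF n.+1) ca1 pY1.
Qed.

(** The sequence 0 -> E -> E' + F -> W -> 0 given by a map h: E -> E' is the syzygy of the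
    corresponding sequence for the map h' induced by h on the next cokernels. *)
Lemma self_extension_step E F E' F' E'' (e : {linear E -> F}) (k : {linear F -> E'})
    (e' : {linear E' -> F'}) (k' : {linear F' -> E''})
    (h : {linear E -> E'}) (t : {linear F -> F'}) W (r : {linear (E' * F)%type -> W})
    (sesr : short_exact (pairing h e : {linear _ -> _}) r) :
  short_exact e k -> short_exact e' k' -> fg_projective F -> fg_projective F' ->
  (forall x, t (e x) = e' (h x)) ->
  exists (h' : {linear E' -> E''}) W' (r' : {linear (E'' * F')%type -> W'})
    (sesr' : short_exact (pairing h' e' : {linear _ -> _}) r'),
    syz_step (Ses sesr') (Ses sesr).
Proof.
move=> ses ses' PF PF' te.
have [ei ek ks] := ses; have [e'i e'k k's] := ses'; have [_ rk rs] := sesr.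
have k'e' x : k' (e' x) = 0 by exact: ses_comp0 x ses'.
have ke x : k (e x) = 0 by exact: ses_comp0 x ses.
have [h' h'E] : exists h' : {linear E' -> E''}, forall x, h' (k x) = (k' \o t) x.
  by apply: (lin_factor_surj ks) => x /ek[z <-] /=; rewrite te k'e'.
have [W' [r' ses2]] := ses_coker (i := pairing h' e' : {linear _ -> (E'' * F')%type})
  (fun x y (hh : pairing h' e' x = pairing h' e' y) => e'i x y (congr1 snd hh)).
have [_ r'k r's] := ses2.
exists h', W', r', ses2.
pose T := Ses (ses_prod F (F' * F')%type).
pose kk : {linear (F' * F')%type -> (E'' * F')%type} :=
  pairing (k' \o fstl F' F') (sndl F' F').
pose f2 : {linear E' -> (E'' * F')%type} := pairing h' e'.
pose pB : {linear (F * (F' * F'))%type -> (E'' * F')%type} :=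
  (f2 \o k \o fstl F (F' * F')%type) \+ (kk \o sndl F (F' * F')%type).
pose pC : {linear (F' * F')%type -> W'} := r' \o kk.
pose j2 : {linear (E' * F)%type -> (F' * F')%type} :=
  pairing ((e' \o fstl E' F) \- (t \o sndl E' F) : {linear _ -> _}) (\- (e' \o k \o sndl E' F) : {linear _ -> _}).
pose jB : {linear (E' * F)%type -> (F * (F' * F'))%type} := pairing (sndl E' F) j2.
have [jC jCE] : exists jC : {linear W -> (F' * F')%type}, forall z, jC (r z) = j2 z.
  apply: (lin_factor_surj rs) => z /rk[x <-]; apply/pair_equal_spec; split=> /=.
    by rewrite te subrr.
  by rewrite ke linear0 oppr0.
have kks : surj kk.
  by move=> [x y]; have [x' <-] := k's x; exists (x', y).
have r'f2 z : r' (f2 z) = 0 by exact: ses_comp0 z ses2.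
apply: (@SyzStep R (Ses ses2) (Ses sesr) T e jB jC k pB pC) => //.
- exact: fg_projective_sum.
- split.
  + apply: lin_inj => -[x y] [/= y0 h1 h2]; move: h1; rewrite y0 linear0 subr0.
    by move=> /(inj0 e'i)->.
  + move=> [g [a b]]; split.
      move=> [/= h1 h2].
      have /e'k[w wE] : k' (a + t g) = 0 by rewrite linearD addrC -[k' (t g)]h'E.
      exists (w, g); apply/pair_equal_spec; split=> //=; apply/pair_equal_spec; split=> /=.
        by rewrite wE addrK.
      by apply/eqP; rewrite eq_sym -addr_eq0 addrC; apply/eqP.
    move=> [[x y] <-]; apply/pair_equal_spec; split=> /=.
      by rewrite h'E /= linearB k'e' sub0r subrr.
    by rewrite subrr.
  + move=> z; have [[a b] <-] := kks z; exists (0, (a, b)).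
    by rewrite /pB /= linear0 (linear0 f2) add0r.
- split.
  + apply: lin_inj => w; have [[x y] <-] := rs w; rewrite jCE => -[/= h1 /eqP].
    rewrite oppr_eq0 => /eqP/(inj0 e'i)/ek[z zE]; apply/rk; exists z.
    apply/pair_equal_spec; split=> //=.
    by apply: e'i; apply/eqP; rewrite eq_sym -subr_eq0 -te zE; apply/eqP.
  + move=> [a b]; split.
      move=> /r'k[z [z1 z2]]; have [g gE] := ks z.
      move: z1 z2; rewrite -gE h'E /= => z1 z2.
      have /e'k[w wE] : k' (a - t g) = 0 by rewrite linearB z1 subrr.
      exists (r (w, - g)); rewrite jCE; apply/pair_equal_spec; split=> /=.
        by rewrite linearN opprK wE subrK.
      by rewrite !linearN opprK.
    move=> [z]; have [[x y] <-] := rs z; rewrite jCE => -[<- <-].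
    apply/r'k; exists (- k y); apply/pair_equal_spec; split=> /=.
      by rewrite linearN h'E /= linearB k'e' sub0r.
    by rewrite linearN.
  + by move=> z; have [v <-] := r's z; have [x <-] := kks v; exists x.
- move=> x; apply/pair_equal_spec; split=> //=.
  by rewrite /j2 /=; apply/pair_equal_spec; rewrite /= te subrr ke linear0 oppr0.
- by move=> x; rewrite /pB /= (linear0 kk) addr0.
- move=> [g [a b]]; rewrite /pB /= linearD.
  by rewrite [r' (f2 _)]r'f2 add0r.
Qed.

End Desyzygy.

(** * The module at the end of the coresolution of the residue field *)

Section Final.
Variables (R : comNzRingType) (X : lmodType R -> Prop) (HX : resolving X) (n : nat).
Implicit Types B C Y W : lmodType R.
Hypothesis X_pd_le' : forall W : lmodType R, pd_le n W -> X W.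
Hypothesis inclusion_factors : forall S S' : ses R, X (sA S) -> X (sB S) -> X (sC S) ->
  syz_iter n S S' -> fg_projective (sA S') ->
  exists (P : lmodType R) (q : {linear sB S' -> P}) (t : {linear P -> sB S'}),
    fg_projective P /\ forall x, sf S' x = t (q (sf S' x)).

(** The map c induces psi: E' -> C, and the kernel Y of B + E' -> C is the cokernel of
    (a, e).  Then B + E' is an extension of C by Y. *)
Lemma X_of_desyzygy (S : ses R) (E F E' : lmodType R) (e : {linear E -> F}) (k : {linear F -> E'})
    (a : {linear E -> sA S}) (c : {linear F -> sB S}) :
  short_exact e k -> (forall x, c (e x) = sf S (a x)) -> X (sC S) ->
  (forall Y (r : {linear (sA S * F)%type -> Y}), short_exact (pairing a e) r -> X Y) ->
  X E'.
Proof.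
move=> ses ca XC XY; have [ei ek ks] := ses; have [fi fe gs] := sP S.
have gf x : sg S (sf S x) = 0 by exact: ses_comp0 x (sP S).
have ke x : k (e x) = 0 by exact: ses_comp0 x ses.
have [psi psiE] : exists psi : {linear E' -> sC S}, forall x, psi (k x) = (sg S \o c) x.
  by apply: (lin_factor_surj ks) => x /ek[z <-] /=; rewrite ca gf.
pose d : {linear (sB S * E')%type -> sC S} := pair_case (sg S) (\- psi : {linear _ -> _}).
have ds : surj d.
  by move=> z; have [b <-] := gs z; exists (b, 0); rewrite /d /= /pair_case /= linear0 oppr0 addr0.
have [Y [i sesY]] := ses_ker ds; have [ii id_ _] := sesY.
have [r rE] : exists r : {linear (sA S * F)%type -> Y}, forall z, i (r z) =
   pairing ((c \o sndl (sA S) F) \- (sf S \o fstl (sA S) F) : {linear _ -> _}) (k \o sndl (sA S) F : {linear _ -> _}) z.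
  apply: (lift_ses sesY) => z; rewrite /d /= /pair_case /= psiE /=.
  by rewrite linearB gf subr0 subrr.
have sesr : short_exact (pairing a e) r.
  split.
  - by move=> x x' [_ /ei].
  - move=> [x z]; split=> [e0|[w [<- <-]]].
      have := congr1 i e0; rewrite rE linear0 => -[/= h1 /ek[w wE]]; exists w.
      apply/pair_equal_spec; split=> //=; apply: fi; rewrite -ca wE.
      by apply/eqP; rewrite -subr_eq0; apply/eqP.
    apply: (inj0 ii); rewrite rE; apply/pair_equal_spec; split=> /=; last exact: ke.
    by rewrite ca subrr.
  - move=> w; have d0 : d (i w) = 0 by exact: ses_comp0 w sesY.
    have [x xE] := ks (i w).2.
    have /fe[a' a'E] : sg S (c x - (i w).1) = 0.
      move: d0; rewrite /d /= /pair_case /= -xE psiE /= linearB => /eqP.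
      by rewrite subr_eq0 => /eqP->; rewrite subrr.
    exists (a', x); apply: ii; rewrite rE [RHS]surjective_pairing.
    by apply/pair_equal_spec; split=> //=; rewrite a'E opprB addrC subrK.
have XBE := resolving_ext HX sesY (XY Y r sesr) XC.
apply: (X_retract HX (e := sndl (sB S) E') (s := @pair_r R (sB S) E' : {linear _ -> _})) XBE.
by [].
Qed.

Variables (m : R -> Prop).
Hypothesis mid : is_ideal m.
Hypothesis m1 : ~ m 1.
Variables (r : nat) (y : 'rV[R]_r).
Hypothesis yP : forall a, m a <-> exists b, a = dot y b.
Hypothesis ymin : forall b, dot y b = 0 -> forall i, m (b 0 i).
Variables (e0 : {linear 'rV[R]_1 -> 'rV[R]_r}) (E1 : nat -> lmodType R)
  (k0 : {linear 'rV[R]_r -> E1 0%N}) (q : nat -> nat)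
  (e1 : forall j, {linear E1 j -> 'rV[R]_(q j)}) (k1 : forall j, {linear 'rV[R]_(q j) -> E1 j.+1}).
Hypothesis e0E : forall x, e0 x = x 0 0 *: y.
Hypothesis ses0 : short_exact e0 k0.
Hypothesis ses1 : forall j, (j < n)%N -> short_exact (e1 j) (k1 j).
Hypothesis approx1 : forall j, left_approx (e1 j).

Definition Ef j : lmodType R := if j is i.+1 then E1 i else 'rV[R]_1.
Definition Ff j : lmodType R := if j is i.+1 then 'rV[R]_(q i) else 'rV[R]_r.
Definition ef j : {linear Ef j -> Ff j} :=
  match j return {linear Ef j -> Ff j} with 0 => e0 | i.+1 => e1 i end.
Definition kf j : {linear Ff j -> Ef j.+1} :=
  match j return {linear Ff j -> Ef j.+1} with 0 => k0 | i.+1 => k1 i end.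

Lemma sesf j : (j <= n)%N -> short_exact (ef j) (kf j).
Proof. by case: j => [|j] jn; [exact: ses0|exact: ses1]. Qed.
Lemma projFf j : fg_projective (Ff j).
Proof. by case: j => [|j]; exact: fg_projective_rV. Qed.

(** Such a functional is a vector b with dot y b = 0, and the generators are
    minimal. *)
Lemma functional_E1 (w : {linear E1 0%N -> R^o}) x : m (w x).
Proof.
have [_ ek ks] := ses0; have [v <-] := ks x.
have [b bE] := dot_functional (w \o k0 : {linear _ -> _}).
have yb : dot y b = 0.
  rewrite -bE /= (ek y).2 ?linear0 //; exists (const_mx 1).
  by rewrite e0E mxE scale1r.
have -> : w (k0 v) = dot v b by rewrite -bE.
have [m0 mD mM] := mid.
by apply: (big_ind m) => // i _; apply: mM; exact: ymin.
Qed.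

Lemma coresolution_end_not_in_X : ~ X (E1 n).
Proof.
move=> XE; have [ei ek ks] := ses0.
have r0 : (0 < r)%N.
  rewrite lt0n; apply/negP => /eqP r0.
  have : const_mx 1 = 0 :> 'rV[R]_1.
    apply: (inj0 ei); rewrite e0E; apply/rowP => i; exfalso.
    by have := leq_trans (ltn_ord i) (eq_leq r0); rewrite ltn0.
  by move=> /rowP/(_ 0); rewrite !mxE => /eqP; rewrite oner_eq0.
pose i0 := Ordinal r0; pose z := k0 (delta_mx 0 i0).
(* All coordinates of values of e0 lie in m, so no basis vector lies in the image
   of e0 modulo m. *)
have z_notin : ~ in_mM y z.
  move=> [c cE]; have [c' c'E] := proj_lift c (fg_projective_rV R r) ks.
  have /ek[x xE] : k0 (delta_mx 0 i0 - c' y) = 0 by rewrite linearB c'E cE subrr.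
  apply: m1; have := congr1 (fun v : 'rV[R]_r => v 0 i0) xE; rewrite e0E !mxE !eqxx /=.
  move=> /eqP; rewrite eq_sym subr_eq => /eqP e1y.
  rewrite (_ : 1 = x 0 0 * y 0 i0 + c' y 0 i0) //.
  have [_ mD mM] := mid; apply: mD.
    by apply: mM; apply/yP; exists (delta_mx 0 i0); rewrite dotC dot_delta.
  exact: (functional_y yP (coordl i0 \o c' : {linear _ -> _})).
have [h0 h0E] := rV_map_delta (fun _ : 'I_1 => z).
have h01 : h0 (const_mx 1) = z.
  by rewrite rV_mapE big_ord1 h0E mxE scale1r.
have h0x x : h0 x = x 0 0 *: z.
  by rewrite rV_mapE big_ord1 h0E.
have [W0 [r0' sesW0]] := ses_coker (i := pairing h0 e0 : {linear _ -> (E1 0%N * 'rV[R]_r)%type})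
  (fun x x' (hh : pairing h0 e0 x = pairing h0 e0 x') => ei x x' (congr1 snd hh)).
have main i : (i <= n)%N -> exists (h : {linear Ef i -> Ef i.+1}) (W : lmodType R)
    (r' : {linear (Ef i.+1 * Ff i)%type -> W})
    (sesr : short_exact (pairing h (ef i) : {linear _ -> _}) r'),
    syz_iter i (Ses sesr) (Ses sesW0) /\
    exists t : {linear Ff i -> Ff i.+1}, forall x, t (ef i x) = ef i.+1 (h x).
  elim: i => [|i IH] ni.
    exists h0, W0, r0', sesW0; split=> //.
    (* A map R -> M with image in m M extends along e0, whose entries generate m. *)
    have [t tE] : in_mM y (e1 0%N z).
      apply: (in_mM_proj yP (fg_projective_rV R _)) => w.
      exact: (functional_E1 (w \o e1 0%N : {linear _ -> _})).
    by exists t => x /=; rewrite e0E linearZ tE h0x linearZ.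
  have [h [W [r' [sesr [it [t tE]]]]]] := IH (ltnW ni).
  have [h' [W' [r'' [sesr' st]]]] := self_extension_step sesr (sesf (ltnW ni)) (sesf ni)
    (projFf i) (projFf i.+1) tE.
  exists h', W', r'', sesr'; split; first by exists (Ses sesr).
  have [t' t'E] := left_approx_proj (ef i.+2 \o h' : {linear _ -> _}) (@approx1 i : left_approx (ef i.+1)) (projFf i.+2).
  by exists t'.
have [h [W [r' [sesr [it _]]]]] := main n (leqnn n).
have XF j : X (Ff j) := resolving_proj HX (projFf j).
have XB : X (Ef n.+1 * Ff n)%type by exact: (resolving_sum HX XE (XF n)).
have XA : X (Ef n) := resolving_ker HX (sesf (leqnn n)) (XF n) XE.
have XW : X W.
  have [ei' ek' ks'] := sesf (leqnn n); have [ri rk rs] := sesr.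
  have ke x : kf n (ef n x) = 0 by exact: ses_comp0 x (sesf (leqnn n)).
  have [g gE] : exists g : {linear W -> Ef n.+1}, forall v, g (r' v) = (kf n \o sndl _ _) v.
    by apply: (lin_factor_surj rs) => v /rk[x <-] /=; rewrite ke.
  have ses2 : short_exact (r' \o @pair_l R (Ef n.+1) (Ff n) : {linear _ -> _}) g.
    split.
    - apply: lin_inj => x /= /rk[w [h1 h2]].
      by have w0 : w = 0 by [apply: (inj0 ei')]; rewrite -h1 w0 linear0.
    - move=> w; have [[x v] <-] := rs w; rewrite gE /=; split=> [/ek'[u uE]|[x' x'E]].
        exists (x - h u); apply/eqP; rewrite /= -subr_eq0 -linearB; apply/eqP/rk.
        exists (- u); apply/pair_equal_spec; split=> /=.
          by rewrite linearN addrC addrA addNr add0r.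
        by rewrite linearN uE sub0r.
      have /rk[u [h1 h2]] : r' ((x, v) - @pair_l R (Ef n.+1) (Ff n) x') = 0.
        by rewrite linearB; apply/eqP; rewrite subr_eq0 -x'E.
      by move: h2; rewrite /= subr0 => <-; rewrite ke.
    - by move=> x; have [v <-] := ks' x; exists (r' (0, v)); rewrite gE.
  exact: (@resolving_ext R X HX _ _ _ _ _ ses2 XE XE).
have [P [p [t [PP pt]]]] := inclusion_factors (S := Ses sesr) XA XB XW it (fg_projective_rV R 1).
have := pt (const_mx 1); set f := sf (Ses sesW0) (const_mx 1) => fE.
have f12 : f = (z, y).
  by rewrite /f; apply/pair_equal_spec; rewrite h01 e0E mxE scale1r.
apply: z_notin; have -> : z = fstl (E1 0%N) 'rV[R]_r f by rewrite f12.
apply: in_mM_map; rewrite fE; apply: in_mM_map; apply: (in_mM_proj yP PP) => w.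
rewrite f12 [(z, y)]pair_lr !linearD /=.
have [_ mD _] := mid; apply: mD.
  exact: (functional_E1 (w \o p \o @pair_l R (E1 0%N) 'rV[R]_r : {linear _ -> _})).
exact: (functional_y yP (w \o p \o @pair_r R (E1 0%N) 'rV[R]_r : {linear _ -> _})).
Qed.

Lemma coresolution_end_in_X (S : ses R) a B C (f : {linear 'rV[R]_a -> B}) (g : {linear B -> C})
    (ses' : short_exact f g) (u v : 'rV[R]_a) (c : {linear 'rV[R]_r -> B}) :
  X (sC S) -> syz_iter n S (Ses ses') -> dot u v = 1 -> c y = f u -> X (E1 n).
Proof.
move=> XC it uv cy.
have [a0 a0E] := rV_map_delta (fun _ : 'I_1 => u).
have a0x x : a0 x = x 0 0 *: u by rewrite rV_mapE big_ord1 a0E.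
have [|Y s sess|a' [c' [ca pY]]] := desyzygy (k := kf) (n := n) (S := S) (S' := Ses ses') (a := a0) (c := c)
  sesf approx1 projFf it.
- by move=> x /=; rewrite e0E a0x !linearZ cy.
- (* Pairing with v splits (a0, e0), so its cokernel is projective. *)
  have vL : linear (fun x : ('rV[R]_a * 'rV[R]_r)%type => const_mx (dot x.1 v) : 'rV[R]_1).
    by move=> b x x'; apply/rowP => i; rewrite !mxE dotDl dotZl.
  pose ret := mklin vL; have [_ sk ss] := sess.
  have retE x : ret (pairing a0 e0 x) = x.
    apply/rowP => i; rewrite ord1 /ret /= mxE a0x.
    by transitivity (x 0 0 * dot u v); [exact: dotZl|rewrite uv mulr1].
  have [sec secE] : exists sec : {linear Y -> ('rV[R]_a * 'rV[R]_r)%type}, forall x,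
      sec (s x) = (idfun \- (pairing a0 e0 \o ret)) x.
    apply: (lin_factor_surj ss) => x /sk[w <-].
    transitivity (pairing a0 e0 w - pairing a0 e0 (ret (pairing a0 e0 w))) => //.
    by rewrite retE subrr.
  apply: (@fg_projective_retract R ('rV[R]_a * 'rV[R]_r)%type Y s sec).
    move=> w; have [x <-] := ss w; rewrite secE.
    have -> : (idfun \- (pairing a0 e0 \o ret)) x = x - pairing a0 e0 (ret x) by [].
    by rewrite linearB [s (pairing a0 e0 _)](_ : _ = 0) ?subr0 //; apply/sk; exists (ret x).
  exact: (fg_projective_sum (fg_projective_rV R a) (fg_projective_rV R r)).
apply: (X_of_desyzygy (sesf (leqnn n)) ca XC) => Y s sess; apply: X_pd_le'; exact: pY sess.
Qed.

End Final.

(** * Proof of the theorem *)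

Section Main.
Variable R : comNzRingType.
Implicit Types A B C D E F G H K L M N P Q U V W Y Z : lmodType R.

(** The syzygies of a given resolution are the images of its differentials. *)
Record image_of A B (f : {linear A -> B}) := ImageOf {
  im_M : lmodType R; im_i : {linear im_M -> B}; im_p : {linear A -> im_M};
  im_inj : injective im_i; im_surj : surj im_p; im_E : forall x, im_i (im_p x) = f x }.

Lemma image_exists A B (f : {linear A -> B}) : exists I : image_of f, True.
Proof.
have [|M [i [ii iP]]] := @sub_exists R B (fun y => exists x, f x = y).
  split=> [|k x y [x' <-] [y' <-]]; first by exists 0; rewrite linear0.
  by exists (k *: x' + y'); rewrite linearP.
have [p pE] := lin_factor_inj (h := f) ii (fun z => (iP (f z)).1 (ex_intro _ z erefl)).
have ps : surj p.
  by move=> z; have [x xE] := (iP (i z)).2 (ex_intro _ z erefl); exists x; apply: ii; rewrite pE.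
by exists (ImageOf ii ps pE).
Qed.

Definition image_map A B (f : {linear A -> B}) : image_of f := projT1 (cid (image_exists f)).

Section Syzygies.
Variables (M : lmodType R) (P : fg_resolution M).
Definition res_syz j : lmodType R := if j is i.+1 then im_M (image_map (fres_d P i)) else M.
Definition res_syz_inc j : {linear res_syz j.+1 -> P j} := im_i (image_map (fres_d P j)).
Definition res_syz_proj j : {linear P j -> res_syz j} :=
  match j return {linear P j -> res_syz j} with
  | 0 => fres_aug P | i.+1 => im_p (image_map (fres_d P i)) end.

Lemma res_syz_incE j x : res_syz_inc j (res_syz_proj j.+1 x) = fres_d P j x.
Proof. exact: im_E. Qed.

Lemma res_syz_ses j : short_exact (res_syz_inc j) (res_syz_proj j).
Proof.
split; first exact: im_inj.
  have imP y : (exists x, res_syz_inc j x = y) <-> exists x, fres_d P j x = y.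
    split=> [[x <-]|[x <-]]; last by exists (res_syz_proj j.+1 x); rewrite res_syz_incE.
    by have [z <-] := @im_surj _ _ _ (image_map (fres_d P j)) x; exists z; rewrite -res_syz_incE.
  move=> y; apply: iff_trans (iff_sym (imP y)).
  case: j {imP} y => [|j] y; first exact: fres_exact0.
  split=> [e|/fres_exact e]; first by apply/fres_exact; rewrite -res_syz_incE e linear0.
  by apply: (@im_inj _ _ _ (image_map (fres_d P j))); rewrite linear0 -[RHS]e im_E.
by case: j => [|j]; [exact: fres_surj|exact: im_surj].
Qed.
End Syzygies.

Lemma chain_is_syzygy n (K P : nat -> lmodType R) (i : forall j, {linear K j.+1 -> P j})
    (p : forall j, {linear P j -> K j}) :
  (forall j, fg_projective (P j)) -> (forall j, short_exact (i j) (p j)) ->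
  is_syzygy n (K 0%N) (K n).
Proof.
elim: n K P i p => [|n IH] K P i p PP ses /=.
  by exists (idfun : {linear K 0%N -> K 0%N}); exists id.
exists (K 1%N), (P 0%N), (i 0%N), (p 0%N); split=> //.
exact: (IH (fun j => K j.+1) (fun j => P j.+1) (fun j => i j.+1) (fun j => p j.+1)).
Qed.

Lemma syz_iter_pd_le n (S S' : ses R) : syz_iter n S S' -> fg_projective (sA S') -> pd_le n (sA S).
Proof.
elim: n S => [|n IH] S /=; first by move=> ->.
move=> [S1 [T jA jB jC pA pB pC PA _ sesA _ _ _ _ _ _] it] PS'.
by exists (sA S1), (sA T), jA, pA; split=> //; exact: IH.
Qed.

(** The statement that Ext^(n+1)(M, R) = 0 for M = K 0, which carries the proof. *)
Lemma functionals_extend n (X : lmodType R -> Prop)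
  (R_noetherian : noetherian R) (m : R -> Prop) (m_local : is_local m)
  (X_resolving : resolving X)
  (X_pd : forall M : lmodType R, pd_lt n M -> X M)
  (X_quotients : forall x : n.-tuple R, regular_seq x ->
     forall M : lmodType R, is_quotient_ring_module x M -> X M)
  (X_syzygies : forall M N : lmodType R, X M -> is_syzygy n.+1 M N ->
     torsionfree n.+1 N)
  (Ext_mod_stable : forall F P : mod_stable X, projective P ->
     Ext_zero (3 * n + 1)%N F P)
  (K P : nat -> lmodType R) (i : forall j, {linear K j.+1 -> P j})
  (p : forall j, {linear P j -> K j}) :
  (forall j, fg_projective (P j)) -> (forall j, short_exact (i j) (p j)) -> X (K 0%N) ->
  forall g0 : {linear K n.+1 -> R^o}, exists h : {linear P n -> R^o}, forall x, h (i n x) = g0 x.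
Proof.
move=> PP ses XM g0; apply: contrapT => nex.
have XP := X_pd_le X_resolving R_noetherian X_pd X_quotients.
have inclusion_factors S S' XA XB XC := @syzygy_inclusion_factors R X X_resolving n S S' Ext_mod_stable XA XB XC.
have mid : is_ideal m by case: m_local => -[].
have m1 : ~ m 1 by case: m_local => -[].
have munit := local_unit R_noetherian m_local.
have tf : torsionfree n.+1 (K n.+1) := X_syzygies _ _ XM (chain_is_syzygy n.+1 PP ses).
have [S [SC [q [B [C [f [g [ses' [it [w nw]]]]]]]]]] :=
  universal_extension R_noetherian PP ses tf nex.
have XA : X (sA S) := XP _ (syz_iter_pd_le it (fg_projective_rV R q)).
have XC : X (sC S) by rewrite SC.
have XB : X (sB S) := resolving_ext X_resolving (sP S) XA XC.
have [P0 [s [t [PP0 st]]]] := inclusion_factors S _ XA XB XC it (fg_projective_rV R q).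
have [||u [[v uv] uP]] := @unimodular_vector R m munit q
    (fun d => exists G : {linear B -> R^o}, forall x, G (f x) = dot x d).
- split; first by exists \0 => x; rewrite dot0r.
  move=> k x z [G GE] [G' G'E]; exists (k \*: G \+ G' : {linear _ -> _}) => x' /=.
  by rewrite GE G'E ![dot x' _]dotC dotDl dotZl.
- move=> all; have [d dE] := dot_functional w; apply: nw; have [G GE] := all d.
  by exists G => x; rewrite GE dE.
have [r [y [yP ymin]]] := minimal_generators mid munit R_noetherian.
have [c cE] : in_mM y (s (f u)).
  apply: (in_mM_proj yP PP0) => phi.
  have [d dE] := dot_functional (phi \o s \o f : {linear _ -> _}).
  rewrite -[phi _]/((phi \o s \o f : {linear _ -> _}) u) dE dotC; apply: uP.
  by exists (phi \o s : {linear _ -> _}) => x; rewrite -dE.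
have cy : (t \o c) y = f u by rewrite /= cE -st.
have [e0 e0E'] := rV_map (fun _ : 'I_1 => y).
have e0E x : e0 x = x 0 0 *: y by rewrite e0E' big_ord1.
have [C0 [k0 [k0s k0e]]] := coker_exists e0.
have CF : fin_gen C0 := fin_gen_surj k0s (fg_projective_rV R r).1.
have [T [rT [rTs rTe]]] := coker_exists (cor_codiff R_noetherian CF e0 k0 0).
have yT b (x : T) : dot y b *: x = 0.
  have [z <-] := rTs x; rewrite -linearZ; apply/rTe; exists (z 0 0 *: b).
  apply: dot_inj => x'; rewrite (cor_codiffE e0 k0 (i := 0)).
  transitivity (dot (x' 0 0 *: y) (z 0 0 *: b)); first by rewrite -e0E.
  have -> : dot x' (dot y b *: z) = dot y b * (x' 0 0 * z 0 0).
    by rewrite dotC; transitivity (dot y b * dot z x');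
      [exact: dotZl|rewrite {2}/dot big_ord1 [z 0 0 * _]mulrC].
  by rewrite dotZl [dot y (_ *: _)]dotC dotZl [dot b y]dotC mulrA mulrC.
have ac := acyclic_of_minimal (P := dual_resolution k0s k0e rTs rTe) yT it uv (st u) (ex_intro _ c cE).
have ses0 : short_exact e0 k0.
  by split=> //; exact: dual_acyclic_inj0 (ac 0%N (leq0n n)).
have ses1 j : (j < n)%N -> short_exact (cor_emb R_noetherian CF j) (cor_proj R_noetherian CF j).
  by move=> jn; split; [exact: dual_acyclic_inj (ac _ jn)|exact: cor_exact|exact: cor_proj_surj].
have appr j : left_approx (cor_emb R_noetherian CF j) by exact: cor_approx.
apply: (@coresolution_end_not_in_X R X X_resolving n inclusion_factors m mid m1 r y yP ymin e0
  (cor_mod R_noetherian CF) k0 (cor_dim R_noetherian CF) (cor_emb R_noetherian CF) (cor_proj R_noetherian CF)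
  e0E ses0 ses1 appr).
exact: (@coresolution_end_in_X R X X_resolving n XP r y e0 (cor_mod R_noetherian CF) k0
  (cor_dim R_noetherian CF) (cor_emb R_noetherian CF) (cor_proj R_noetherian CF) e0E ses0 ses1 appr
  S q B C f g ses' u v (t \o c : {linear _ -> _}) XC it uv cy).
Qed.

End Main.

Theorem theorem4p2 (R : comNzRingType) (n : nat) (X : lmodType R -> Prop)
  (R_noetherian : noetherian R)
  (R_henselian : henselian_local R)
  (X_resolving : resolving X)
  (X_pd : forall M : lmodType R, pd_lt n M -> X M)
  (X_quotients : forall x : n.-tuple R, regular_seq x ->
     forall M : lmodType R, is_quotient_ring_module x M -> X M)
  (X_syzygies : forall M N : lmodType R, X M -> is_syzygy n.+1 M N ->
     torsionfree n.+1 N)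
  (Ext_mod_stable : forall F P : mod_stable X, projective P ->
     Ext_zero (3 * n + 1)%N F P) :
  forall M : lmodType R, X M -> forall i : nat, (n < i)%N ->
    Ext_module_zero i M R^o.
Proof.
move=> M XM [//|j]; rewrite ltnS => nj P g g0.
have [m [m_local _]] := R_henselian.
(* The l-th syzygy of M takes the place of M, with the truncated resolution. *)
have [l e] : exists l, j = (n + l)%N by exists (j - n)%N; rewrite subnKC.
rewrite {j nj}e in g g0 *.
have XK j : X (res_syz P j).
  elim: j => [|j IH] //.
  exact: (@resolving_ker R X X_resolving _ _ _ _ _ (res_syz_ses P j) (resolving_proj X_resolving (fres_proj P j)) IH).
have [g1 g1E] : exists g1 : {linear res_syz P (n + l).+1 -> R^o}, forall x,
    g1 (res_syz_proj P (n + l).+1 x) = g x.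
  have [_ ke ps] := res_syz_ses P (n + l).+1.
  by apply: (lin_factor_surj ps) => x /ke[z <-];
    have [z' <-] := @im_surj _ _ _ _ (image_map (fres_d P (n + l).+1)) z; rewrite im_E g0.
have [h hE] := functionals_extend R_noetherian m_local X_resolving X_pd X_quotients X_syzygies
  Ext_mod_stable (K := fun a => res_syz P (a + l)) (P := fun a => P (a + l)%N)
  (i := fun a => res_syz_inc P (a + l)) (p := fun a => res_syz_proj P (a + l))
  (fun a => fres_proj P (a + l)) (fun a => res_syz_ses P (a + l)) (XK l) g1.
exists h => x; rewrite -g1E -hE.
by transitivity (h (res_syz_inc P (n + l) (res_syz_proj P (n + l).+1 x))); [rewrite res_syz_incE|].
Qed.
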